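(* Let $\Omega\subset\mathbb{R}^d$ be a bounded domain with smooth boundary, $H\in C^1(\overline{\Omega};\mathbb{R}^d)$ with $|H(x)|\ge\delta_0$ on $\overline{\Omega}$ for a constant $\delta_0>0$, and $p\in L^\infty(\Omega)$. Let $\{\Omega_i\}_{1\le i\le N}$ be a partition of $\Omega$ satisfying Conditions (B) and (C) defined in the context. Then there exists a constant $T_0>0$ depending on $H,\Omega$ such that for all $T>T_0$ we can find a constant $C>0$ such that $$\|u(\cdot,0)\|_{L^2(\Omega)}\le C\|u\|_{L^2(\partial\Omega\times(0,T))}$$ for all $u\in H^1(Q)$, $Q=\Omega\times(0,T)$, satisfying $$\partial_tu(x,t)+(H(x)\cdot\nabla u(x,t))+p(x)u(x,t)=0\quad\text{in }Q.$$ Here the constant $C>0$ depends on $\Omega$, $T$, $\varphi$, where $\varphi$ is the piecewise weight function described in the context.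
   Context: $(v\cdot w)$ is the Euclidean scalar product, $S^{d-1}$ the unit sphere of $\mathbb{R}^d$, $\nabla$ the gradient in $x$, and $\nu(x)$ the outward unit normal to $\partial\Omega$ at $x$. Boundary, initial and final values are traces. Partition: $\overline{\Omega}=\bigcup_{i=1}^N\overline{\Omega_i}$, where $\Omega_i\subset\Omega$ are non-empty pairwise disjoint subdomains. For $i\ne j$ put $\gamma_{ij}:=\partial\Omega_i\cap\partial\Omega_j$ and let $|\gamma_{ij}|$ be its surface measure; it is assumed that $\gamma_{ij}$ is of piecewise $C^2$-class whenever $|\gamma_{ij}|>0$. Interfaces with $|\gamma_{ij}|=0$ are neglected. $\nu_{i\to j}$ is the unit normal vector to $\gamma_{ij}$ directed from $\Omega_i$ towards $\Omega_j$ (so $\nu_{i\to j}=-\nu_{j\to i}$). Condition (B): (i) on each $\gamma_{ij}$ one of the following holds: $(H\cdot\nu_{i\to j})>0$ almost everywhere on $\gamma_{ij}$; or $(H\cdot\nu_{i\to j})<0$ almost everywhere on $\gamma_{ij}$; or $(H\cdot\nu_{i\to j})=0$ almost everywhere on $\gamma_{ij}$. (ii) For each $i=1,\dots,N$ there exist a constant $\delta_1>0$ and a constant vector $v_i\in S^{d-1}$ such that $(H(x)\cdot v_i)>\delta_1$ for all $x\in\overline{\Omega_i}$. Directed graph $\Lambda$ associated with the partition: there is one node $O_i$ for each $\Omega_i$; distinct nodes $O_i,O_j$ are connected by a segment $\Gamma_{ij}$ if and only if $|\gamma_{ij}|>0$ and $(H\cdot\nu_{i\to j})\neq0$ on $\gamma_{ij}$;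 the segment is directed from $O_i$ to $O_j$ if $(H\cdot\nu_{i\to j})>0$ a.e. on $\gamma_{ij}$, and from $O_j$ to $O_i$ if $(H\cdot\nu_{i\to j})<0$ a.e. on $\gamma_{ij}$. $\Lambda$ has a closed loop if one can choose a subset of its directed segments whose union is an oriented closed Jordan curve. Condition (C): the directed graph $\Lambda$ associated with the partition has no closed loops. Weight $\varphi$: $\varphi=\varphi_i$ in $Q_i:=\Omega_i\times(0,T)$, where $\varphi_i(x,t)=|x+r_iv_i|^2-\beta t$, $1\le i\le N$, with the vectors $v_i$ of Condition (B)(ii) and constants $r_i>0$, $\beta>0$ which, under Conditions (B) and (C), can be found so that the following Carleman estimate holds: there are constants $C>0$, $s_0>0$ with $$s\sum_{i=1}^N\int_{\Omega_i}|u(x,0)|^2e^{2s\varphi_i(x,0)}dx+s^2\sum_{i=1}^N\int_{Q_i}|u|^2e^{2s\varphi_i}dxdt+s\int_{\partial\Omega_-\times(0,T)}|u|^2e^{2s\varphi}dSdt$$ $$\le C\sum_{i=1}^N\int_{Q_i}|\partial_tu+(H\cdot\nabla u)+pu|^2e^{2s\varphi_i}dxdt+Cs\int_{\partial\Omega_+\times(0,T)}|u|^2e^{2s\varphi}dSdt+Cs\sum_{i=1}^N\int_{\Omega_i}|u(x,T)|^2e^{2s\varphi_i(x,T)}dx$$ for all $s>s_0$ and $u\in H^1(Q)$, where $\partial\Omega_+:=\{x\in\partial\Omega:(H(x)\cdot\nu(x))\ge0\}$ and $\partial\Omega_-:=\{x\in\partial\Omega:(H(x)\cdot\nu(x))<0\}$.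 *)

(* Defs.v *)
From HB Require Import structures.
From mathcomp Require Import all_boot all_order all_algebra.
From mathcomp Require Import all_classical all_reals all_analysis.

Set Implicit Arguments.
Unset Strict Implicit.
Unset Printing Implicit Defensive.

Import Order.TTheory GRing.Theory Num.Theory.
Import numFieldNormedType.Exports.

Local Open Scope classical_set_scope.
Local Open Scope ring_scope.

(* 'rV[R]_n carries the sup norm in the library; it induces the usual topology,
   but lengths, unit vectors and diameters below are Euclidean. *)
Section Euclidean.
Context {R : realType} {n : nat}.
Implicit Types x y : 'rV[R]_n.

Definition dotv x y : R := \sum_i x 0 i * y 0 i.

Definition enorm x : R := Num.sqrt (dotv x x).

Definition grad (f : 'rV[R]_n -> R) x : 'rV[R]_n :=
  \row_i 'D_(delta_mx 0 i : 'rV[R]_n) f x.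

End Euclidean.

Section Calculus.
Context {R : realType} {V : normedModType R}.

Fixpoint Ck (k : nat) (f : V -> R) : Prop :=
  match k with
  | 0 => continuous f
  | k'.+1 => (forall x, differentiable f x) /\ forall v, Ck k' ('D_v f)
  end.

Definition smooth (f : V -> R) : Prop := forall k, Ck k f.

Definition bdry (A : set V) : set V := closure A `\` interior A.

Definition domain (A : set V) : Prop := [/\ open A, connected A & A !=set0].

End Calculus.

(* Product sigma-algebra on R^n, generated by the coordinates: this is the
   Borel sigma-algebra. *)
Section RowVectorMeasurable.
Context {R : realType} {n : nat}.

Definition rV_coord (i : 'I_n) (x : 'rV[R]_n) : measurableTypeR R := x 0 i.

Let rV_set0 : g_sigma_preimage rV_coord set0.
Proof. exact: sigma_algebra0. Qed.

Let rV_setC A : g_sigma_preimage rV_coord A -> g_sigma_preimage rV_coord (~` A).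
Proof. exact: sigma_algebraC. Qed.

Let rV_bigcup (F : _^nat) : (forall i, g_sigma_preimage rV_coord (F i)) ->
  g_sigma_preimage rV_coord (\bigcup_i (F i)).
Proof. exact: sigma_algebra_bigcup. Qed.

HB.instance Definition _ := @isMeasurable.Build
  (measure_tuple_display (sigma_display R.-ocitv.-measurable)) 'rV[R]_n
  (g_sigma_preimage rV_coord) rV_set0 rV_setC rV_bigcup.

Lemma measurable_rV_coord i : measurable_fun [set: 'rV[R]_n] (rV_coord i).
Proof.
move=> _ Y mY; rewrite setTI; apply: sub_sigma_algebra => /=.
rewrite -bigcup_seq/=; exists i => /=; first by rewrite mem_index_enum.
by exists Y => //; rewrite setTI.
Qed.

Lemma measurable_fun_rV d (T : measurableType d) (f : T -> 'rV[R]_n) :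
  (forall i, measurable_fun [set: T] (rV_coord i \o f)) ->
  measurable_fun [set: T] f.
Proof.
move=> mf; apply: (@measurability _ _ _ _ setT f
  (\big[setU/set0]_(i < n) preimage_set_system setT (rV_coord i) measurable)) => //.
move=> _ [C + <-]; rewrite -bigcup_seq/= => -[i _ [A mA <-]].
rewrite !setTI; have := mf i measurableT A mA.
by rewrite setTI comp_preimage.
Qed.

End RowVectorMeasurable.

Section Lebesgue.
Context {R : realType}.

Definition rV_cons n (z : 'rV[R]_n * measurableTypeR R) : 'rV[R]_n.+1 :=
  row_mx ((z.2 : R)%:M : 'rV[R]_1) z.1.

Lemma measurable_rV_cons n : measurable_fun setT (@rV_cons n).
Proof.
apply: measurable_fun_rV => i.
have [i0|i0] := eqVneq i ord0.
  have -> : rV_coord i \o @rV_cons n = snd.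
    apply/funext => z; rewrite /= /rV_coord /rV_cons i0.
    have -> : (ord0 : 'I_n.+1) = lshift n (ord0 : 'I_1) by apply/val_inj.
    by rewrite (row_mxEl (z.2%:M : 'rV_1)) mxE eqxx mulr1n.
  exact: measurable_snd.
have [j ij] : exists j : 'I_n, i = rshift 1 j.
  case: (unliftP ord0 i) i0 => [j ->|->]; last by rewrite eqxx.
  by exists j; apply/val_inj.
have -> : rV_coord i \o @rV_cons n = rV_coord j \o fst.
  by apply/funext => z; rewrite /= /rV_coord /rV_cons ij (row_mxEr (z.2%:M : 'rV_1)).
by apply: measurableT_comp; [exact: measurable_rV_coord|exact: measurable_fst].
Qed.

Definition lebesgue_step n (m : {measure set 'rV[R]_n -> \bar R}) :
    {measure set 'rV[R]_n.+1 -> \bar R} :=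
  measure_function_pushforward__canonical__measure_function_Measure
    (m \x lebesgue_measure)%E (@measurable_rV_cons n).

Fixpoint lebesgue_rV n : {measure set 'rV[R]_n -> \bar R} :=
  match n with
  | 0 => dirac (0 : 'rV[R]_0)
  | n'.+1 => lebesgue_step (lebesgue_rV n')
  end.

Lemma lebesgue_rVS n (A : set 'rV[R]_n.+1) :
  lebesgue_rV n.+1 A = (lebesgue_rV n \x lebesgue_measure)%E (@rV_cons n @^-1` A).
Proof. by []. Qed.

End Lebesgue.

(* The k-dimensional Hausdorff measure on R^n, normalized so that it agrees with
   the area of k-dimensional surfaces. *)
Section Hausdorff.
Context {R : realType} {n : nat} (k : nat).
Implicit Types (A E : set 'rV[R]_n) (delta : R).
Local Open Scope ereal_scope.

Definition ediam E : \bar R :=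
  ereal_sup [set (enorm (z.1 - z.2)%R)%:E | z in E `*` E].

Definition unit_ball_volume : \bar R :=
  lebesgue_rV k [set x : 'rV[R]_k | enorm x <= 1]%R.

Definition hausdorff_weight delta E : \bar R :=
  if pselect (E = set0) then 0 else
  if ediam E <= delta%:E
  then unit_ball_volume * ((2 ^- k)%:E * ediam E ^+ k) else +oo.

Definition hausdorff_pre delta A : \bar R :=
  ereal_inf [set \sum_(i <oo) hausdorff_weight delta (F i) |
             F in [set F : (set 'rV[R]_n)^nat | A `<=` \bigcup_i F i]].

Definition hausdorff A : \bar R :=
  ereal_sup [set hausdorff_pre delta A | delta in [set delta : R | 0 < delta]%R].

Lemma ediam_ge0 E : E !=set0 -> 0 <= ediam E.
Proof.
move=> [x Ex]; apply: ereal_sup_ubound; exists (x, x) => //=.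
by rewrite subrr /enorm /dotv big1 ?sqrtr0// => i _; rewrite mxE mul0r.
Qed.

Lemma hausdorff_weight_ge0 delta E : 0 <= hausdorff_weight delta E.
Proof.
rewrite /hausdorff_weight; case: pselect => //= E0.
have {}E0 : E !=set0 by apply/set0P/eqP.
case: ifPn => // _; rewrite mule_ge0 ?measure_ge0// mule_ge0//.
by rewrite expe_ge0// ediam_ge0.
Qed.

Lemma hausdorff_weight0 delta : hausdorff_weight delta set0 = 0.
Proof. by rewrite /hausdorff_weight; case: pselect. Qed.

(* All sets measurable, so that the covers used by [mu_ext] are arbitrary. *)
Let D := g_sigma_algebraType [set: set 'rV[R]_n].

Let mD (A : set D) : measurable A.
Proof. exact: sub_sigma_algebra. Qed.

Let hausdorff_preE delta :
  hausdorff_pre delta = @mu_ext _ D R (hausdorff_weight delta).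
Proof.
apply/funext => A; rewrite /hausdorff_pre /mu_ext; congr ereal_inf.
apply/seteqP; split=> [_ [F AF <-]|_ [F [_ AF] <-]]; exists F => //.
Qed.

Lemma hausdorff_set0 : hausdorff set0 = 0.
Proof.
have pre0 delta : hausdorff_pre delta set0 = 0.
  rewrite hausdorff_preE; apply: mu_ext0; first exact: hausdorff_weight0.
  exact: hausdorff_weight_ge0.
apply/eqP; rewrite eq_le; apply/andP; split.
  by apply: ge_ereal_sup => _ [delta _ <-]; rewrite pre0.
by apply: ereal_sup_ubound; exists 1%R => //=; rewrite ?ltr01 ?pre0.
Qed.

Lemma hausdorff_ge0 A : 0 <= hausdorff A.
Proof.
apply: (@le_trans _ _ (hausdorff_pre 1 A)).
  by rewrite hausdorff_preE; apply: mu_ext_ge0; exact: hausdorff_weight_ge0.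
by apply: ereal_sup_ubound; exists 1%R => //=; rewrite ltr01.
Qed.

Lemma le_hausdorff : {homo hausdorff : A B / A `<=` B >-> A <= B}.
Proof.
move=> A B AB; apply: ge_ereal_sup => _ [delta d0 <-].
apply: (@le_trans _ _ (hausdorff_pre delta B)).
  by rewrite hausdorff_preE; exact: le_mu_ext.
by apply: ereal_sup_ubound; exists delta.
Qed.

Lemma hausdorff_sigma_subadditive : sigma_subadditive hausdorff.
Proof.
move=> F; apply: ge_ereal_sup => _ [delta d0 <-].
apply: (@le_trans _ _ (\sum_(i <oo) hausdorff_pre delta (F i))).
  rewrite hausdorff_preE; apply: mu_ext_sigma_subadditive.
  exact: hausdorff_weight_ge0.
apply: lee_nneseries => [i _ _|i _].
  by rewrite hausdorff_preE; apply: mu_ext_ge0; exact: hausdorff_weight_ge0.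
by apply: ereal_sup_ubound; exists delta.
Qed.

HB.instance Definition _ := isOuterMeasure.Build R 'rV[R]_n hausdorff
  hausdorff_set0 hausdorff_ge0 le_hausdorff hausdorff_sigma_subadditive.

End Hausdorff.

(* (d-1)-dimensional surface measure, as a measure on its Caratheodory
   sigma-algebra. *)
Section Surface.
Context {R : realType}.

Definition surface_outer (d : nat) : {outer_measure set 'rV[R]_d -> \bar R} :=
  @hausdorff R d d.-1.

Definition surface_space (d : nat) := caratheodory_type (surface_outer d).

Definition surface (d : nat) : {measure set surface_space d -> \bar R} :=
  (surface_outer d : set (caratheodory_type (surface_outer d)) -> \bar R).

End Surface.

Section Domains.
Context {R : realType} {d : nat}.
Implicit Types (M K Om : set 'rV[R]_d) (x nu : 'rV[R]_d).

(* Near x, the set M is the zero set of rho, a C^k function with nonvanishing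
   gradient. *)
Definition defining_function (k : nat) M x (rho : 'rV[R]_d -> R) : Prop :=
  [/\ Ck k rho, grad rho x != 0 & \forall y \near x, M y <-> rho y = 0].

Definition C2_hypersurface M : Prop :=
  forall x, M x -> exists rho, defining_function 2 M x rho.

Definition smooth_boundary Om : Prop :=
  forall x, bdry Om x -> exists rho : 'rV[R]_d -> R,
    [/\ smooth rho, grad rho x != 0 & \forall y \near x, Om y <-> rho y < 0].

(* C^1 in Om, together with derivatives that extend continuously to the closure *)
Definition C1_closure Om (H : 'rV[R]_d -> 'rV[R]_d) : Prop :=
  {within closure Om, continuous H} /\
  forall v, exists2 G : 'rV[R]_d -> 'rV[R]_d, {within closure Om, continuous G} &
    forall x, Om x -> differentiable H x /\ 'D_v H x = G x.

(* A finite union of compact pieces of C^2 hypersurfaces, each piece K having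
   boundary K `&` closure (M `\` K), relative to its hypersurface M, of measure
   zero, any two pieces overlapping in a set of measure zero. *)
Definition piecewise_C2 (gam : set 'rV[R]_d) : Prop :=
  exists m (K M : 'I_m -> set 'rV[R]_d),
    [/\ gam = \bigcup_i K i,
        forall i, [/\ compact (K i), K i `<=` M i & C2_hypersurface (M i)],
        forall i, surface d (K i `&` closure (M i `\` K i)) = 0%E &
        forall i j, i != j -> surface d (K i `&` K j) = 0%E].

End Domains.

Section Partition.
Context {R : realType} {d N : nat}.
Variables (H : 'rV[R]_d -> 'rV[R]_d) (Omi : 'I_N -> set 'rV[R]_d).

Definition interface i j : set 'rV[R]_d := bdry (Omi i) `&` bdry (Omi j).

Definition is_partition (Om : set 'rV[R]_d) : Prop :=
  [/\ forall i, domain (Omi i) /\ Omi i `<=` Om,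
      forall i j, i != j -> Omi i `&` Omi j = set0,
      closure Om = \bigcup_i closure (Omi i) &
      forall i j, i != j -> (0 < surface d (interface i j))%E ->
        piecewise_C2 (interface i j)].

(* nu is the unit normal at x to the interface, directed from the i-th to the
   j-th subdomain *)
Definition interface_normal i j (x nu : 'rV[R]_d) : Prop :=
  [/\ enorm nu = 1,
      exists2 rho, defining_function 2 (interface i j) x rho &
        exists c : R, nu = c *: grad rho x &
      \forall t \near (0 : R)^'+, Omi i (x - t *: nu) /\ Omi j (x + t *: nu)].

(* The sign condition P (H . nu_{i -> j}) holds a.e. on the interface. The
   existence of the normal a.e., implicit in the notation nu_{i -> j}, is part of
   the condition. *)
Definition ae_flux (P : R -> Prop) i j : Prop :=
  {ae surface d, forall x, interface i j x ->
     exists2 nu, interface_normal i j x nu & P (dotv (H x) nu)}.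

Definition ConditionB : Prop :=
  (forall i j, i != j -> [\/ ae_flux (fun r => 0 < r) i j,
                             ae_flux (fun r => r < 0) i j |
                             ae_flux (fun r => r = 0) i j]) /\
  (forall i, exists2 delta1 : R, 0 < delta1 & exists2 v : 'rV[R]_d, enorm v = 1 &
     forall x, closure (Omi i) x -> delta1 < dotv (H x) v).

(* One orientation suffices: nu_{j -> i} = - nu_{i -> j}, so H . nu_{i -> j} > 0
   is the same as H . nu_{j -> i} < 0. *)
Definition Lambda : rel 'I_N := fun i j =>
  `[< [/\ i != j, (0 < surface d (interface i j))%E &
          ae_flux (fun r => 0 < r) i j] >].

(* An oriented closed Jordan curve made of edges is a directed cycle through
   pairwise distinct nodes. *)
Definition ConditionC : Prop :=
  ~ exists2 c : seq 'I_N, c != [::] & ucycle Lambda c.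

End Partition.

Section Lebesgue_spaces.
Context {R : realType} {disp : measure_display} {T : measurableType disp}.
Variables (mu : {measure set T -> \bar R}) (D : set T).

Definition normL (q : \bar R) (f : T -> R) : \bar R :=
  ('N[mu]_q [EFin \o (f \_ D)])%E.

Definition inL (q : \bar R) (f : T -> R) : Prop :=
  measurable_fun D (f : T -> measurableTypeR R) /\ (normL q f < +oo)%E.

End Lebesgue_spaces.

Section Sobolev.
Context {R : realType} {d : nat}.
Let V := ('rV[R]_d * R)%type.
Implicit Types (Q : set V) (v : V) (u g : V -> R).

Definition dxdt : {measure set ('rV[R]_d * measurableTypeR R) -> \bar R} :=
  (lebesgue_rV d \x lebesgue_measure)%E.

Definition test_function Q (phi : V -> R) : Prop :=
  smooth phi /\
  exists K : set V, [/\ compact K, K `<=` Q & forall z, ~ K z -> phi z = 0].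

Definition is_weak_derivative Q v u g : Prop :=
  forall phi, test_function Q phi ->
    \int[dxdt]_(z in Q) (u z * 'D_v phi z) =
    - \int[dxdt]_(z in Q) (g z * phi z).

Definition is_L2_derivative Q v u : set (V -> R) :=
  [set g | inL dxdt Q 2%:E g /\ is_weak_derivative Q v u g].

(* By linearity, it is the same to ask for derivatives along all v in R^d x R as
   along the basis vectors. *)
Definition inH1 Q u : Prop :=
  inL dxdt Q 2%:E u /\ forall v, is_L2_derivative Q v u !=set0.

(* For u in H^1(Q), its weak derivative along v (defined a.e.) *)
Definition wderiv Q v u : V -> R := xget (fun=> 0) (is_L2_derivative Q v u).

Definition wderiv_t Q u : V -> R := wderiv Q ((0, 1) : V) u.

Definition wderiv_x Q (i : 'I_d) u : V -> R :=
  wderiv Q ((delta_mx 0 i, 0) : V) u.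

(* The trace operator is the continuous extension to H^1(Q), with values in
   L^2(S, mu), of the restriction w |-> w \o iota of functions smooth up to the
   boundary of Q. *)
Definition is_trace Q u disp (Y : measurableType disp)
    (mu : {measure set Y -> \bar R}) (S : set Y) (iota : Y -> V) (g : Y -> R)
    : Prop :=
  inL mu S 2%:E g /\
  exists w : nat -> V -> R,
    [/\ forall n, smooth (w n),
        normL dxdt Q 2%:E (fun z => w n z - u z) @[n --> \oo] --> 0%E,
        forall v, normL dxdt Q 2%:E (fun z => 'D_v (w n) z - wderiv Q v u z)
                    @[n --> \oo] --> 0%E &
        normL mu S 2%:E (fun y => w n (iota y) - g y) @[n --> \oo] --> 0%E].

End Sobolev.

Section Transport.
Context {R : realType} {d : nat}.
Variables (Om : set 'rV[R]_d) (T : R).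

Definition cylinder : set ('rV[R]_d * R) := Om `*` `]0, T[.

Definition lateral : set (surface_space d * measurableTypeR R) :=
  bdry Om `*` `]0, T[.

Definition dSdt :
    {measure set (@surface_space R d * measurableTypeR R) -> \bar R} :=
  (surface d \x lebesgue_measure)%E.

Definition transport_equation (H : 'rV[R]_d -> 'rV[R]_d) (p : 'rV[R]_d -> R)
    (u : 'rV[R]_d * R -> R) : Prop :=
  {ae dxdt, forall z, cylinder z ->
     wderiv_t cylinder u z + \sum_i H z.1 0 i * wderiv_x cylinder i u z
       + p z.1 * u z = 0}.

Definition initial_trace (u : 'rV[R]_d * R -> R) (u0 : 'rV[R]_d -> R) : Prop :=
  is_trace cylinder u (lebesgue_rV d) Om (fun x => (x, 0)) u0.

Definition lateral_trace (u : 'rV[R]_d * R -> R)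
    (ub : surface_space d * measurableTypeR R -> R) : Prop :=
  is_trace cylinder u dSdt lateral id ub.

End Transport.

(* Main.v *)
(* Extend [H] to a bounded Lipschitz field [F] on R^d and let [Phi] be its flow.

   Every point of [Om] leaves [Om] along [Phi] within a uniform time. The points that
   do not form an open set, so it is enough to consider a generic one, whose orbit
   avoids the null sets leading to an interface point without normal, with [F]
   tangent, or where two interfaces meet transversally. Then each crossing follows an
   edge of [Lambda]. This graph being acyclic, x . v_i / delta_i plus a large multiple
   of the rank of the i-th node grows along the orbit at unit rate at least, whereas it
   is bounded.

   For smooth [w], w(x, 0)^2 is bounded by the value of w^2 at the exit point plus the
   integral along the orbit of the square of the equation's residual. To integrate this
   over [Om], one needs that x |-> (exit point, exit time) and (x, t) |-> (Phi x t, t)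
   push Lebesgue measure to measures below multiples of dS dt and dx dt; this is checked
   on cubes, since the points whose orbit visits a set within a short time are covered
   by backward transport of a cover of that set. No divergence theorem is needed. One
   concludes by applying the estimate to smooth approximations of [u]; those provided by
   the initial and by the lateral trace are compared through the trace inequality at
   t = 0. *)

Require Import Defs.
From HB Require Import structures.
From mathcomp Require Import all_boot all_order all_algebra.
From mathcomp Require Import all_classical all_reals all_analysis.
From mathcomp Require Import measurable_realfun ess_sup_inf ring lra zify.

Set Implicit Arguments.
Unset Strict Implicit.
Unset Printing Implicit Defensive.

Import Order.TTheory GRing.Theory Num.Theory.
Import numFieldNormedType.Exports.

Local Open Scope classical_set_scope.
Local Open Scope ring_scope.

(** * Comparison of integrals through dyadic cells *)

(** Two kinds of objects are merely lower semicontinuous: the exit time, because an orbit touching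
    the boundary from inside stops there while its neighbours may go on, and the continuous
    functions cut off by the indicator of an open set. This is why measures are compared on
    half-open dyadic cubes and integrals on lower semicontinuous integrands. The points where the
    field is tangent to an interface may have positive area, so it is not their size that makes
    their orbits negligible but their flatness: a piece of size 1/m stays within eps/m of a
    hyperplane containing the field, and so does all that it sweeps in a time 1/m. The same
    flatness, in a direction combining two normals, treats the intersection of two interfaces
    without any measure of dimension d - 2. The potential is only bounded and [u] has only weak
    derivatives: neither is ever restricted to an orbit. Orbits see smooth functions, and the
    residual is replaced by the continuous [defect], which no longer involves the potential. *)

Section CellComparison.
Context {R : realType} {disp : measure_display} {X : measurableType disp}.
Variables (c : nat -> X -> nat).
Hypothesis mc : forall n k, measurable (c n @^-1` [set k]).
Hypothesis c_refine : forall n x y, c n.+1 x = c n.+1 y -> c n x = c n y.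
Variable g : X -> R.
Hypothesis g_ge0 : forall x, 0 <= g x.
Hypothesis g_lsc : forall x e, 0 < e ->
  exists n, forall y, c n y = c n x -> g x - e <= g y.

(* By lower semicontinuity [g] is the increasing limit of its infima over the cells
   of generation [n], so that comparing the measures of cells is enough. *)
Let G n k : R := inf [set g y | y in c n @^-1` [set k]].
Let gn n x : R := G n (c n x).

Let G_ge0 n k : 0 <= G n k.
Proof.
rewrite /G; have [->|/set0P[x xk]] := eqVneq (c n @^-1` [set k]) set0.
  by rewrite image_set0 inf0.
by apply: lb_le_inf; [exists (g x), x|move=> _ [y _ <-]].
Qed.

Let lb n k : has_lbound [set g y | y in c n @^-1` [set k]].
Proof. by exists 0 => _ [y _ <-]. Qed.

Let gn_le n x : gn n x <= g x.
Proof. by apply: ge_inf; [exact: lb|exists x]. Qed.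

Let gn_ge0 n x : 0 <= gn n x.
Proof. by apply: lb_le_inf; [exists (g x), x|move=> _ [y _ <-]]. Qed.

Let refine n m x y : (n <= m)%N -> c m x = c m y -> c n x = c n y.
Proof.
elim: m => [|m IH]; first by rewrite leqn0 => /eqP ->.
rewrite leq_eqVlt => /predU1P[-> //|]; rewrite ltnS => nm /c_refine; exact: IH.
Qed.

Let gn_homo x : {homo gn^~ x : n m / (n <= m)%N >-> n <= m}.
Proof.
move=> n m nm; apply: lb_le_inf; first by exists (g x), x.
move=> _ [y /= yx <-]; apply: ge_inf; first exact: lb.
by exists y => //=; exact: (refine nm).
Qed.

Let gn_cvg x : gn ^~ x @ \oo --> g x.
Proof.
apply/cvgrPdist_le => e e0; have [n hn] := g_lsc x e0.
exists n => // m /= nm; rewrite ger0_norm ?subr_ge0// lerBlDr -lerBlDl.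
apply: lb_le_inf; first by exists (g x), x.
by move=> _ [y /= yx <-]; apply: hn; exact: (refine nm).
Qed.

Let measurable_gn n : measurable_fun setT (gn n).
Proof.
move=> _ Y mY; rewrite setTI.
have -> : gn n @^-1` Y = \bigcup_(k in [set k | Y (G n k)]) (c n @^-1` [set k]).
  apply/seteqP; split=> [x Yx|x [k /= Yk xk]]; first by exists (c n x).
  by rewrite /= /gn xk.
exact: bigcup_measurable.
Qed.

Lemma measurable_cell_lsc : measurable_fun setT (g : X -> measurableTypeR R).
Proof. by apply: (measurable_fun_cvg measurable_gn) => x _; exact: gn_cvg. Qed.

Let integral_gn (mu : {measure set X -> \bar R}) n :
  (\int[mu]_x (gn n x)%:E = \sum_(k <oo) (G n k)%:E * mu (c n @^-1` [set k]))%E.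
Proof.
have UT : \bigcup_k (c n @^-1` [set k]) = [set: X].
  by apply/seteqP; split=> // x _; exists (c n x).
rewrite -UT ge0_integral_bigcup//.
- apply: eq_eseriesr => k _; rewrite -integral_cst//.
  by apply: eq_integral => x /[!inE]/= xk; rewrite /gn xk.
- by rewrite UT; apply/measurable_EFinP; exact: measurable_gn.
- by move=> x _; rewrite lee_fin.
- by move=> i j _ _ [x [/= <- <-]].
Qed.

(** The integral of each step function [gn] depends on the measure only through the masses of cells,
    and monotone convergence passes to [g] even when the measures are infinite. *)
Lemma ge0_le_integral_cells (mu nu : {measure set X -> \bar R}) :
    (forall n k, mu (c n @^-1` [set k]) <= nu (c n @^-1` [set k]))%E ->
  (\int[mu]_x (g x)%:E <= \int[nu]_x (g x)%:E)%E.
Proof.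
move=> le_mu.
have cvgE (m : {measure set X -> \bar R}) :
    (\int[m]_x (gn n x)%:E)%E @[n --> \oo] --> (\int[m]_x (g x)%:E)%E.
  have -> : (\int[m]_x (g x)%:E = \int[m]_x limn (fun n => (gn n x)%:E))%E.
    apply: eq_integral => x _; apply/esym/cvg_lim => //.
    by apply/fine_cvgP; split; [exact: nearW|exact: gn_cvg].
  apply: cvg_monotone_convergence => //.
  - by move=> n; apply/measurable_EFinP; exact: measurable_gn.
  - by move=> n x _; rewrite lee_fin.
  - by move=> x _ i j ij; rewrite lee_fin gn_homo.
rewrite -(cvg_lim _ (cvgE mu))// -(cvg_lim _ (cvgE nu))//.
apply: lee_lim; [exact: cvgP (cvgE mu)|exact: cvgP (cvgE nu)|].
apply: nearW => n; rewrite !integral_gn; apply: lee_nneseries => k _ //.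
  by rewrite mule_ge0// lee_fin.
by apply: lee_wpmul2l; [rewrite lee_fin|exact: le_mu].
Qed.

End CellComparison.

(** * Half-open cubes and the dyadic grid *)

Section Cubes.
Context {R : realType}.

(** Half-open, so that the dyadic cubes of a given size tile the space. *)
Definition cube n (a : 'rV[R]_n) (s : R) : set 'rV[R]_n :=
  [set x | forall i, a 0 i <= x 0 i < a 0 i + s].

Lemma measurable_cube n (a : 'rV[R]_n) s : measurable (cube a s).
Proof.
have -> : cube a s = \bigcap_(i : 'I_n) (rV_coord i @^-1` `[a 0 i, a 0 i + s[).
  apply/seteqP; split=> [x ax i _|x ax i]; first by rewrite /= in_itv /= ax.
  by have := ax i I; rewrite /= in_itv.
apply: fin_bigcap_measurable => [|i _]; first exact: finite_finset.
rewrite -[X in measurable X]setTI; apply: measurable_rV_coord => //.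
Qed.

Lemma lebesgue_cube n (a : 'rV[R]_n) s : 0 <= s ->
  lebesgue_rV n (cube a s) = (s ^+ n)%:E.
Proof.
move=> s0; elim: n a => [|n IH] a.
  by rewrite /= diracE mem_set ?expr0// => -[].
rewrite lebesgue_rVS.
have -> : @rV_cons R n @^-1` cube a s =
    cube (\row_j a 0 (lift ord0 j)) s `*` `[a 0 ord0, a 0 ord0 + s[.
  apply/seteqP; split=> [[x t] /= h|[x t] /= [h1 h2] i].
    split=> [i|].
      have := h (lift ord0 i); rewrite mxE /rV_cons.
      have -> : lift ord0 i = rshift 1 i by apply/val_inj.
      by rewrite (row_mxEr (t%:M : 'rV_1)).
    have := h ord0; rewrite /rV_cons in_itv.
    have -> : (ord0 : 'I_n.+1) = lshift n (ord0 : 'I_1) by apply/val_inj.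
    by rewrite (row_mxEl (t%:M : 'rV_1)) mxE eqxx mulr1n.
  case: (unliftP ord0 i) => [j ->|->].
    have := h1 j; rewrite mxE /rV_cons.
    have -> : lift ord0 j = rshift 1 j by apply/val_inj.
    by rewrite (row_mxEr (t%:M : 'rV_1)).
  move: h2; rewrite /rV_cons in_itv.
  have -> : (ord0 : 'I_n.+1) = lshift n (ord0 : 'I_1) by apply/val_inj.
  by rewrite (row_mxEl (t%:M : 'rV_1)) mxE eqxx mulr1n.
rewrite product_measure1E//; last exact: measurable_cube.
transitivity ((s ^+ n)%:E * s%:E)%E; last by rewrite -EFinM exprSr.
congr (_ * _)%E; first exact: IH.
rewrite -[LHS]/(lebesgue_measure _) lebesgue_measure_itv /= lte_fin ltrDl.
case: ifPn => [_|]; first by rewrite -EFinB addrC addKr.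
by rewrite -leNgt => s0'; rewrite (@le_anti _ _ s 0) ?s0 ?s0'.
Qed.

Lemma bigcup_cubeT n : \bigcup_k cube (const_mx (- k%:R) : 'rV[R]_n) k.*2%:R = setT.
Proof.
apply/seteqP; split=> // x _.
have [k hk] : exists k : nat, forall i, `|x 0 i| < k%:R.
  exists (\sum_i (Num.truncn `|x ord0 i|).+1)%N => i.
  apply: (lt_le_trans (truncnS_gt _)); rewrite ler_nat.
  by rewrite (bigD1 i)//= leq_addr.
exists k => // i; rewrite mxE -addnn natrD addrC addrK.
by move: (hk i); rewrite ltr_norml => /andP[/ltW -> ->].
Qed.

Lemma sigma_finite_lebesgue_rV n : sigma_finite setT (@lebesgue_rV R n).
Proof.
exists (fun k => cube (const_mx (- k%:R) : 'rV[R]_n) k.*2%:R).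
  by rewrite bigcup_cubeT.
move=> k; split; first exact: measurable_cube.
by rewrite lebesgue_cube// ltry.
Qed.

End Cubes.

Section Grid.
Context {R : realType} {d : nat}.
Let V := ('rV[R]_d * R)%type.
Let X := ('rV[R]_d * measurableTypeR R)%type.

Lemma coord_le_norm (x : 'rV[R]_d) i : `|x 0 i| <= `|x|.
Proof.
rewrite [leRHS]/Num.norm/= mx_normrE.
by apply: (le_bigmax _ (fun ij : 'I_1 * 'I_d => `|x ij.1 ij.2|) (0, i)).
Qed.

Lemma norm_le_coord (x : 'rV[R]_d) e : 0 <= e -> (forall i, `|x 0 i| <= e) -> `|x| <= e.
Proof.
move=> e0 h; rewrite [leLHS]/Num.norm/= mx_normrE; apply: bigmax_le => //.
by move=> [i j] _ /=; rewrite ord1.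
Qed.

(* The number of the half-open dyadic cube of side 2^-n that contains [z]. *)
Definition grid (n : nat) (z : X) : nat :=
  pickle (\row_i Num.floor (2 ^+ n * z.1 0 i), Num.floor (2 ^+ n * (z.2 : R))).

Lemma floor_eqE (x : R) (m : int) : (Num.floor x == m) = (m%:~R <= x < m%:~R + 1).
Proof.
rewrite eq_le floor_ge_int -ltzD1 floor_lt_int intrD andbC.
by [].
Qed.

Lemma floor_scale_eqE n (x : R) (m : int) : (Num.floor (2 ^+ n * x) == m) =
  (m%:~R * 2 ^- n <= x < m%:~R * 2 ^- n + 2 ^- n).
Proof.
have p : 0 < (2 : R) ^+ n by rewrite exprn_gt0.
rewrite floor_eqE -[in X in _ = (_ && (_ < _ + X))](mul1r (2 ^- n)) -mulrDl.
by rewrite ler_pdivrMr// ltr_pdivlMr// mulrC.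
Qed.

Lemma grid_fiber n k : grid n @^-1` [set k] = set0 \/
  exists a b, grid n @^-1` [set k] = cube a (2 ^- n) `*` `[b, b + 2 ^- n[.
Proof.
have [->|/set0P[z0 /= z0k]] := eqVneq (grid n @^-1` [set k]) set0; first by left.
right; set m := (\row_i Num.floor (2 ^+ n * z0.1 0 i), Num.floor (2 ^+ n * (z0.2 : R))).
exists (\row_i ((m.1 0 i)%:~R * 2 ^- n)), (m.2%:~R * 2 ^- n).
apply/seteqP; split=> z /=.
  rewrite -z0k => /(pcan_inj pickleK) [e1 e2]; split=> [i|].
    by rewrite mxE -floor_scale_eqE; move/rowP: e1 => /(_ i); rewrite !mxE => ->.
  by rewrite in_itv /= -floor_scale_eqE e2.
move=> [h1 h2]; rewrite -z0k; congr pickle; congr pair.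
  apply/rowP => i; rewrite !mxE; apply/eqP; rewrite floor_scale_eqE.
  by have := h1 i; rewrite !mxE.
by apply/eqP; rewrite floor_scale_eqE; move: h2; rewrite in_itv.
Qed.

Lemma measurable_grid n k : measurable (grid n @^-1` [set k]).
Proof.
have [->//|[a [b ->]]] := grid_fiber n k.
by apply: measurableX => //; exact: measurable_cube.
Qed.

Lemma floor_refine n (x y : R) : Num.floor (2 ^+ n.+1 * x) = Num.floor (2 ^+ n.+1 * y) ->
  Num.floor (2 ^+ n * x) = Num.floor (2 ^+ n * y).
Proof.
suff le (u v : R) : Num.floor (2 ^+ n.+1 * u) = Num.floor (2 ^+ n.+1 * v) ->
    (Num.floor (2 ^+ n * u) <= Num.floor (2 ^+ n * v))%R.
  by move=> e; apply: le_anti; rewrite !le.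
move=> e; rewrite floor_ge_int.
have h : (Num.floor (2 ^+ n * u) * 2)%:~R <= 2 ^+ n.+1 * u.
  rewrite intrM exprS mulrC -mulrA ler_pM2l//; exact: floor_le.
by rewrite -floor_ge_int e floor_ge_int intrM exprS mulrC -mulrA ler_pM2l in h.
Qed.

Lemma grid_refine n z1 z2 : grid n.+1 z1 = grid n.+1 z2 -> grid n z1 = grid n z2.
Proof.
move=> /(pcan_inj pickleK) [/rowP e1 e2]; congr pickle; congr pair.
  by apply/rowP => i; have := e1 i; rewrite !mxE; exact: floor_refine.
exact: floor_refine.
Qed.

Lemma floor_scale_dist n (x y : R) : Num.floor (2 ^+ n * x) = Num.floor (2 ^+ n * y) ->
  `|x - y| <= 2 ^- n.
Proof.
move=> e; have := floor_scale_eqE n x (Num.floor (2 ^+ n * y)).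
have := floor_scale_eqE n y (Num.floor (2 ^+ n * y)).
rewrite e eqxx => /esym/andP[h1 h2] /esym/andP[h3 h4].
rewrite ler_norml; apply/andP; split; lra.
Qed.

(** The points of the cell of [z] are within 2^-n of [z] in the sup norm, so that this cell ends up
    in any ball about [z]. *)
Lemma near_grid (P : V -> Prop) (z : V) : (\forall z' \near z, P z') ->
  exists n, forall z', grid n z' = grid n z -> P z'.
Proof.
move=> /nbhs_ballP[e /= e0 he].
have [n ne] : exists n, 2 ^- n < e :> R.
  have [n _ /(_ n (leqnn _))] := @near_infty_natSinv_expn_lt R (PosNum e0).
  by rewrite /= mul1r; exists n.
exists n => z' /(pcan_inj pickleK) [/rowP e1 e2]; apply: he; split => /=.
  rewrite -ball_normE /=; apply: le_lt_trans ne; apply: norm_le_coord => // i.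
  by rewrite !mxE distrC; apply: floor_scale_dist; have := e1 i; rewrite !mxE.
rewrite -ball_normE /=; apply: le_lt_trans ne; rewrite distrC.
exact: floor_scale_dist.
Qed.

Lemma measurable_lsc (g : X -> R) : (forall z, 0 <= g z) ->
  (forall (z : V) e, 0 < e -> \forall z' \near z, g z - e <= g z') ->
  measurable_fun setT (g : X -> measurableTypeR R).
Proof.
move=> g0 glsc; apply: (measurable_cell_lsc measurable_grid grid_refine g0).
by move=> z e e0; exact: near_grid (glsc z e e0).
Qed.

Lemma lsc_le_integral (mu nu : {measure set X -> \bar R}) (g : X -> R) :
  (forall z, 0 <= g z) ->
  (forall (z : V) e, 0 < e -> \forall z' \near z, g z - e <= g z') ->
  (forall a b s, 0 < s -> (mu (cube a s `*` `[b, (b + s)%R[%classic) <=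
                         nu (cube a s `*` `[b, (b + s)%R[%classic))%E) ->
  (\int[mu]_z (g z)%:E <= \int[nu]_z (g z)%:E)%E.
Proof.
move=> g0 glsc le_mu; apply: (ge0_le_integral_cells measurable_grid grid_refine g0).
  by move=> z e e0; exact: near_grid (glsc z e e0).
move=> n k; have [->|[a [b ->]]] := grid_fiber n k; first by rewrite !measure0.
by apply: le_mu; rewrite invr_gt0 exprn_gt0.
Qed.

Lemma open_measurable_rVR (U : set V) : open U -> measurable (U : set X).
Proof.
move=> oU; have := @measurable_lsc (\1_U : X -> R) (fun=> ltac:(by rewrite indicE)).
have h : forall (z : V) e, 0 < e -> \forall z' \near z, \1_U z - e <= \1_U z' :> R.
  move=> z e e0; have [Uz|Uz] := pselect (U z).
    near=> z'; rewrite !indicE mem_set// mem_set ?gerBl ?ltW//.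
    by near: z'; exact: open_nbhs_nbhs.
  near=> z'; rewrite !indicE memNset// sub0r.
  by rewrite (@le_trans _ _ 0)// oppr_le0 ltW.
move=> /(_ h) m1; have := m1 measurableT [set 1] (measurable_set1 _).
rewrite setTI; congr measurable; apply/seteqP; split=> z /=; rewrite indicE.
  by case: (boolP (z \in U)) => [/set_mem//|_] /eqP; rewrite eq_sym oner_eq0.
by move=> Uz; rewrite mem_set.
Unshelve. all: by end_near. Qed.

Lemma continuous_measurable_rVR (f : V -> R) : continuous f ->
  measurable_fun setT (f : X -> measurableTypeR R).
Proof.
move=> cf.
have pos (h : V -> R) : continuous h -> (forall z, 0 <= h z) ->
    measurable_fun setT (h : X -> measurableTypeR R).
  move=> ch h0; apply: measurable_lsc => // z e e0.
  have /cvgrPdist_le/(_ e e0) := ch z; apply: filterS => z'.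
  by rewrite ler_norml => /andP[_]; rewrite lerBlDr lerBlDl.
(* A difference of nonnegative continuous functions, as [pos] asks. *)
have -> : f = (fun z => (`|f z| + f z) - `|f z|).
  by apply/funext => z; rewrite addrC addKr.
apply: measurable_funB; apply: pos => z.
- by apply: cvgD; [apply: cvg_norm; exact: cf|exact: cf].
- by rewrite addrC -lerBlDl sub0r -normrN ler_norm.
- by apply: cvg_norm; exact: cf.
- by [].
Qed.

Lemma continuous_measurable_rV (f : 'rV[R]_d -> R) : continuous f ->
  measurable_fun setT (f : 'rV[R]_d -> measurableTypeR R).
Proof.
move=> cf.
have -> : f = (f \o fst) \o (fun x : 'rV[R]_d => (x, 0) : X) by [].
apply: measurableT_comp; last by apply: measurable_fun_pair => //; exact: measurable_cst.
apply: continuous_measurable_rVR => z.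
by apply: continuous_comp; [exact: cvg_fst|exact: cf].
Qed.

Lemma open_measurable_rV (U : set 'rV[R]_d) : open U -> measurable U.
Proof.
move=> oU.
have -> : U = (fun x : 'rV[R]_d => (x, 0) : X) @^-1` (fst @^-1` U) by [].
rewrite -[X in measurable X]setTI.
have m : measurable_fun setT (fun x : 'rV[R]_d => (x, 0) : X).
  by apply: measurable_fun_pair => //; exact: measurable_cst.
apply: m => //; apply: open_measurable_rVR.
by apply: open_comp => // z _; exact: cvg_fst.
Qed.

End Grid.

(** * Borel sets are measurable for the surface measure *)

Section MetricOuterMeasure.
Context {R : realType} {T : Type}.
Variable mu : {outer_measure set T -> \bar R}.
Variable f : T -> R.
Local Open Scope ereal_scope.
Hypothesis mu_sep : forall (A B : set T) (r : R), (0 < r)%R ->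
  (forall x y, A x -> B y -> f x + r <= f y)%R -> mu A + mu B <= mu (A `|` B).

Section fixed_set.
Variables (a : R) (X : set T).
Hypothesis muX : mu X < +oo.

Let A k := [set x | X x /\ (a + k.+1%:R^-1 <= f x)%R].
Let S k := [set x | X x /\ (a + k.+2%:R^-1 <= f x < a + k.+1%:R^-1)%R].

Let inv_lt (k j : nat) : (k < j)%N -> (j.+1%:R^-1 < k.+1%:R^-1 :> R)%R.
Proof. by move=> kj; rewrite ltf_pV2 ?posrE ?ltr0n// ltr_nat. Qed.

Let inv_le (k j : nat) : (k <= j)%N -> (j.+1%:R^-1 <= k.+1%:R^-1 :> R)%R.
Proof. by move=> kj; rewrite lef_pV2 ?posrE ?ltr0n// ler_nat. Qed.

Let AX k : mu (A k) <= mu X.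
Proof. by apply: le_outer_measure => x []. Qed.

(* Two shells of the same parity lie at a positive distance from each other. *)
Let sum_shell (o n : nat) :
  \sum_(0 <= j < n.+1) mu (S (o + j.*2)%N) <= mu (A (o + n.*2).+1).
Proof.
elim: n => [|n IH].
  by rewrite big_nat1 addn0; apply: le_outer_measure => x [Xx /andP[]].
rewrite big_nat_recr//=.
set m := (o + n.*2)%N in IH *; have -> : (o + n.+1.*2 = m.+2)%N by rewrite /m; lia.
apply: (@le_trans _ _ (mu (S m.+2 `|` A m.+1))).
  rewrite addeC; apply: (le_trans (leeD2l _ IH)).
  apply: (mu_sep (r := m.+2%:R^-1 - m.+3%:R^-1)); first by rewrite subr_gt0 inv_lt.
  move=> x y [_ /andP[_ hx]] [_ hy]; move: hx hy.
  by move: (m.+2%:R^-1)%R (m.+3%:R^-1)%R => p q; lra.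
apply: le_outer_measure => x [[Xx /andP[h _]]|[Xx h]]; split=> //.
by apply: le_trans h; rewrite lerD2l; apply: inv_le; rewrite ltnW.
Qed.

Let sum_shells n : \sum_(0 <= j < n) mu (S j) <= mu X + mu X.
Proof.
have even_odd k : \sum_(0 <= j < k.*2) mu (S j) =
    \sum_(0 <= j < k) mu (S (0 + j.*2)%N) + \sum_(0 <= j < k) mu (S (1 + j.*2)%N).
  elim: k => [|k IH]; first by rewrite !big_geq// adde0.
  rewrite doubleS !big_nat_recr//= IH -!addeA; congr (_ + _).
  by rewrite addeC -!addeA addeCA [in LHS]addeC -addeA; congr (_ + _); rewrite addeC.
apply: (@le_trans _ _ (\sum_(0 <= j < n.*2) mu (S j))).
  have nn : (n <= n.*2)%N by rewrite -addnn leq_addr.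
  by rewrite [leRHS](big_cat_nat (n := n))//= leeDl// sume_ge0// => *; exact: outer_measure_ge0.
have shell o : \sum_(0 <= j < n) mu (S (o + j.*2)%N) <= mu X.
  case: n => [|k]; first by rewrite big_geq// outer_measure_ge0.
  exact: le_trans (sum_shell _ _) (AX _).
by rewrite even_odd; exact: leeD (shell 0%N) (shell 1%N).
Qed.

Let cover k : [set x | X x /\ (a < f x)%R] `<=` A k `|` \bigcup_(j in ~` `I_k) S j.
Proof.
move=> x [Xx ax]; have [h|h] := leP (a + k.+1%:R^-1)%R (f x); first by left.
right.
have ex : exists j, (a + j.+2%:R^-1 <= f x)%R.
  have fxa : (0 < f x - a)%R by rewrite subr_gt0.
  have [j _ hj] := near_infty_natSinv_lt (PosNum fxa).
  by exists j; rewrite -lerBrDl ltW//; exact: hj j.+1 (leqnSn _).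
case: (ex_minnP ex) => j hj jmin; exists j.
  rewrite /= => jk; move: h; rewrite ltNge => /negP; apply; apply: le_trans hj.
  by rewrite lerD2l inv_le.
split=> //; rewrite hj /=; case: j hj jmin => [|j] hj jmin.
  by apply: (lt_le_trans h); rewrite lerD2l inv_le.
by rewrite ltNge; apply/negP => /jmin; rewrite ltnn.
Qed.

(** Caratheodory's argument for metric outer measures. The sets [A k] are at a positive distance
    from the half-space, where [mu_sep] gives additivity; what they miss of its complement is
    covered by the shells [S j] with j >= k, whose total measure tends to 0 because the series of
    all shells is bounded by twice the measure of [X]. *)
Lemma separated_halfspace :
  mu (X `&` [set x | f x <= a]%R) + mu (X `&` ~` [set x | f x <= a]%R) <= mu X.
Proof.
have -> : X `&` ~` [set x | f x <= a]%R = [set x | X x /\ (a < f x)%R].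
  by apply/seteqP; split=> x [Xx] /=; [move=> /negP; rewrite -ltNge|rewrite ltNge => /negP].
have cvg_sum : \sum_(0 <= j <oo) mu (S j) < +oo.
  apply: (@le_lt_trans _ _ (mu X + mu X)); last by rewrite lte_add_pinfty.
  apply: lime_le; last by apply: nearW => n; exact: sum_shells.
  by apply: is_cvg_nneseries => *; exact: outer_measure_ge0.
have tail := nneseries_tail_cvg cvg_sum (fun k _ => outer_measure_ge0 mu (S k)).
apply/lee_addgt0Pr => e e0.
have [k hk] : exists k, \sum_(k <= j <oo) mu (S j) <= e%:E.
  move/fine_cvgP: tail => [fin /cvgrPdist_le/(_ e e0) small].
  have [k [fk]] := filter_ex (filterI fin small).
  rewrite sub0r normrN => /(le_trans (ler_norm _)) ek.
  by exists k; rewrite -(fineK fk) lee_fin.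
apply: (@le_trans _ _ (mu (X `&` [set x | f x <= a]%R) + (mu (A k) + e%:E))).
  apply: leeD2l; apply: le_trans (le_outer_measure _ _ _ (cover k)) _.
  apply: le_trans (outer_measureU2 _ _ _) _; apply: leeD2l.
  exact: le_trans (outer_measure_sigma_subadditive_tail _ _ _) hk.
rewrite addeA; apply: leeD2r.
apply: le_trans (mu_sep (r := k.+1%:R^-1) _ _) _ => //.
  move=> x y [_ /= hx] [_ hy]; apply: le_trans hy; exact: lerD.
by apply: le_outer_measure => x [[]|[]].
Qed.

End fixed_set.

Lemma caratheodory_halfspace a : mu.-caratheodory [set x | f x <= a]%R.
Proof.
apply: le_caratheodory_measurable => X.
have [muX|] := ltP (mu X) +oo; first exact: separated_halfspace.
by rewrite leye_eq => /eqP ->; rewrite leey.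
Qed.

End MetricOuterMeasure.

Section HausdorffCoord.
Context {R : realType} {n : nat} (k : nat).
Implicit Types A B E : set 'rV[R]_n.
Local Open Scope ereal_scope.

Lemma coord_le_enorm (x : 'rV[R]_n) i : (`|x 0 i| <= enorm x)%R.
Proof.
rewrite -sqrtr_sqr ler_sqrt; last by apply: sumr_ge0 => j _; rewrite -expr2 sqr_ge0.
rewrite /dotv (bigD1 i)//= -expr2 lerDl; apply: sumr_ge0 => j _.
by rewrite -expr2 sqr_ge0.
Qed.

Lemma enorm_le_ediam E x y : E x -> E y -> (enorm (x - y))%:E <= ediam E.
Proof. by move=> Ex Ey; apply: ereal_sup_ubound; exists (x, y). Qed.

Lemma hausdorff_pre_ge0 delta A : 0 <= hausdorff_pre k delta A.
Proof.
apply: le_ereal_inf_tmp => _ [F _ <-]; apply: nneseries_ge0 => i _ _.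
exact: hausdorff_weight_ge0.
Qed.

Lemma hausdorff_weight_antitone (delta1 delta2 : R) E : (delta1 <= delta2)%R ->
  hausdorff_weight k delta2 E <= hausdorff_weight k delta1 E.
Proof.
move=> le12; rewrite /hausdorff_weight; case: pselect => //= _.
case: ifPn => [h2|h2]; case: ifPn => h1 //; first by rewrite leey.
by exfalso; move/negP: h2; apply; apply: (le_trans h1); rewrite lee_fin.
Qed.

Lemma hausdorff_pre_antitone (delta1 delta2 : R) A : (delta1 <= delta2)%R ->
  hausdorff_pre k delta2 A <= hausdorff_pre k delta1 A.
Proof.
move=> le12; apply: le_ereal_inf_tmp => _ [F AF <-].
apply: ge_ereal_inf; exists (\sum_(i <oo) hausdorff_weight k delta2 (F i)).
  by exists F.
apply: lee_nneseries => i _; last exact: hausdorff_weight_antitone.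
by move=> _; exact: hausdorff_weight_ge0.
Qed.

Lemma hausdorff_pre_le delta A : (0 < delta)%R -> hausdorff_pre k delta A <= hausdorff k A.
Proof. by move=> d0; apply: ereal_sup_ubound; exists delta. Qed.

(** A member of a cover that meets both [A] and [B] has diameter at least r > delta, hence infinite
    weight. In all other cases each member is charged to one of the two sets only. *)
Lemma hausdorff_pre_sep (i : 'I_n) A B (r delta : R) : (delta < r)%R ->
  (forall x y, A x -> B y -> x 0 i + r <= y 0 i)%R ->
  hausdorff_pre k delta A + hausdorff_pre k delta B <= hausdorff_pre k delta (A `|` B).
Proof.
move=> dr sep; apply: le_ereal_inf_tmp => _ [F ABF <-].
pose cut C j := if `[< F j `&` C !=set0 >] then F j else set0.
have cover C : C `<=` A `|` B -> C `<=` \bigcup_j cut C j.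
  move=> CAB x Cx; have [j _ Fx] := ABF x (CAB x Cx).
  by exists j => //; rewrite /cut ifT//; apply/asboolP; exists x.
have bound C : C `<=` A `|` B ->
    hausdorff_pre k delta C <= \sum_(j <oo) hausdorff_weight k delta (cut C j).
  move=> CAB; apply: ereal_inf_lbound; exists (cut C) => //; exact: cover.
apply: le_trans (leeD (bound A _) (bound B _)) _; [by move=> x; left|by move=> x; right|].
rewrite -nneseriesD; last 2 first.
- by move=> *; exact: hausdorff_weight_ge0.
- by move=> *; exact: hausdorff_weight_ge0.
apply: lee_nneseries => j _.
  by move=> _; rewrite adde_ge0// hausdorff_weight_ge0.
rewrite /cut; case: asboolP => [[x [Fx Ax]]|_]; last first.
  rewrite hausdorff_weight0 add0e; case: asboolP => // _.
  by rewrite hausdorff_weight0 hausdorff_weight_ge0.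
case: asboolP => [[y [Fy By]]|_]; last by rewrite hausdorff_weight0 adde0.
suff -> : hausdorff_weight k delta (F j) = +oo by rewrite leey.
have F0 : F j <> set0 by move=> F0; rewrite F0 in Fx.
rewrite /hausdorff_weight; case: pselect => //= _.
rewrite ifF//; apply/negbTE; rewrite -ltNge.
apply: lt_le_trans (enorm_le_ediam Fy Fx); rewrite lte_fin.
apply: lt_le_trans (coord_le_enorm _ i); rewrite !mxE.
have := sep x y Ax By; have := ler_norm (y 0 i - x 0 i)%R; lra.
Qed.

Lemma hausdorff_sep (i : 'I_n) A B (r : R) : (0 < r)%R ->
  (forall x y, A x -> B y -> x 0 i + r <= y 0 i)%R ->
  hausdorff k A + hausdorff k B <= hausdorff k (A `|` B).
Proof.
move=> r0 sep.
have [fin|] := ltP (hausdorff k (A `|` B)) +oo; last first.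
  by rewrite leye_eq => /eqP ->; rewrite leey.
have finC C : C `<=` A `|` B -> hausdorff k C \is a fin_num.
  move=> CAB; rewrite ge0_fin_numE ?hausdorff_ge0//.
  by apply: le_lt_trans fin; exact: le_hausdorff.
have finA : hausdorff k A \is a fin_num by apply: finC => x; left.
have finB : hausdorff k B \is a fin_num by apply: finC => x; right.
apply/lee_addgt0Pr => e e0.
have e20 : (0 < e / 2)%R by rewrite divr_gt0.
have [_ [dA /= dA0 <-] hA] := ub_ereal_sup_adherent e20 finA.
have [_ [dB /= dB0 <-] hB] := ub_ereal_sup_adherent e20 finB.
(* Below the separation [r], and fine enough for both [A] and [B]. *)
pose dl := Num.min (r / 2)%R (Num.min dA dB).
have dl0 : (0 < dl)%R by rewrite !lt_min dA0 dB0 divr_gt0.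
have hAB := @hausdorff_pre_sep i A B r dl _ sep.
have {}hA : hausdorff k A <= hausdorff_pre k dl A + (e / 2)%:E.
  rewrite -leeBlDr//; apply: le_trans (ltW hA) _; apply: hausdorff_pre_antitone.
  by rewrite !ge_min lexx !orbT.
have {}hB : hausdorff k B <= hausdorff_pre k dl B + (e / 2)%:E.
  rewrite -leeBlDr//; apply: le_trans (ltW hB) _; apply: hausdorff_pre_antitone.
  by rewrite !ge_min lexx !orbT.
apply: le_trans (leeD hA hB) _.
rewrite addeACA -EFinD -splitr; apply: leeD2r.
apply: le_trans (hAB _) (hausdorff_pre_le _ dl0).
by rewrite gt_min; apply/orP; left; rewrite ltr_pdivrMr// mulr_natr mulr2n ltrDl.
Qed.

End HausdorffCoord.

Section SurfaceBorel.
Context {R : realType} {d : nat}.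

Lemma measurable_surface_id :
  measurable_fun [set: surface_space d] (id : surface_space d -> 'rV[R]_d).
Proof.
apply: measurable_fun_rV => i.
apply: (measurability _ (RGenCInfty.measurableE R)) => _ [_ [a ->] <-].
rewrite setTI.
(* [caratheodory_halfspace] is about sets x_i <= a; the generators of the Borel sets are countable
   intersections of complements of these. *)
have -> : (rV_coord i \o id) @^-1` `[a, +oo[%classic =
    \bigcap_m ~` [set x : surface_space d | (x : 'rV_d) 0 i <= a - m.+1%:R^-1].
  apply/seteqP; split=> x /=; rewrite ?in_itv/= ?andbT.
    move=> ax m _ /=; apply/negP; rewrite -ltNge; apply: lt_le_trans ax.
    by rewrite ltrBlDr ltrDl invr_gt0.
  move=> h; rewrite leNgt; apply/negP => xa.
  have axp : 0 < a - (x : 'rV_d) 0 i by rewrite subr_gt0.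
  have [m _ hm] := near_infty_natSinv_lt (PosNum axp).
  by apply: (h m I) => /=; rewrite lerBrDr -lerBrDl ltW//; exact: hm m (leqnn _).
apply: bigcap_measurable => // m _; apply: measurableC.
exact: (caratheodory_halfspace (@hausdorff_sep R d d.-1 i)).
Qed.


End SurfaceBorel.

(** * Flows of Lipschitz fields *)

Section RealCalculus.
Context {R : realType}.
Implicit Types f df g : R -> R.

Lemma is_derive1_continuous f (x df : R) : is_derive x 1 f df -> {for x, continuous f}.
Proof.
by move=> [h _]; apply/differentiable_continuous/derivable1_diffP.
Qed.

Lemma is_derive1_within_continuous f df (a b : R) :
  (forall x, a <= x <= b -> is_derive x 1 f (df x)) -> {within `[a, b], continuous f}.
Proof.
move=> h; apply: continuous_in_subspaceT => x; rewrite inE /= in_itv /= => xab.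
exact: is_derive1_continuous (h x xab).
Qed.

Lemma is_derive1_ext f g (x df dg : R) : f =1 g -> df = dg ->
  is_derive x 1 f df -> is_derive x 1 g dg.
Proof. by move=> /funext -> ->. Qed.

Lemma derive_ge0_le f df (a b : R) : a <= b ->
  (forall x, a <= x <= b -> is_derive x 1 f (df x)) ->
  (forall x, a <= x <= b -> 0 <= df x) -> f a <= f b.
Proof.
move=> ab h df0; have [||c] := @MVT_segment R f df a b ab.
- by move=> x; rewrite in_itv /= => /andP[ax xb]; apply: h; rewrite !ltW.
- exact: is_derive1_within_continuous h.
- rewrite in_itv /= => cab e; rewrite -subr_ge0 e mulr_ge0 ?subr_ge0//.
  exact: df0.
Qed.

Lemma derive_le f df g dg (a b : R) : a <= b ->
  (forall x, a <= x <= b -> is_derive x 1 f (df x)) ->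
  (forall x, a <= x <= b -> is_derive x 1 g (dg x)) ->
  (forall x, a <= x <= b -> df x <= dg x) -> f b - f a <= g b - g a.
Proof.
move=> ab hf hg le; have h : (g - f) a <= (g - f) b.
  apply: (@derive_ge0_le _ (fun x => dg x - df x)) => // x xab.
    by apply: is_deriveB; [exact: hg|exact: hf].
  by rewrite subr_ge0; exact: le.
by move: h; rewrite !fctE; lra.
Qed.

Lemma is_derive_comp_opp f (x df : R) :
  is_derive (- x) 1 f df -> is_derive x 1 (fun t => f (- t)) (- df).
Proof.
move=> h; have h1 : is_derive x 1 (-%R : R -> R) (-1) by apply: is_deriveN.
by have := is_derive1_comp h h1; rewrite mulrN1.
Qed.

(** In the norm weighted by exp(- a |t|), integration from 0 gains a factor 1/a. This makes the
    Picard map a contraction on the whole line. *)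
Lemma derive_bound_exp f df (K a : R) : f 0 = 0 -> 0 < a -> 0 <= K ->
  (forall t : R, is_derive t 1 f (df t)) ->
  (forall t, `|df t| <= K * a * expR (a * `|t|)) ->
  forall t, `|f t| <= K * expR (a * `|t|).
Proof.
move=> + a0 K0.
have dexp (x : R) : is_derive x 1 (fun y => K * expR (a * y)) (K * a * expR (a * x)).
  have h1 : is_derive x 1 (fun y : R => a * y) a.
    by have := @is_deriveZ R R R id a x 1 1 (is_derive_id _ _); rewrite [_ *: _]mulr1.
  have := @is_deriveZ R R R _ K x 1 _ (is_derive1_comp (is_derive_expR (a * x)) h1).
  suff -> : K * a * expR (a * x) = K *: (expR (a * x) * a) by [].
  by rewrite -mulrA [X in K * X]mulrC.
have pos (g dg : R -> R) : g 0 = 0 -> (forall t : R, is_derive t 1 g (dg t)) ->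
    (forall t, `|dg t| <= K * a * expR (a * `|t|)) ->
    forall t, 0 <= t -> `|g t| <= K * expR (a * t).
  move=> g0 hg hdg t t0; have e0 : K * expR (a * 0) = K by rewrite mulr0 expR0 mulr1.
  have hd x : 0 <= x <= t -> `|dg x| <= K * a * expR (a * x).
    by move=> /andP[x0 _]; rewrite -{2}(ger0_norm x0); exact: hdg.
  have up : g t - g 0 <= K * expR (a * t) - K * expR (a * 0).
    apply: (@derive_le g dg _ (fun x => K * a * expR (a * x))) => // x /hd.
    by rewrite ler_norml => /andP[].
  have lo : (- g) t - (- g) 0 <= K * expR (a * t) - K * expR (a * 0).
    apply: (@derive_le (- g) (fun x => - dg x) _ (fun x => K * a * expR (a * x))) => //.
    by move=> x /hd; rewrite ler_norml => /andP[]; lra.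
  move: up lo; rewrite e0 !fctE g0 ler_norml => up lo.
  by apply/andP; split; lra.
move=> f0 hf hdf t; have [t0|t0] := leP 0 t; first by rewrite (ger0_norm t0); exact: pos hdf t t0.
have := @pos (fun s => f (- s)) (fun s => - df (- s)) _ _ _ (- t) _.
rewrite /= opprK (ltr0_norm t0); apply; first by rewrite oppr0.
- by move=> s; apply: is_derive_comp_opp; exact: hf.
- by move=> s; rewrite normrN -(normrN s); exact: hdf.
- by rewrite oppr_ge0 ltW.
Qed.

Lemma ler_addgt0_geo (a b K : R) : 0 <= K -> (forall n : nat, a <= b + K * 2 ^- n) -> a <= b.
Proof.
move=> K0 h; apply/ler_addgt0Pr => e e0.
have K1 : 0 < K + 1 by rewrite ltr_pwDr.
have eK : 0 < e / (K + 1) by rewrite divr_gt0.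
have [n _ /(_ n (leqnn _))] := @near_infty_natSinv_expn_lt R (PosNum eK).
rewrite /= mul1r ltr_pdivlMr// => ne; apply: le_trans (h n) _; rewrite lerD2l.
apply: le_trans (ltW ne); rewrite mulrC ler_wpM2l ?invr_ge0 ?exprn_ge0//.
by rewrite lerDl.
Qed.

(** The limit is taken as the supremum of the lower bounds u n - 2 K 2^-n, which brings the rate
    along with the existence. *)
Lemma geometric_lim (u : nat -> R) (K : R) : 0 <= K ->
  (forall n, `|u n.+1 - u n| <= K * 2 ^- n) ->
  exists l, forall n, `|l - u n| <= 2 * K * 2 ^- n.
Proof.
move=> K0 h.
have half n : 2 ^- n.+1 = 2 ^- n / 2 :> R by rewrite exprS invfM mulrC.
have step n m : `|u (n + m)%N - u n| <= 2 * K * (2 ^- n - 2 ^- (n + m)).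
  elim: m => [|m IH]; first by rewrite addn0 !subrr normr0 mulr0.
  rewrite addnS half; have := h (n + m)%N.
  have -> : u (n + m).+1 - u n = (u (n + m).+1 - u (n + m)%N) + (u (n + m)%N - u n) by lra.
  move=> h1; apply: le_trans (ler_normD _ _) _; apply: le_trans (lerD h1 IH) _; lra.
have le n m : u n - 2 * K * 2 ^- n <= u m + 2 * K * 2 ^- m.
  have p k : 0 <= 2 * K * 2 ^- k by rewrite mulr_ge0 ?mulr_ge0// invr_ge0 exprn_ge0.
  have [nm|/ltnW mn] := leqP n m.
    have := step n (m - n)%N; rewrite subnKC// ler_norml => /andP[s1 s2].
    have := p n; have := p m; lra.
  have := step m (n - m)%N; rewrite subnKC// ler_norml => /andP[s1 s2].
  have := p n; have := p m; lra.
pose E := range (fun n => u n - 2 * K * 2 ^- n).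
have Eub m : ubound E (u m + 2 * K * 2 ^- m) by move=> _ [n _ <-]; exact: le.
exists (sup E) => n; rewrite ler_norml; apply/andP; split.
  rewrite lerBrDr addrC; apply: ub_le_sup; first by exists (u 0%N + 2 * K * 2 ^- 0%N).
  by exists n.
rewrite lerBlDr addrC; apply: ge_sup; first by exists (u 0%N - 2 * K * 2 ^- 0%N), 0%N.
exact: Eub.
Qed.

(** The integrals from - (n + 1) are primitives on bounded intervals. Normalised to vanish at 0 they
    agree wherever two of them are defined, so they glue to a primitive on the whole line. *)
Lemma primitive_exists f : continuous f ->
  exists F : R -> R, F 0 = 0 /\ forall t : R, is_derive t 1 F (f t).
Proof.
move=> cf.
pose G (n : nat) (t : R) : R := (\int[lebesgue_measure]_(s in `[- n.+1%:R, t]) f s)%R.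
have dG n (t : R) : `|t| < n.+1%:R -> is_derive t 1 (G n) (f t).
  rewrite ltr_norml => /andP[nt tn].
  have [|d1 d2] := @continuous_FTC1_closed R f (- n.+1%:R) t n.+1%:R tn _ nt (cf t).
    apply: continuous_compact_integrable; first exact: segment_compact.
    exact: continuous_subspaceT.
  by apply: DeriveDef; [exact: d1|rewrite -derive1E; exact: d2].
pose F n (t : R) : R := G n t - G n 0.
have dF n (t : R) : `|t| < n.+1%:R -> is_derive t 1 (F n) (f t).
  move=> tn; have := is_deriveB (dG n t tn) (is_derive_cst (G n 0) t 1).
  by rewrite subr0.
have F0 n : F n 0 = 0 by rewrite /F subrr.
have FE n m t : `|t| < n.+1%:R -> `|t| < m.+1%:R -> F n t = F m t.
  move=> tn tm.
  have key (x : R) : `|x| <= `|t| -> is_derive x 1 (fun s => F n s - F m s) 0.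
    move=> xt; rewrite -(subrr (f x)); apply: is_deriveB; apply: dF;
      exact: le_lt_trans xt _.
  have eq0 s1 s2 : s1 <= s2 -> (forall x, s1 <= x <= s2 -> `|x| <= `|t|) ->
      F n s1 - F m s1 = F n s2 - F m s2.
    move=> s12 sub; apply: le_anti; apply/andP; split.
      apply: (@derive_ge0_le (fun s => F n s - F m s) (fun=> 0)) => // x xs.
      by apply: key; exact: sub.
    have := @derive_ge0_le (fun s => - (F n s - F m s)) (fun=> 0) s1 s2 s12.
    rewrite lerN2; apply=> // x xs; rewrite -oppr0; apply: is_deriveN.
    by apply: key; exact: sub.
  suff : F n 0 - F m 0 = F n t - F m t by rewrite !F0 subrr => /esym/subr0_eq.
  have [t0|t0] := leP 0 t.
    by apply: eq0 => // x /andP[x0 xt]; rewrite !ger0_norm.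
  apply/esym; apply: eq0 => [|x /andP[tx x0]]; first exact: ltW.
  by rewrite (ltr0_norm t0) ler0_norm// lerN2.
pose idx (t : R) := (Num.truncn `|t|).
have idxP t : `|t| < (idx t).+1%:R by exact: truncnS_gt.
exists (fun t => F (idx t) t); split=> [|t]; first exact: F0.
apply: (near_eq_is_derive (f := F (idx t).+1)); last first.
  by apply: dF; apply: lt_trans (idxP t) _; rewrite ltr_nat.
have : \forall s \near t, `|s| < (idx t).+2%:R.
  have : `|t| < (idx t).+2%:R by apply: lt_trans (idxP t) _; rewrite ltr_nat.
  have cn : {for t, continuous (fun s : R => `|s|)} by exact: norm_continuous.
  exact: (cvgr_lt _ cn).
by apply: filterS => s hs; apply: FE.
Qed.

Lemma lipschitz_continuous (V W : normedModType R) (g : V -> W) (K : R) :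
  (forall x y, `|g x - g y| <= K * `|x - y|) -> continuous g.
Proof.
move=> hg x; apply/cvgrPdist_le => e e0.
have K1 : 0 < `|K| + 1 by rewrite ltr_pwDr.
apply/nbhs_normP; exists (e / (`|K| + 1)); first by rewrite /= divr_gt0.
move=> y /= /ltW; rewrite ler_pdivlMr// => hs; apply: le_trans (hg _ _) _.
apply: le_trans hs; rewrite mulrC ler_wpM2l//.
by apply: le_trans (ler_norm _) _; rewrite lerDl.
Qed.

End RealCalculus.

Section ContinuousReal.
Context {R : realType} {U : topologicalType}.
Implicit Types f g : U -> R.

Lemma continuous_addr f g : continuous f -> continuous g -> continuous (fun x => f x + g x).
Proof. by move=> cf cg x; exact: cvgD (cf x) (cg x). Qed.

Lemma continuous_mulr f g : continuous f -> continuous g -> continuous (fun x => f x * g x).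
Proof. by move=> cf cg x; exact: cvgM (cf x) (cg x). Qed.

Lemma continuous_sumr (I : Type) (s : seq I) (f : I -> U -> R) :
  (forall i, continuous (f i)) -> continuous (fun x => \sum_(i <- s) f i x).
Proof.
move=> cf; elim: s => [|i s IH].
  by under eq_fun do rewrite big_nil; move=> x; exact: cst_continuous.
by under eq_fun do rewrite big_cons; exact: continuous_addr.
Qed.

End ContinuousReal.

Section Flow.
Context {R : realType} {d : nat}.
Variables (F : 'rV[R]_d -> 'rV[R]_d) (L B : R).
Hypothesis L_gt0 : 0 < L.
Hypothesis B_ge0 : 0 <= B.
Hypothesis F_lip : forall x y, `|F x - F y| <= L * `|x - y|.
Hypothesis F_bnd : forall x, `|F x| <= B.

Definition solution (g : R -> 'rV[R]_d) : Prop :=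
  forall (t : R) i, is_derive t 1 (fun s => g s 0 i) (F (g t) 0 i).

Lemma coord_dist_le (x y : 'rV[R]_d) i : `|x 0 i - y 0 i| <= `|x - y|.
Proof. by have := coord_le_norm (x - y) i; rewrite !mxE. Qed.

Lemma curve_coord_continuous (g : R -> 'rV[R]_d) i : continuous g ->
  continuous (fun s => F (g s) 0 i).
Proof.
move=> cg t; have cFg : {for t, continuous (F \o g)}.
  by apply: continuous_comp; [exact: cg|exact: lipschitz_continuous F_lip _].
apply/cvgrPdist_le => e e0; have /cvgrPdist_le/(_ e e0) := cFg.
by apply: filterS => s; apply: le_trans; exact: coord_dist_le.
Qed.

Lemma derive_bnd_lipschitz (f df : R -> R) :
  (forall t : R, is_derive t 1 f (df t)) -> (forall t, `|df t| <= B) ->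
  forall s t, `|f s - f t| <= B * `|s - t|.
Proof.
move=> hf hB; have le s t : s <= t -> `|f s - f t| <= B * `|s - t|.
  move=> st; rewrite distrC [`|s - t|]distrC (@ger0_norm _ (t - s)) ?subr_ge0//.
  have [|c _ ->] := @MVT_segment R f df s t st.
  - by apply: is_derive1_within_continuous => x _; exact: hf.
  - by rewrite normrM (@ger0_norm _ (t - s)) ?subr_ge0// ler_wpM2r ?subr_ge0.
move=> s t; have [/le//|/ltW/le] := leP s t.
by rewrite distrC [`|t - s|]distrC.
Qed.

Section Picard.
Variable x0 : 'rV[R]_d.

Let prim (f : R -> R) : R -> R :=
  xget (fun=> 0) [set P | P 0 = 0 /\ forall t : R, is_derive t 1 P (f t)].

Let primP f : continuous f ->
  prim f 0 = 0 /\ forall t : R, is_derive t 1 (prim f) (f t).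
Proof.
move=> cf; have [P hP] := primitive_exists cf.
by rewrite /prim; case: xgetP => [Q _ //|/(_ P)].
Qed.

Let step (g : R -> 'rV[R]_d) (t : R) : 'rV[R]_d :=
  \row_i (x0 0 i + prim (fun s => F (g s) 0 i) t).

Let stepP g : continuous g -> forall (t : R) i,
  is_derive t 1 (fun s => step g s 0 i) (F (g t) 0 i).
Proof.
move=> cg t i; have [_ h] := primP (@curve_coord_continuous g i cg).
apply: is_derive1_ext (is_deriveD (is_derive_cst (x0 0 i) t 1) (h t)).
  by move=> s; rewrite /step mxE.
exact: add0r.
Qed.

Let step0 g : continuous g -> step g 0 = x0.
Proof.
move=> cg; apply/rowP => i; rewrite mxE.
by have [-> _] := primP (@curve_coord_continuous g i cg); rewrite addr0.
Qed.

Let step_lip g : continuous g -> forall s t, `|step g s - step g t| <= B * `|s - t|.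
Proof.
move=> cg s t; apply: norm_le_coord => [|i]; first by rewrite mulr_ge0.
rewrite !mxE; have := @derive_bnd_lipschitz _ _ (stepP cg ^~ i) _ s t.
rewrite /= !mxE; apply => r; exact: le_trans (coord_le_norm _ _) (F_bnd _).
Qed.

(* Picard iterates; they converge on the whole line at once in the norm weighted by
   [expR (- 2 L |t|)]. *)
Let X n := iter n step (fun=> x0).

Let X_cont n : continuous (X n).
Proof.
elim: n => [|n IH]; first exact: cst_continuous.
exact: lipschitz_continuous (step_lip IH).
Qed.

Let L2 : 0 < 2 * L. Proof. by rewrite mulr_gt0. Qed.

(** The first Picard step is at most B |t|, hence at most [c] times exp(2 L |t|). *)
Let c := B / (2 * L).

Let c_ge0 : 0 <= c. Proof. by rewrite divr_ge0// ltW. Qed.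

Let geo_ge0 n : 0 <= c * 2 ^- n.
Proof. by rewrite mulr_ge0// invr_ge0 exprn_ge0. Qed.

(** The exponent is twice the Lipschitz constant, so that the contraction factor is 1/2. *)
Let step_contract g1 g2 K : continuous g1 -> continuous g2 -> 0 <= K ->
  (forall t, `|g1 t - g2 t| <= 2 * K * expR (2 * L * `|t|)) ->
  forall t, `|step g1 t - step g2 t| <= K * expR (2 * L * `|t|).
Proof.
move=> c1 c2 K0 h t; apply: norm_le_coord => [|i].
  by rewrite mulr_ge0// expR_ge0.
rewrite [X in `|X|]mxE [X in `|_ + X|]mxE.
apply: (@derive_bound_exp R (fun s => step g1 s 0 i - step g2 s 0 i)
  (fun s => F (g1 s) 0 i - F (g2 s) 0 i) K (2 * L)) => //.
- by rewrite !step0// subrr.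
- by move=> s; apply: is_deriveB; exact: stepP.
- move=> s; apply: le_trans (coord_dist_le _ _ _) _; apply: le_trans (F_lip _ _) _.
  apply: le_trans (ler_wpM2l (ltW L_gt0) (h s)) _.
  by rewrite !mulrA [L * 2]mulrC -!mulrA [L * (K * _)]mulrCA !mulrA [2 * K]mulrC.
Qed.

Let X_step n t : `|X n.+1 t - X n t| <= c * 2 ^- n * expR (2 * L * `|t|).
Proof.
elim: n t => [|n IH] t.
  rewrite expr0 invr1 mulr1.
  have -> : X 0%N t = step (X 0%N) 0 by rewrite step0//; exact: (@X_cont 0%N).
  apply: le_trans (_ : B * `|t| <= _).
    by have := step_lip (@X_cont 0%N) t 0; rewrite subr0.
  rewrite /c mulrAC ler_pdivlMr// -[leLHS]mulrA ler_wpM2l// mulrC.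
  by apply: le_trans (expR_ge1Dx _); rewrite lerDr.
apply: (@step_contract (X n.+1) (X n)); [exact: X_cont|exact: X_cont| |].
  exact: geo_ge0.
move=> s; apply: le_trans (IH s) _; rewrite ler_wpM2r ?expR_ge0//.
by have -> : 2 ^- n.+1 = 2 ^- n / 2 :> R; [rewrite exprS invfM mulrC|lra].
Qed.

Lemma solution_exists : exists g, solution g /\ g 0 = x0.
Proof.
have [g hg] : exists g : R -> 'rV[R]_d, forall t n i,
    `|g t 0 i - X n t 0 i| <= 2 * c * 2 ^- n * expR (2 * L * `|t|).
  have ex t i : exists l : R, forall n,
      `|l - X n t 0 i| <= 2 * c * 2 ^- n * expR (2 * L * `|t|).
    have [|n|l hl] := @geometric_lim R (fun n => X n t 0 i) (c * expR (2 * L * `|t|)).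
    - by rewrite mulr_ge0// expR_ge0.
    - by apply: le_trans (coord_dist_le _ _ _) _; rewrite mulrAC; exact: X_step.
    - by exists l => n; have := hl n; rewrite mulrA mulrAC.
  have /choice[l hl] : forall ti : R * 'I_d, exists l : R, forall n,
      `|l - X n ti.1 0 ti.2| <= 2 * c * 2 ^- n * expR (2 * L * `|ti.1|).
    by move=> [t i]; exact: ex.
  by exists (fun t => \row_i l (t, i)) => t n i; rewrite mxE; exact: hl (t, i) n.
have gX t n : `|g t - X n t| <= 2 * (c * 2 ^- n) * expR (2 * L * `|t|).
  apply: norm_le_coord => [|i].
    by rewrite mulr_ge0 ?expR_ge0// mulr_ge0// geo_ge0.
  by rewrite !mxE mulrA.
have cg : continuous g.
  apply: (@lipschitz_continuous R _ _ _ B) => s t.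
  pose K := 2 * c * expR (2 * L * `|s|) + 2 * c * expR (2 * L * `|t|) + B * 0.
  apply: (@ler_addgt0_geo _ _ _ K).
    by rewrite /K mulr0 addr0 addr_ge0// mulr_ge0 ?expR_ge0// mulr_ge0.
  (* The convergence is not uniform on the line, but every iterate after the first one is
     [B]-Lipschitz by [step_lip], and so is the limit. *)
  move=> n; have -> : g s - g t = (g s - X n.+1 s) + (X n.+1 s - X n.+1 t) - (g t - X n.+1 t).
    by rewrite addrA subrK opprB addrA subrK.
  apply: le_trans (ler_normB _ _) _; apply: le_trans (lerD (ler_normD _ _) (gX _ _)) _.
  apply: le_trans (lerD (lerD (gX _ _) (step_lip (@X_cont n) s t)) (lexx _)) _.
  have := geo_ge0 n; have -> : 2 ^- n.+1 = 2 ^- n / 2 :> R by rewrite exprS invfM mulrC.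
  have := expR_ge0 (2 * L * `|s|); have := expR_ge0 (2 * L * `|t|).
  rewrite /K; nra.
suff gE : g = step g.
  exists g; split; last by rewrite gE; exact: step0.
  by have := @stepP g cg; rewrite -gE.
apply/funext => t; apply/rowP => i; apply/eqP; rewrite -subr_eq0 -normr_le0.
apply: (@ler_addgt0_geo _ _ _ (2 * c * expR (2 * L * `|t|))).
  by rewrite mulr_ge0 ?expR_ge0// mulr_ge0.
move=> n; rewrite add0r.
have h := @step_contract g (X n) (c * 2 ^- n) cg (@X_cont n) _ (fun s => gX s n) t.
have {h}h1 : `|step g t - X n.+1 t| <= c * 2 ^- n * expR (2 * L * `|t|).
  by apply: h; exact: geo_ge0.
have h2 := gX t n.+1.
have -> : g t 0 i - step g t 0 i = (g t - X n.+1 t) 0 i - (step g t - X n.+1 t) 0 i.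
  by rewrite !mxE; lra.
apply: le_trans (ler_normB _ _) _.
apply: le_trans (lerD (le_trans (coord_le_norm _ _) h2) (le_trans (coord_le_norm _ _) h1)) _.
have -> : 2 ^- n.+1 = 2 ^- n / 2 :> R by rewrite exprS invfM mulrC.
lra.
Qed.

End Picard.

Section Gronwall.
Variables (g1 g2 : R -> 'rV[R]_d).
Hypotheses (sol1 : solution g1) (sol2 : solution g2).

(** The squared Euclidean distance is differentiable, unlike the sup norm; passing from one to the
    other costs a factor depending on d. *)
Let S t := \sum_i (g1 t 0 i - g2 t 0 i) ^+ 2.

Let dS t := \sum_i 2 * (g1 t 0 i - g2 t 0 i) * (F (g1 t) 0 i - F (g2 t) 0 i).

Let S_ge0 t : 0 <= S t.
Proof. by apply: sumr_ge0 => i _; exact: sqr_ge0. Qed.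

Let S_le t : `|g1 t - g2 t| ^+ 2 <= S t.
Proof.
have [e|/mx_norm_neq0[[i j] ij]] := eqVneq (mx_norm (g1 t - g2 t)) 0.
  by rewrite [X in X ^+ 2](_ : _ = 0) ?expr0n.
rewrite [X in X ^+ 2](_ :
  _ = `|(g1 t - g2 t) i j|)// ord1 real_normK ?num_real// !mxE /S (bigD1 j)//= lerDl.
by apply: sumr_ge0 => k _; exact: sqr_ge0.
Qed.

Let S_ge t : S t <= d%:R * `|g1 t - g2 t| ^+ 2.
Proof.
rewrite -[X in X%:R * _]card_ord -sum1_card natr_sum mulr_suml.
apply: ler_sum => i _; rewrite mul1r -[leLHS]real_normK ?num_real//.
by rewrite lerXn2r ?nnegrE//; exact: coord_dist_le.
Qed.

Let S_derive (t : R) : is_derive t 1 S (dS t).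
Proof.
have h (i : 'I_d) : is_derive t 1 ((fun s => g1 s 0 i - g2 s 0 i) ^+ 2)
    (2 * (g1 t 0 i - g2 t 0 i) * (F (g1 t) 0 i - F (g2 t) 0 i)).
  have := is_deriveX 2 (is_deriveB (sol1 t i) (sol2 t i)).
  by rewrite expr1.
by apply: is_derive1_ext (is_derive_sum h) => // s; rewrite fct_sumE.
Qed.

Let dS_le t : `|dS t| <= 2 * (L * d%:R) * S t.
Proof.
apply: le_trans (ler_norm_sum _ _ _) _.
apply: (@le_trans _ _ (\sum_(i < d) 2 * L * S t)); last first.
  by rewrite sumr_const card_ord -[leLHS]mulr_natr; nra.
apply: ler_sum => i _; rewrite !normrM (ger0_norm (ler0n _ 2)) -!mulrA ler_pM2l//.
apply: (@le_trans _ _ (`|g1 t - g2 t| * (L * `|g1 t - g2 t|))).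
  apply: ler_pM => //; first exact: coord_dist_le.
  exact: le_trans (coord_dist_le _ _ _) (F_lip _ _).
by rewrite mulrCA ler_pM2l// -expr2 S_le.
Qed.

Let K := 2 * (L * d%:R).

Let dexp (a x : R) : is_derive x 1 (fun y => expR (a * y)) (expR (a * x) * a).
Proof.
have h1 : is_derive x 1 (fun y : R => a * y) a.
  by have := @is_deriveZ R R R id a x 1 1 (is_derive_id _ _); rewrite [_ *: _]mulr1.
exact: is_derive1_comp (is_derive_expR (a * x)) h1.
Qed.

Let S_forward s t : s <= t -> S t <= expR (K * (t - s)) * S s.
Proof.
have dE (x : R) : is_derive x 1 (fun x => - (expR (- K * x) * S x))
    (- (expR (- K * x) * dS x + S x * (expR (- K * x) * - K))).
  by apply: is_deriveN; exact: is_deriveM (dexp (- K) x) (S_derive x).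
move=> st; have h : - (expR (- K * s) * S s) <= - (expR (- K * t) * S t).
  apply: (derive_ge0_le st (fun x _ => dE x)) => x _.
  have /ler_normlP[_ h] := dS_le x.
  have := mulr_ge0 (expR_ge0 (- K * x)) (_ : 0 <= K * S x - dS x).
  by rewrite subr_ge0 => /(_ h); lra.
rewrite mulrBr addrC expRD -mulrN.
move: h; rewrite lerN2 !mulNr => h.
have : expR (K * t) * (expR (- (K * t)) * S t) <= expR (K * t) * (expR (- (K * s)) * S s).
  by rewrite ler_pM2l ?expR_gt0.
by rewrite !mulrA -!expRD subrr expR0 mul1r addrC mulrN.
Qed.

Let S_backward s t : t <= s -> S t <= expR (K * (s - t)) * S s.
Proof.
have dE (x : R) : is_derive x 1 (fun x => expR (K * x) * S x)
    (expR (K * x) * dS x + S x * (expR (K * x) * K)).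
  exact: is_deriveM (dexp K x) (S_derive x).
move=> st; have h : expR (K * t) * S t <= expR (K * s) * S s.
  apply: (derive_ge0_le st (fun x _ => dE x)) => x _.
  have /ler_normlP[h _] := dS_le x.
  have := mulr_ge0 (expR_ge0 (K * x)) (_ : 0 <= K * S x + dS x).
  rewrite -lerBlDr sub0r => /(_ _); rewrite /K in h *; lra.
rewrite mulrBr addrC expRD.
have : expR (- (K * t)) * (expR (K * t) * S t) <= expR (- (K * t)) * (expR (K * s) * S s).
  by rewrite ler_pM2l ?expR_gt0.
by rewrite !mulrA -!expRD addNr expR0 mul1r.
Qed.

(** From |S'| <= 2 L d S, in both directions of time. Taking the square root halves the exponent,
    and the factor d is a crude bound for the sqrt d that comes from comparing norms. *)
Lemma solution_gronwall s t :
  `|g1 t - g2 t| <= d%:R * expR (L * d%:R * `|t - s|) * `|g1 s - g2 s|.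
Proof.
have h : S t <= expR (K * `|t - s|) * S s.
  have [ts|/ltW st] := leP t s; last by rewrite ger0_norm ?subr_ge0// S_forward.
  by rewrite distrC ger0_norm ?subr_ge0// S_backward.
rewrite -(@ler_pXn2r _ 2)// ?nnegrE ?mulr_ge0 ?expR_ge0 ?ler0n//.
apply: le_trans (S_le t) _; apply: le_trans h _.
have -> : expR (K * `|t - s|) = expR (L * d%:R * `|t - s|) ^+ 2.
  by rewrite -expRM_natl /K !mulrA.
have d2 : d%:R <= d%:R ^+ 2 :> R by rewrite -natrX ler_nat -mulnn; case: (d) => // n;
  rewrite leq_pmull.
have h2 := le_trans (S_ge s) (ler_wpM2r (exprn_ge0 2 (normr_ge0 _)) d2).
apply: le_trans (ler_wpM2l (exprn_ge0 2 (expR_ge0 _)) h2) _.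
by rewrite !exprMn mulrCA mulrA.
Qed.

End Gronwall.

Lemma solution_shift g a : solution g -> solution (fun t => g (t + a)).
Proof.
move=> hg t i; have h : is_derive t 1 (fun s : R => s + a) 1.
  by have := is_deriveD (is_derive_id t 1) (is_derive_cst a t 1); rewrite addr0.
by have := @is_derive1_comp R (fun s => g s 0 i) _ t _ _ (hg (t + a) i) h; rewrite mulr1.
Qed.

Lemma solution_unique g1 g2 a : solution g1 -> solution g2 -> g1 a = g2 a -> g1 = g2.
Proof.
move=> s1 s2 e; apply/funext => t; apply/eqP; rewrite -subr_eq0 -normr_le0.
by have := solution_gronwall s1 s2 a t; rewrite e subrr normr0 mulr0.
Qed.

Lemma flow_exists : exists Phi : 'rV[R]_d -> R -> 'rV[R]_d,
  [/\ forall x, solution (Phi x), forall x, Phi x 0 = x,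
      forall x s t, Phi (Phi x s) t = Phi x (t + s),
      forall x s t, `|Phi x s - Phi x t| <= B * `|s - t| &
      forall x y t, `|Phi x t - Phi y t| <= d%:R * expR (L * d%:R * `|t|) * `|x - y|].
Proof.
have /choice[Phi hPhi] x := solution_exists x.
exists Phi; split=> [x|x|x s t|x s t|x y t]; try by have [] := hPhi x.
- have [sx _] := hPhi x; have [sy y0] := hPhi (Phi x s).
  have -> // : Phi (Phi x s) = fun t => Phi x (t + s).
  apply: (@solution_unique _ _ 0) => //; first exact: solution_shift.
  by rewrite y0 add0r.
- apply: norm_le_coord => [|i]; first by rewrite mulr_ge0.
  have [sx _] := hPhi x; rewrite !mxE.
  apply: (derive_bnd_lipschitz (sx ^~ i)) => r.
  exact: le_trans (coord_le_norm _ _) (F_bnd _).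
- have [sx x0] := hPhi x; have [sy y0] := hPhi y.
  by have := solution_gronwall sx sy 0 t; rewrite subr0 x0 y0.
Qed.

End Flow.

(** * Lipschitz extension of the transport field *)

Section LipschitzExtension.
Context {R : realType} {V : normedModType R}.

(** McShane's infimum of the cones f y + L |x - y|, truncated to [-B, B]; the truncation does not
    increase distances. *)
Lemma lipschitz_extension (A : set V) (f : V -> R) (L B : R) :
  A !=set0 -> 0 <= L -> (forall x y, A x -> A y -> `|f x - f y| <= L * `|x - y|) ->
  (forall x, A x -> `|f x| <= B) ->
  exists g, [/\ forall x, A x -> g x = f x,
                forall x y, `|g x - g y| <= L * `|x - y| &
                forall x, `|g x| <= B].
Proof.
move=> [x0 Ax0] L0 fL fB.
pose E x := [set f y + L * `|x - y| | y in A].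
have lbE x : has_lbound (E x).
  exists (f x0 - L * `|x - x0|) => _ [y Ay <-].
  have := fL _ _ Ax0 Ay => /ler_normlP[_ h].
  have : L * `|x0 - y| <= L * (`|x - x0| + `|x - y|).
    by rewrite ler_wpM2l// (distrC x x0) ler_distD.
  rewrite mulrDr; lra.
have E0 x : E x !=set0 by exists (f x0 + L * `|x - x0|), x0.
pose g x := inf (E x).
have gE x : A x -> g x = f x.
  move=> Ax; apply/eqP; rewrite eq_le; apply/andP; split.
    by apply: ge_inf => //; exists x => //; rewrite subrr normr0 mulr0 addr0.
  apply: lb_le_inf => // _ [y Ay <-]; have := fL _ _ Ax Ay => /ler_normlP[_ h]; lra.
have g_le x y : g x <= g y + L * `|x - y|.
  rewrite -lerBlDr; apply: lb_le_inf => // _ [z Az <-]; rewrite lerBlDr.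
  apply: le_trans (_ : f z + L * `|x - z| <= _); first by apply: ge_inf => //; exists z.
  rewrite -addrA lerD2l -mulrDr ler_wpM2l// [leRHS]addrC; exact: ler_distD.
have gL x y : `|g x - g y| <= L * `|x - y|.
  have h1 := g_le x y; have h2 := g_le y x; rewrite (distrC y x) in h2.
  by apply/ler_normlP; split; lra.
have B0 : 0 <= B by apply: le_trans (fB _ Ax0).
pose clip r := Num.max (- B) (Num.min B r).
have clipB r : `|clip r| <= B.
  by rewrite ler_norml /clip le_max lexx/= ge_max ge_min lexx/= andbT; lra.
have clipE r : `|r| <= B -> clip r = r.
  by rewrite ler_norml => /andP[r1 r2]; rewrite /clip (min_idPr r2) (max_idPr r1).
have maxL (a r s : R) : `|Num.max a r - Num.max a s| <= `|r - s|.
  rewrite !maxEle; have /ler_normlP[h1 h2] := lexx `|r - s|.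
  by do 2! case: ifP => /idP; move=> *; apply/ler_normlP; split; lra.
have minL (a r s : R) : `|Num.min a r - Num.min a s| <= `|r - s|.
  rewrite !minEle; have /ler_normlP[h1 h2] := lexx `|r - s|.
  by do 2! case: ifP => /idP; move=> *; apply/ler_normlP; split; lra.
have clipL r s : `|clip r - clip s| <= `|r - s| by exact: le_trans (maxL _ _ _) (minL _ _ _).
exists (clip \o g); split=> [x Ax|x y|x] /=.
- by rewrite gE// clipE// fB.
- exact: le_trans (clipL _ _) (gL _ _).
- exact: clipB.
Qed.

End LipschitzExtension.

Section DirectionalDerivative.
Context {R : realType} {V : normedModType R}.

Lemma is_derive_line (f : V -> R) (x v : V) (t : R) : differentiable f (x + t *: v) ->
  is_derive t 1 (fun s => f (x + s *: v)) ('D_v f (x + t *: v)).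
Proof.
move=> df; have dl : is_diff t (fun s : R => x + s *: v) (fun s => s *: v).
  by have := is_diffD (is_diff_cst x t) (is_diff_scalel t v); rewrite add0r.
have dg : is_diff t (f \o (fun s : R => x + s *: v))
    ('d f (x + t *: v) \o (fun s => s *: v)).
  by apply: is_diff_comp; exact: differentiableP.
have [dgt eg] := dg.
apply: DeriveDef; first exact/derivable1_diffP.
rewrite deriveE// eg /= scale1r deriveE//.
Qed.

Lemma segment_mvt (f : V -> R) (x v : V) :
  (forall t, 0 <= t <= 1 -> differentiable f (x + t *: v)) ->
  exists2 t, 0 <= t <= 1 & f (x + v) - f x = 'D_v f (x + t *: v).
Proof.
move=> df; have [t||c] := @MVT_segment R (fun s => f (x + s *: v))
    (fun s => 'D_v f (x + s *: v)) 0 1 ler01.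
- rewrite in_itv /= => /andP[t0 t1]; apply: is_derive_line; apply: df.
  by rewrite !ltW.
- apply: is_derive1_within_continuous => t /df; exact: is_derive_line.
- by rewrite in_itv /= scale1r scale0r addr0 subr0 mulr1; exists c.
Qed.

Lemma near_dist_lt (z : V) (r : R) : 0 < r -> \forall y \near z, `|z - y| < r.
Proof. by move=> r0; apply/nbhs_normP; exists r. Qed.

Lemma near_norm_ball (z : V) (P : V -> Prop) : (\forall y \near z, P y) ->
  exists2 r : R, 0 < r & forall y, `|z - y| < r -> P y.
Proof. by move=> /nbhs_normP[r /= r0 h]; exists r. Qed.

Lemma convex_ball (z x v : V) (r t : R) : `|z - x| < r -> `|z - (x + v)| < r ->
  0 <= t <= 1 -> `|z - (x + t *: v)| < r.
Proof.
move=> zx zy /andP[t0 t1].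
have -> : z - (x + t *: v) = (1 - t) *: (z - x) + t *: (z - (x + v)).
  have -> : z - (x + v) = z - x - v by rewrite opprD addrA.
  by rewrite (scalerBr t (z - x) v) scalerBl scale1r opprD !addrA subrK.
apply: le_lt_trans (ler_normD _ _) _; rewrite !normrZ ger0_norm ?subr_ge0// ger0_norm//.
have [->|t00] := eqVneq t 0; first by rewrite subr0 mul1r mul0r addr0.
have tp : 0 < t by rewrite lt0r t00.
have : t * `|z - (x + v)| < t * r by rewrite ltr_pM2l.
have : (1 - t) * `|z - x| <= (1 - t) * r by rewrite ler_wpM2l ?subr_ge0// ltW.
lra.
Qed.

End DirectionalDerivative.

Section RowDerivative.
Context {R : realType} {d : nat}.
Implicit Types (f : 'rV[R]_d -> R) (x v : 'rV[R]_d).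

Lemma derive_sum_coord f x v : differentiable f x ->
  'D_v f x = \sum_i v 0 i * 'D_(delta_mx 0 i : 'rV[R]_d) f x.
Proof.
move=> df; rewrite deriveE// [in LHS](row_sum_delta v) linear_sum.
by apply: eq_bigr => i _; rewrite linearZ/= deriveE.
Qed.

Lemma derive_grad f x v : differentiable f x -> 'D_v f x = dotv v (grad f x).
Proof.
by move=> df; rewrite derive_sum_coord//; apply: eq_bigr => i _; rewrite mxE.
Qed.

End RowDerivative.

Section LipschitzField.
Context {R : realType} {d : nat}.
Variables (Om : set 'rV[R]_d) (H : 'rV[R]_d -> 'rV[R]_d).
Hypotheses (open_Om : open Om) (bnd_Om : bounded_set Om).
Hypotheses (smooth_Om : smooth_boundary Om) (C1_H : C1_closure Om H).

Lemma compact_closure_bounded : compact (closure Om).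
Proof.
apply: bounded_closed_compact; last exact: closed_closure.
have [M [Mr hM]] := bnd_Om; exists M; split=> // M' MM' x clx.
have cB : closed [set y : 'rV[R]_d | `|y| <= M'].
  apply: (@preimage_closed _ _ (fun y : 'rV[R]_d => `|y|) [set r | r <= M']).
    by move=> y _; exact: norm_continuous.
  exact: closed_le.
by have := closureS (hM M' MM'); move/closure_id: cB => <-; exact.
Qed.

Lemma within_compact_bounded (K : set 'rV[R]_d) (G : 'rV[R]_d -> 'rV[R]_d) :
  compact K -> {within K, continuous G} -> exists2 M, 0 <= M & forall x, K x -> `|G x| <= M.
Proof.
move=> cK cG; have /compact_bounded[M [Mr hM]] := continuous_compact cG cK.
exists (`|M| + 1); first by rewrite addr_ge0.
move=> x Kx; apply: hM; last by exists x.
by apply: le_lt_trans (ler_norm M) _; rewrite ltrDl.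
Qed.

Let Hi i x := H x 0 i.

(** Each partial derivative coincides in [Om] with a function continuous on the compact closure. *)
Lemma C1_closure_derive_bound : exists2 M, 0 <= M & forall x, Om x -> forall i,
  differentiable (Hi i) x /\ forall v, `|'D_v (Hi i) x| <= M * `|v|.
Proof.
have [cH dH] := C1_H.
have diffH x : Om x -> differentiable H x.
  by move=> Omx; have [G _ hG] := dH 0; have [] := hG x Omx.
have diffHi x i : Om x -> differentiable (Hi i) x.
  move=> /diffH dx; have -> : Hi i = (fun N : 'rV[R]_d => N 0 i : R) \o H by [].
  by apply: differentiable_comp => //; exact: differentiable_coord.
have bnd j : exists2 M, 0 <= M & forall x, Om x -> `|'D_(delta_mx 0 j : 'rV[R]_d) H x| <= M.
  have [G cG hG] := dH (delta_mx 0 j).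
  have [M M0 hM] := within_compact_bounded compact_closure_bounded cG.
  exists M => // x Omx; have [_ ->] := hG x Omx; apply: hM; exact: subset_closure.
have {bnd}/choice[M hM] : forall j, exists M, 0 <= M /\
    forall x, Om x -> `|'D_(delta_mx 0 j : 'rV[R]_d) H x| <= M.
  by move=> j; have [M M0 h] := bnd j; exists M.
exists (\sum_j M j); first by apply: sumr_ge0 => j _; have [] := hM j.
move=> x Omx i; split=> [|v]; first exact: diffHi.
rewrite derive_sum_coord; last exact: diffHi.
apply: le_trans (ler_norm_sum _ _ _) _; rewrite mulr_suml.
apply: ler_sum => j _; rewrite normrM mulrC; apply: ler_pM => //; last exact: coord_le_norm.
have [_ h] := hM j; apply: le_trans (h x Omx).
rewrite derive_mx; last exact/diff_derivable/diffH.
have := coord_le_norm (\matrix_(k, l) 'D_(delta_mx 0 j : 'rV[R]_d) (fun y => H y k l) x) i.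
by rewrite mxE.
Qed.

Let locally_lipschitz z := exists r L, [/\ 0 < r, 0 <= L & forall x y, Om x -> Om y ->
  `|z - x| < r -> `|z - y| < r -> `|H x - H y| <= L * `|x - y|].

Section bound.
Variables (M : R) (M0 : 0 <= M).
Hypothesis hM : forall x, Om x -> forall i,
  differentiable (Hi i) x /\ forall v, `|'D_v (Hi i) x| <= M * `|v|.

Let segment_H x v : (forall t, 0 <= t <= 1 -> Om (x + t *: v)) ->
  `|H (x + v) - H x| <= M * `|v|.
Proof.
move=> seg; apply: norm_le_coord => [|i]; first by rewrite mulr_ge0.
have dHt t : 0 <= t <= 1 -> differentiable (Hi i) (x + t *: v).
  by move=> /seg/hM/(_ i)[].
have [t t01 e] := segment_mvt dHt.
by rewrite !mxE [X in `|X|]e; have [_] := hM (seg t t01) i; exact.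
Qed.

Lemma locally_lipschitz_interior z : Om z -> locally_lipschitz z.
Proof.
move=> Omz; have /nbhs_normP[r /= r0 hr] : nbhs z Om by exact: open_nbhs_nbhs.
exists r, M; split=> // x y _ _ zx zy.
have -> : x = y + (x - y) by rewrite addrC subrK.
rewrite [X in M * `|X|]addrAC subrr add0r; apply: segment_H => t t01; apply: hr => /=.
by apply: convex_ball => //; rewrite [y + _]addrC subrK.
Qed.

(* [x] and [y] are joined inside [Om] by going inward along [- n] by a multiple of
   [|x - y|], then parallel to [y - x], then back. *)
Lemma locally_lipschitz_boundary z : bdry Om z -> locally_lipschitz z.
Proof.
move=> /smooth_Om[rho [sm_rho grad0 nearOm]].
have drho x : differentiable rho x by have [] := sm_rho 1%N.
have cD v : continuous ('D_v rho) by have [_ h] := sm_rho 1%N; exact: h.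
have [i Di0] : exists i, 'D_(delta_mx 0 i : 'rV[R]_d) rho z != 0.
  apply: contrapT => /forallNP h; move/negP: grad0; apply; apply/eqP/rowP => i.
  by rewrite !mxE; apply/eqP; apply: contrapT => /negP; exact: h.
(* Along [n] the function [rho] grows at rate |c0| at [z], hence at a rate of at least |c0| / 2
   nearby. A coordinate direction is as good as the normal here. *)
set c0 := 'D__ _ _ in Di0; pose n : 'rV[R]_d := Num.sg c0 *: delta_mx 0 i.
have n1 : `|n| <= 1.
  apply: norm_le_coord => // j; rewrite !mxE normrM normr_sg Di0 mul1r.
  by case: (_ && _); rewrite ?normr1 ?normr0.
pose c := `|c0| / 2.
have c_gt0 : 0 < c by rewrite divr_gt0// normr_gt0.
have nearn : \forall w \near z, c < 'D_n rho w.
  have Dnz : 'D_n rho z = `|c0|.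
    rewrite deriveE// linearZ/= -deriveE// -/c0 [_ *: _]mulrC.
    by rewrite -[LHS]/(c0 * Num.sg c0) mulrC -normrEsg.
  apply: (cvgr_gt _ (cD n z)).
  by rewrite Dnz /c ltr_pdivrMr// mulr_natr mulr2n ltrDl normr_gt0.
have nearM : \forall w \near z, forall j,
    `|'D_(delta_mx 0 j : 'rV[R]_d) rho w| <= `|'D_(delta_mx 0 j : 'rV[R]_d) rho z| + 1.
  apply: (@filter_forall _ _ _ _ (nbhs_filter z)) => j;
    have /cvgrPdist_le/(_ 1 ltr01) := cD (delta_mx 0 j) z.
  apply: filterS => w h; rewrite -[X in `|X|](subrK ('D_(delta_mx 0 j : 'rV[R]_d) rho z)).
  by apply: le_trans (ler_normD _ _) _; rewrite addrC lerD2l distrC.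
have [r1 r10 hr1] := @near_norm_ball R 'rV[R]_d z _ (filterI (filterI nearOm nearn) nearM).
have OmE u : `|z - u| < r1 -> (Om u <-> rho u < 0) by move=> /hr1[[]].
pose M' := \sum_j (`|'D_(delta_mx 0 j : 'rV[R]_d) rho z| + 1).
have hM' w v : `|z - w| < r1 -> `|'D_v rho w| <= M' * `|v|.
  move=> /hr1[_ hj]; rewrite derive_sum_coord//.
  apply: le_trans (ler_norm_sum _ _ _) _; rewrite mulr_suml.
  by apply: ler_sum => j _; rewrite normrM mulrC; apply: ler_pM => //; exact: coord_le_norm.
have M'0 : 0 <= M' by apply: sumr_ge0 => j _; rewrite addr_ge0.
(* Going inward by K |x - y| lowers [rho] by at least as much as it can vary along y - x, so that
   the parallel segment stays where [rho] is negative. *)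
pose K := M' / c + 1.
have K0 : 0 < K by rewrite ltr_wpDl// divr_ge0// ltW.
have Kc : M' <= K * c by rewrite /K mulrDl divfK ?gt_eqF// mul1r lerDl ltW.
have K21 : 0 < 1 + 2 * K by rewrite addr_gt0// mulr_gt0.
(* With |x - y| < 2 r, the inward move has length at most 2 K r, so the path stays in the ball of
   radius r + 2 K r = r1. Its three pieces have lengths at most K, 1 and K times |x - y|. *)
exists (r1 / (1 + 2 * K)), (M * (2 * K + 1)); split.
- by rewrite divr_gt0.
- by rewrite mulr_ge0// addr_ge0// mulr_ge0// ltW.
move=> x y Omx Omy; set r := r1 / (1 + 2 * K) => zx zy; set dl := `|x - y|.
have r0 : 0 < r by rewrite divr_gt0.
have dl0 : 0 <= dl by rewrite normr_ge0.
pose w := - ((K * dl) *: n).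
have w_le : `|w| <= K * dl.
  rewrite normrN normrZ (ger0_norm (mulr_ge0 (ltW K0) dl0)).
  by rewrite ler_piMr// mulr_ge0// ltW.
have r_eq : r1 = r + 2 * K * r.
  by rewrite /r; field; rewrite gt_eqF.
have dl_lt : dl < 2 * r.
  have : dl <= `|z - x| + `|z - y| by rewrite /dl (distrC z x); exact: ler_distD.
  lra.
have rr1 : r <= r1.
  by have := mulr_ge0 (ltW K0) (ltW r0); lra.
have shift_ball u : `|z - u| < r -> `|z - (u + w)| < r1.
  move=> zu; rewrite opprD addrA; apply: le_lt_trans (ler_normB _ _) _.
  have : K * dl <= K * (2 * r) by rewrite ler_pM2l// ltW.
  lra.
have dn u : `|z - u| < r1 -> 'D_w rho u <= - (K * dl * c).
  move=> /hr1[[_ cn] _]; rewrite deriveE// /w linearN linearZ/= -deriveE//.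
  by rewrite lerN2; exact: ler_wpM2l (mulr_ge0 (ltW K0) dl0) _ _ (ltW cn).
have down u t : Om u -> `|z - u| < r -> 0 <= t <= 1 ->
    rho (u + t *: w) <= rho u - t * (K * dl * c) /\ `|z - (u + t *: w)| < r1.
  move=> Omu zu t01; have /andP[t0 t1] := t01.
  have zu1 : `|z - u| < r1 by exact: lt_le_trans zu rr1.
  split; last by apply: convex_ball => //; exact: shift_ball.
  have [s /andP[s0 s1] e] := @segment_mvt _ _ rho u (t *: w) (fun _ _ => drho _).
  have zs : `|z - (u + s *: (t *: w))| < r1.
    rewrite scalerA; apply: convex_ball => //; first exact: shift_ball.
    by rewrite mulr_ge0//= mulr_ile1.
  have eD : 'D_(t *: w) rho (u + s *: (t *: w)) = t * 'D_w rho (u + s *: (t *: w)).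
    by rewrite deriveE// linearZ/= -deriveE.
  by rewrite -lerBlDl e eD -mulrN ler_wpM2l// dn.
have seg u : Om u -> `|z - u| < r -> `|H (u + w) - H u| <= M * (K * dl).
  move=> Omu zu; apply: (@le_trans _ _ (M * `|w|)); last by rewrite ler_wpM2l.
  apply: segment_H => t t01; have /andP[t0 t1] := t01.
  have [h1 h2] := down u t Omu zu t01; apply/(OmE _ h2).
  apply: le_lt_trans h1 _; have h : rho u < 0 by apply/OmE => //; exact: lt_le_trans zu rr1.
  by rewrite (@le_lt_trans _ _ (rho u))// gerBl !mulr_ge0// ltW.
have xwy : x + w + (y - x) = y + w by rewrite addrC addrA subrK.
have mid : `|H (x + w + (y - x)) - H (x + w)| <= M * dl.
  rewrite /dl (distrC x y); apply: segment_H => t t01; have /andP[t0 t1] := t01.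
  have zq : `|z - (x + w + (y - x))| < r1.
    by rewrite xwy; exact: shift_ball.
  have zt := convex_ball (shift_ball x zx) zq t01; apply/(OmE _ zt).
  have [s s01 e] := @segment_mvt _ _ rho (x + w) (t *: (y - x)) (fun _ _ => drho _).
  have [h1 _] := down x 1 Omx zx (ltac:(by rewrite ler01 lexx)).
  rewrite scale1r mul1r in h1.
  have rx : rho x < 0 by apply/OmE => //; exact: lt_le_trans zx rr1.
  have zs : `|z - (x + w + s *: (t *: (y - x)))| < r1.
    by apply: convex_ball => //; exact: shift_ball.
  have := hM' _ (t *: (y - x)) zs; rewrite -e => /ler_normlP[_ h2].
  have h3 : M' * `|t *: (y - x)| <= K * c * dl.
    rewrite normrZ ger0_norm// (distrC y x) -/dl; apply: ler_pM => //.
      by rewrite mulr_ge0.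
    by rewrite ler_piMl.
  rewrite -[X in X < 0](subrK (rho (x + w))).
  lra.
have -> : H x - H y = - (H (x + w) - H x) - (H (x + w + (y - x)) - H (x + w)) + (H (y + w) - H y).
  rewrite xwy.
  by apply/rowP => k; rewrite !mxE; ring.
apply: le_trans (ler_normD _ _) _; apply: le_trans (lerD (ler_normB _ _) (lexx _)) _.
rewrite normrN; apply: le_trans (lerD (lerD (seg x Omx zx) mid) (seg y Omy zy)) _.
lra.
Qed.

End bound.

(** In a domain that is not convex a bound on the derivative does not suffice. Close pairs are
    treated by the local estimates and compactness of the closure, distant pairs by the bound on
    [H]. *)
Lemma lipschitz_on_domain : exists2 L, 0 <= L &
  forall x y, Om x -> Om y -> `|H x - H y| <= L * `|x - y|.
Proof.
have [M M0 hM] := C1_closure_derive_bound.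
have [B B0 hB] := within_compact_bounded compact_closure_bounded (proj1 C1_H).
have loc z : closure Om z -> locally_lipschitz z.
  move=> clz; have [Omz|nOmz] := pselect (Om z); first by apply: (locally_lipschitz_interior M0 hM).
  apply: (locally_lipschitz_boundary M0 hM); split=> //.
  by move/interior_id: open_Om => ->.
have /compact_near_coveringP cov := compact_closure_bounded.
(* A single number [K] is both Lipschitz constant and inverse radius, so that the filter at +oo
   makes both uniform over the closure. *)
have := cov R +oo (fun K z => forall x y, Om x -> Om y -> `|z - x| < K^-1 ->
  `|x - y| < K^-1 -> `|H x - H y| <= K * `|x - y|) _ _.
case=> [z clz|K [Kr hK]].
  have [r [L [r0 L0 h]]] := loc z clz.
  near=> z' K => x y Omx Omy z'x xy.
  have zz' : `|z - z'| < r / 2 by near: z'; apply: (@near_dist_lt R 'rV[R]_d z); rewrite divr_gt0.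
  have K4 : 4 / r < K by near: K; apply: nbhs_pinfty_gt; exact: num_real.
  have LK : L < K by near: K; apply: nbhs_pinfty_gt; exact: num_real.
  have K0 : 0 < K by exact: le_lt_trans L0 LK.
  have Kr : K^-1 < r / 4.
    by rewrite -[r / 4]invrK ltf_pV2 ?posrE ?invr_gt0 ?divr_gt0// invf_div.
  have zx : `|z - x| < r / 2 + r / 4.
    apply: le_lt_trans (ler_distD z' _ _) _; apply: ltrD => //; exact: lt_trans Kr.
  have zy : `|z - y| < r.
    apply: le_lt_trans (ler_distD x _ _) _; lra.
  apply: le_trans (h x y Omx Omy _ zy) _; first lra.
  by rewrite ler_wpM2r// ltW.
pose K1 := `|K| + 1.
have K1p : 0 < K1 by rewrite ltr_pwDr.
exists (K1 + 2 * B * K1); first by rewrite addr_ge0 ?mulr_ge0// ltW.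
move=> x y Omx Omy; rewrite mulrDl; have [xy|xy] := ltP `|x - y| K1^-1.
  rewrite (@le_trans _ _ (K1 * `|x - y|))//; last by rewrite lerDl !mulr_ge0// ltW.
  apply: (hK K1 _ x) => //; last by rewrite subrr normr0 invr_gt0.
    by apply: le_lt_trans (ler_norm _) _; rewrite ltrDl.
  exact: subset_closure.
rewrite (@le_trans _ _ (2 * B * K1 * `|x - y|))//; last by rewrite lerDr mulr_ge0// ltW.
apply: le_trans (ler_normB _ _) _.
have hx : `|H x| <= B by apply: hB; exact: subset_closure.
have hy : `|H y| <= B by apply: hB; exact: subset_closure.
apply: (@le_trans _ _ (2 * B)); first lra.
by rewrite -mulrA ler_peMr ?mulr_ge0// -ler_pdivrMl// mulr1.
Unshelve. all: by end_near. Qed.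

Lemma lipschitz_field_extension : Om !=set0 -> exists F L B, [/\ 0 < L, 0 <= B,
  forall x y, `|F x - F y| <= L * `|x - y|, forall x, `|F x| <= B &
  forall x, Om x -> F x = H x].
Proof.
move=> Om0; have [L L0 hL] := lipschitz_on_domain.
have [B B0 hB] := within_compact_bounded compact_closure_bounded (proj1 C1_H).
have /choice[g hg] i := @lipschitz_extension R _ Om (Hi i) L B Om0 L0
  (fun x y Omx Omy => le_trans (coord_dist_le (H x) (H y) i) (hL x y Omx Omy))
  (fun x Omx => le_trans (coord_le_norm (H x) i) (hB x (subset_closure Omx))).
exists (fun x => \row_i g i x), (L + 1), B; split=> //.
- by rewrite ltr_wpDl.
- move=> x y; apply: norm_le_coord => [|i]; first by rewrite mulr_ge0// addr_ge0.
  rewrite !mxE; have [_ h _] := hg i; apply: le_trans (h x y) _.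
  by rewrite ler_wpM2r// lerDl.
- by move=> x; apply: norm_le_coord => // i; rewrite mxE; have [_ _ h] := hg i.
- by move=> x Omx; apply/rowP => i; rewrite mxE; have [-> //] := hg i.
Qed.

End LipschitzField.

(** * Volume of the set of orbits that meet a given set *)

Section OuterVolume.
Context {R : realType} {n : nat}.
Implicit Types (A B : set 'rV[R]_n) (e s : R).

(* Outer volume, as the sets [hits] below need not be measurable. *)
Definition volume_le A e : Prop :=
  exists N, [/\ measurable N, A `<=` N & (lebesgue_rV n N <= e%:E)%E].

Definition volume_null A : Prop := forall e, 0 < e -> volume_le A e.

Lemma volume_leS A B e1 e2 : A `<=` B -> e1 <= e2 -> volume_le B e1 -> volume_le A e2.
Proof.
move=> AB e12 [N [mN BN hN]]; exists N; split=> //; first exact: subset_trans BN.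
by apply: le_trans hN _; rewrite lee_fin.
Qed.

Lemma volume_le0 e : 0 <= e -> volume_le set0 e.
Proof. by move=> e0; exists set0; split=> //; rewrite measure0 lee_fin. Qed.

Lemma volume_leU A B e1 e2 : volume_le A e1 -> volume_le B e2 -> volume_le (A `|` B) (e1 + e2).
Proof.
move=> [N1 [mN1 AN1 h1]] [N2 [mN2 BN2 h2]]; exists (N1 `|` N2); split.
- exact: measurableU.
- exact: setUSS.
- by apply: le_trans (measureU2 _ _ _) _ => //; rewrite EFinD leeD.
Qed.

Lemma volume_le_bigcup (A : nat -> set 'rV[R]_n) (u : nat -> R) e :
  (forall k, volume_le (A k) (u k)) -> (\sum_(k <oo) (u k)%:E <= e%:E)%E ->
  volume_le (\bigcup_k A k) e.
Proof.
move=> /choice[N hN] hu.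
have mN k : measurable (N k) by have [] := hN k.
exists (\bigcup_k N k); split.
- exact: bigcupT_measurable.
- by apply: subset_bigcup => k _; have [] := hN k.
- apply: le_trans hu; apply: le_trans (measure_sigma_subadditive _ mN _ _) _ => //.
    exact: bigcupT_measurable.
  by apply: lee_nneseries => // k _; have [] := hN k.
Qed.

Lemma volume_le_fin (I : finType) (A : I -> set 'rV[R]_n) e :
  (forall i, volume_le (A i) e) -> volume_le (\bigcup_i A i) (#|I|%:R * e).
Proof.
move=> h.
suff H (s : seq I) : volume_le (\bigcup_(i in [set i | i \in s]) A i) ((size s)%:R * e).
  apply: volume_leS (H (enum I)) => [x [i _ Ax]|]; first by exists i => //=; rewrite mem_enum.
  by rewrite cardE.
elim: s => [|i s IH].
  rewrite mul0r; apply: volume_leS (volume_le0 (lexx 0)) => // x [i] /=.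
  by rewrite in_nil.
apply: volume_leS (volume_leU (h i) IH) => [x [j /=]|].
  by rewrite in_cons => /predU1P[->|js] Ax; [left|right; exists j].
by rewrite /= -natr1 mulrDl mul1r addrC.
Qed.

Lemma volume_le_diam A s : 0 < s -> (forall x y, A x -> A y -> `|x - y| <= s) ->
  volume_le A ((3 * s) ^+ n).
Proof.
move=> s0 dA; have s3 : 0 <= 3 * s by rewrite mulr_ge0// ltW.
have [->|/set0P[x Ax]] := eqVneq A set0; first by apply: volume_le0; rewrite exprn_ge0.
(* The side is 3 s and not 2 s, because a coordinate of [y] may exceed that of [x] by exactly [s]
   and the cube is half-open. *)
exists (cube (x - const_mx s) (3 * s)); split; first exact: measurable_cube.
  move=> y Ay i; rewrite !mxE; have := le_trans (coord_le_norm (x - y) i) (dA x y Ax Ay).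
  by rewrite !mxE ler_norml => /andP[h1 h2]; apply/andP; split; lra.
by rewrite lebesgue_cube.
Qed.

Lemma geometric_series_le (c : R) : 0 <= c -> (\sum_(k <oo) (c * 2 ^- k.+1)%:E <= c%:E)%E.
Proof.
move=> c0; apply: lime_le.
  by apply: is_cvg_nneseries => k _ _; rewrite lee_fin mulr_ge0// invr_ge0 exprn_ge0.
apply: nearW => m; rewrite sumEFin lee_fin.
have -> : \sum_(0 <= k < m) c * 2 ^- k.+1 = c * (1 - 2 ^- m).
  elim: m => [|m IH]; first by rewrite big_geq// expr0 invr1 subrr mulr0.
  by rewrite big_nat_recr//= IH exprS invfM; lra.
by rewrite ler_piMr// gerBl invr_ge0 exprn_ge0.
Qed.

Lemma volume_null_bigcup (A : nat -> set 'rV[R]_n) :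
  (forall k, volume_null (A k)) -> volume_null (\bigcup_k A k).
Proof.
move=> h e e0; apply: (@volume_le_bigcup _ (fun k => e * 2 ^- k.+1)).
  by move=> k; apply: h; rewrite mulr_gt0// invr_gt0 exprn_gt0.
exact: geometric_series_le (ltW e0).
Qed.

Lemma volume_nullS A B : A `<=` B -> volume_null B -> volume_null A.
Proof. by move=> AB nB e e0; apply: volume_leS AB (lexx _) (nB e e0). Qed.

Lemma volume_null_fin (I : finType) (A : I -> set 'rV[R]_n) :
  (forall i, volume_null (A i)) -> volume_null (\bigcup_i A i).
Proof.
move=> h e e0.
have c0 : 0 < #|I|.+1%:R :> R by rewrite ltr0n.
apply: volume_leS (volume_le_fin (fun i => h i (e / #|I|.+1%:R) (divr_gt0 e0 c0))) => //.
by rewrite mulrCA ler_piMr ?(ltW e0)// ler_pdivrMr// mul1r ler_nat.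
Qed.

Lemma volume_nullU A B : volume_null A -> volume_null B -> volume_null (A `|` B).
Proof.
move=> nA nB e e0; rewrite (splitr e).
by apply: volume_leU; [apply: nA|apply: nB]; rewrite divr_gt0.
Qed.

Lemma open_not_null A : open A -> A !=set0 -> ~ volume_null A.
Proof.
move=> oA [x Ax] nA.
have [r r0 hr] := @near_norm_ball R 'rV[R]_n x A (open_nbhs_nbhs (conj oA Ax)).
have p : 0 < (r / 2) ^+ n by rewrite exprn_gt0// divr_gt0.
have [N [mN AN hN]] := nA _ (divr_gt0 p (ltr0n R 2)).
have : (lebesgue_rV n (cube x (r / 2)) <= lebesgue_rV n N)%E.
  apply: le_measure; rewrite ?inE//; first exact: measurable_cube.
  move=> y hy; apply: AN; apply: hr; apply: (@le_lt_trans _ _ (r / 2)).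
    apply: norm_le_coord => [|i]; first by rewrite divr_ge0// ltW.
    by have := hy i => /andP[h1 h2]; rewrite !mxE ler_norml; apply/andP; split; lra.
  by rewrite ltr_pdivrMr// mulr_natr mulr2n ltrDl.
rewrite lebesgue_cube ?divr_ge0 ?(ltW r0)// => /le_trans/(_ hN); rewrite lee_fin leNgt => /negP;
  apply.
by rewrite ltr_pdivrMr// mulr_natr mulr2n ltrDl.
Qed.

End OuterVolume.

Section UnitBall.
Context {R : realType} (k : nat).

Lemma measurable_enorm_ball : measurable [set x : 'rV[R]_k | enorm x <= 1].
Proof.
have -> : [set x : 'rV[R]_k | enorm x <= 1] = (fun x => dotv x x) @^-1` `]-oo, 1].
  apply/seteqP; split=> x; rewrite /= in_itv /= => h.
    have := lerXn2r 2 (sqrtr_ge0 _ : enorm x \in Num.nneg) _ h.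
    rewrite sqr_sqrtr ?expr1n; first by apply; rewrite nnegrE.
    by apply: sumr_ge0 => i _; rewrite -expr2 sqr_ge0.
  by rewrite /enorm -sqrtr1 ler_sqrt.
rewrite -[X in measurable X]setTI; apply: (_ : measurable_fun setT _) => //.
rewrite /dotv; apply: measurable_sum => i.
by apply: measurable_funM; exact: measurable_rV_coord.
Qed.

(** This is the normalising factor of the Hausdorff measure: bounded below, it lets the weights of a
    cover control the powers of the diameters. *)
Lemma unit_ball_volume_gt0 : exists2 v : R, 0 < v & (v%:E <= @unit_ball_volume R k)%E.
Proof.
pose s : R := k.+1%:R^-1.
have s0 : 0 < s by rewrite invr_gt0.
exists ((2 * s) ^+ k); first by rewrite exprn_gt0// mulr_gt0.
rewrite /unit_ball_volume -(@lebesgue_cube R k (const_mx (- s))) ?mulr_ge0 ?(ltW s0)//.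
apply: le_measure; rewrite ?inE; [exact: measurable_cube|exact: measurable_enorm_ball|].
move=> x hx /=; rewrite /enorm -sqrtr1 ler_sqrt//.
apply: (@le_trans _ _ (\sum_(i < k) s)).
  apply: ler_sum => i _; have := hx i; rewrite mxE => /andP[h1 h2].
  have s1 : s <= 1 by rewrite invf_le1// ler1n.
  apply: (@le_trans _ _ (s * s)); last by rewrite ler_piMl// ltW.
  rewrite -expr2 -[leRHS]expr2 -[leLHS]real_normK ?num_real//.
  rewrite lerXn2r ?nnegrE ?(ltW s0)// ler_norml; apply/andP; split; lra.
by rewrite sumr_const card_ord -[leLHS]mulr_natl ler_pdivrMr// mul1r ler_nat.
Qed.

End UnitBall.

(** Members of a cover may have diameter [D] = 0, while [hits_box] asks for a positive size: [r]
    replaces [D], and [eta] is the price in the weight. *)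
Lemma expr_near_right (R : realType) (k : nat) (D e eta : R) : 0 <= D -> 0 < e -> 0 < eta ->
  exists r, [/\ D < r, r <= D + e & r ^+ k <= D ^+ k + eta].
Proof.
move=> D0 e0 eta0.
have := @exprn_continuous R k D => /cvgrPdist_le/(_ eta eta0).
move=> /(@near_norm_ball R R D)[rho rho0 h].
exists (D + Num.min (rho / 2) e); split.
- by rewrite ltrDl lt_min e0 divr_gt0.
- by rewrite lerD2l ge_min lexx orbT.
- have := h (D + Num.min (rho / 2) e); rewrite opprD addNKr normrN.
  rewrite ger0_norm; last by rewrite le_min (ltW e0) divr_ge0// ltW.
  move=> /(_ _)/ler_normlP; case.
    by rewrite gt_min ltr_pdivrMr// mulr_natr mulr2n ltrDl rho0.
  by move=> h1 _; lra.
Qed.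

Lemma interval_cut (R : realType) (a b t : R) (m : nat) : (0 < m)%N -> a <= t <= b ->
  exists i : 'I_m, a + i%:R * ((b - a) / m%:R) <= t <=
                   a + i%:R * ((b - a) / m%:R) + (b - a) / m%:R.
Proof.
case: m => // m' _ /andP[at1 tb]; set m := m'.+1.
have m0 : 0 < m%:R :> R by rewrite ltr0n.
pose q := (t - a) / ((b - a) / m%:R).
have [ab0|ab0] := eqVneq a b.
  by exists ord0; rewrite /= mul0r addr0 -ab0 subrr mul0r addr0 at1 ab0 tb.
have ba : 0 < b - a by rewrite subr_gt0 lt_neqAle ab0 (le_trans at1).
have st0 : 0 < (b - a) / m%:R by rewrite divr_gt0.
have q0 : 0 <= q by rewrite divr_ge0 ?subr_ge0// ltW.
have qm : q <= m%:R by rewrite ler_pdivrMr// mulrCA divff ?gt_eqF// mulr1 lerD2r.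
have tE : t = a + q * ((b - a) / m%:R) by rewrite divfK ?gt_eqF// addrC subrK.
(* The minimum matters for t = b, where the truncation is [m] itself. *)
have im : (minn (Num.truncn q) m' < m)%N by rewrite ltnS geq_minr.
have /andP[l1 l2] := truncn_itv q0.
have lo : (minn (Num.truncn q) m')%:R <= q by apply: le_trans l1; rewrite ler_nat geq_minl.
have hi : q <= (minn (Num.truncn q) m')%:R + 1.
  rewrite natr1 /minn; case: ifP => _; first exact: ltW.
  by [].
exists (Ordinal im).
move: st0 tE; set st := (b - a) / m%:R => st0 tE.
have := ler_wpM2r (ltW st0) lo; have := ler_wpM2r (ltW st0) hi.
by rewrite mulrDl mul1r => h1 h2; apply/andP; split; rewrite /=; lra.
Qed.

Section FlowHits.
Context {R : realType} {d : nat}.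
Hypothesis d_gt0 : (0 < d)%N.
Variables (Phi : 'rV[R]_d -> R -> 'rV[R]_d) (B C T : R).
Hypotheses (B_ge0 : 0 <= B) (C_ge0 : 0 <= C).
Hypothesis Phi0 : forall x, Phi x 0 = x.
Hypothesis PhiD : forall x s t, Phi (Phi x s) t = Phi x (t + s).
Hypothesis Phi_time : forall x s t, `|Phi x s - Phi x t| <= B * `|s - t|.
Hypothesis Phi_space : forall x y t, `|t| <= T -> `|Phi x t - Phi y t| <= C * `|x - y|.
Implicit Types E Z : set 'rV[R]_d.

Definition hits E (a b : R) : set 'rV[R]_d := [set x | exists2 t, a <= t <= b & E (Phi x t)].

Let c := 3 * (C + B + 1).

Let c_gt0 : 0 < c.
Proof. by rewrite mulr_gt0// ltr_wpDl// addr_ge0. Qed.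

(** Flowing back from [E], a spread [r] in space contributes C r and a spread [r] in time
    contributes B r. The factor 3 in [c] comes from [volume_le_diam]. *)
Lemma hits_short E (a b r : R) : 0 < r -> b - a <= r -> - T <= a -> b <= T ->
  (forall x y, E x -> E y -> `|x - y| <= r) -> volume_le (hits E a b) ((c * r) ^+ d).
Proof.
move=> r0 ba Ta bT dE; rewrite /c -mulrA; apply: volume_le_diam.
  by rewrite mulr_gt0// ltr_wpDl// addr_ge0.
move=> x y [t /andP[at1 tb] Et] [s /andP[as1 sb] Es].
have back z u : z = Phi (Phi z u) (- u) by rewrite PhiD addNr Phi0.
rewrite (back x t) (back y s); apply: le_trans (ler_distD (Phi (Phi y s) (- t)) _ _) _.
have h1 : `|Phi (Phi x t) (- t) - Phi (Phi y s) (- t)| <= C * r.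
  apply: le_trans (Phi_space _ _ _) _; last by rewrite ler_wpM2l// dE.
  by rewrite normrN ler_norml; apply/andP; split; lra.
have h2 : `|Phi (Phi y s) (- t) - Phi (Phi y s) (- s)| <= B * r.
  apply: le_trans (Phi_time _ _ _) _; rewrite ler_wpM2l// ler_norml.
  by apply/andP; split; lra.
by apply: le_trans (lerD h1 h2) _; rewrite -mulrDl ler_wpM2r ?ltW// ltrDl.
Qed.

(** Cutting the time interval into pieces no longer than [r] replaces one factor [r] of [hits_short]
    by the duration. The remaining power d - 1 is that of the surface measure. *)
Lemma hits_box E (a b r : R) : 0 < r -> a <= b -> - T <= a -> b <= T ->
  (forall x y, E x -> E y -> `|x - y| <= r) ->
  volume_le (hits E a b) (c ^+ d * r ^+ d.-1 * (b - a + r)).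
Proof.
move=> r0 ab Ta bT dE.
pose m := (Num.truncn ((b - a) / r)).+1.
have m1 : (b - a) / r < m%:R by exact: truncnS_gt.
have m2 : m%:R <= (b - a) / r + 1.
  by rewrite -natr1 lerD2r truncn_le// divr_ge0 ?subr_ge0// ltW.
have m0 : 0 < m%:R :> R by rewrite ltr0n.
pose a' (i : 'I_m) := a + i%:R * ((b - a) / m%:R).
have h i : volume_le (hits E (a' i) (a' i + (b - a) / m%:R)) ((c * r) ^+ d).
  have step0 : 0 <= (b - a) / m%:R by rewrite divr_ge0 ?subr_ge0// ltW.
  have up : (i%:R + 1) * ((b - a) / m%:R) <= b - a.
    apply: (@le_trans _ _ (m%:R * ((b - a) / m%:R))); last by rewrite mulrCA divff ?gt_eqF// mulr1.
    by rewrite ler_wpM2r// natr1 ler_nat.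
  apply: hits_short => //.
  - rewrite addrAC subrr add0r ler_pdivrMr// mulrC -ler_pdivrMr//; exact: ltW.
  - apply: le_trans Ta _; rewrite lerDl mulr_ge0//.
  - apply: le_trans bT; rewrite /a'; lra.
apply: volume_leS (volume_le_fin h).
  move=> x [t /andP[at1 tb] Et].
  have [i hi] := @interval_cut R a b t m isT (ltac:(by rewrite at1 tb)).
  by exists i => //; exists t.
have rd : r ^+ d = r * r ^+ d.-1 by rewrite -exprS prednK.
rewrite card_ord exprMn rd.
have p : 0 <= c ^+ d * (r * r ^+ d.-1).
  by rewrite mulr_ge0 ?exprn_ge0 ?(ltW c_gt0)// mulr_ge0 ?exprn_ge0 ?(ltW r0).
apply: le_trans (ler_wpM2r p m2) _.
suff -> : ((b - a) / r + 1) * (c ^+ d * (r * r ^+ d.-1)) = c ^+ d * r ^+ d.-1 * (b - a + r) by [].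
by field; rewrite gt_eqF.
Qed.

(** The swept volume is at most a constant times area times duration: [hits_box] is summed over a
    nearly optimal cover of [E] by sets of diameter at most e/2. *)
Lemma hits_hausdorff E (a b h e : R) : a <= b -> - T <= a -> b <= T -> 0 < e ->
  (hausdorff d.-1 E <= h%:E)%E ->
  forall v, 0 < v -> (v%:E <= @unit_ball_volume R d.-1)%E ->
  volume_le (hits E a b) (c ^+ d * 2 ^+ d.-1 / v * (h + e) * (b - a + e)).
Proof.
move=> ab Ta bT e0 Eh v v0 vle.
pose w := v / 2 ^+ d.-1.
have w0 : 0 < w by rewrite divr_gt0// exprn_gt0.
have e2 : 0 < e / 2 by rewrite divr_gt0.
have pre_h : (hausdorff_pre d.-1 (e / 2) E <= h%:E)%E.
  exact: le_trans (hausdorff_pre_le _ _ e2) Eh.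
have pre_fin : hausdorff_pre d.-1 (e / 2) E \is a fin_num.
  by rewrite ge0_fin_numE ?hausdorff_pre_ge0// (le_lt_trans pre_h)// ltry.
have [_ [F EF <-] hF] := lb_ereal_inf_adherent e2 pre_fin.
have {}hF : (\sum_(i <oo) hausdorff_weight d.-1 (e / 2) (F i) <= (h + e / 2)%:E)%E.
  by apply: le_trans (ltW hF) _; rewrite EFinD leeD2r.
have wfin j : hausdorff_weight d.-1 (e / 2) (F j) \is a fin_num.
  rewrite ge0_fin_numE ?hausdorff_weight_ge0//.
  apply: le_lt_trans (le_lt_trans hF (ltry _)).
  apply: le_trans (@nneseries_lim_ge R (fun i => hausdorff_weight d.-1 (e / 2) (F i)) xpredT
    0%N j.+1 _); last first.
    by move=> *; exact: hausdorff_weight_ge0.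
  by rewrite big_nat_recr//= leeDr// sume_ge0// => *; exact: hausdorff_weight_ge0.
(* The second term, of sum at most e/2, pays for the enlargement of each diameter by
   [expr_near_right]. *)
pose W j := fine (hausdorff_weight d.-1 (e / 2) (F j)) + e / 2 * 2 ^- j.+1.
have e2j j : 0 < e / 2 * 2 ^- j.+1 by rewrite mulr_gt0// invr_gt0 exprn_gt0.
have W0 j : 0 <= W j.
  by rewrite addr_ge0// ?(ltW (e2j j))// fine_ge0// hausdorff_weight_ge0.
have cw0 : 0 <= c ^+ d / w by rewrite divr_ge0 ?(ltW w0)// exprn_ge0// ltW.
have ba0 : 0 <= b - a + e by rewrite addr_ge0 ?subr_ge0// ltW.
have hitsF j : volume_le (hits (F j) a b) (c ^+ d / w * W j * (b - a + e)).
  have [F0|/set0P F0] := eqVneq (F j) set0.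
    apply: (@volume_leS _ _ _ set0 0); first by move=> x [t _]; rewrite F0.
      exact: mulr_ge0 (mulr_ge0 cw0 (W0 j)) ba0.
    exact: volume_le0.
  have := wfin j; rewrite /W /hausdorff_weight.
  case: pselect => //= [F0'|_]; first by move: F0; rewrite F0' => -[].
  case: ifPn => // diam_le; rewrite /W => fin_w.
  have diam_fin : ediam (F j) \is a fin_num.
    by rewrite ge0_fin_numE ?ediam_ge0// (le_lt_trans diam_le)// ltry.
  pose D := fine (ediam (F j)).
  have DE : ediam (F j) = D%:E by rewrite fineK.
  have D0 : 0 <= D by rewrite fine_ge0// ediam_ge0.
  have De : D <= e / 2 by rewrite -lee_fin -DE.
  have wD : w * D ^+ d.-1 <= fine (unit_ball_volume d.-1 * ((2 ^- d.-1)%:E * ediam (F j) ^+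
    d.-1))%E.
    rewrite -lee_fin fineK// DE -EFin_expe.
    apply: (@le_trans _ _ (v%:E * (2 ^- d.-1 * D ^+ d.-1)%:E)%E).
      by rewrite -EFinM /w mulrA.
    rewrite (EFinM (2 ^- d.-1)); move: vle; rewrite -EFinM => vle'.
    by apply: lee_wpmul2r => //; rewrite lee_fin mulr_ge0 ?exprn_ge0// invr_ge0 exprn_ge0.
  have [r [Dr re rD]] := @expr_near_right R d.-1 _ _ _ D0 e2 (divr_gt0 (e2j j) w0).
  have r0 : 0 < r by exact: le_lt_trans Dr.
  apply: (@volume_leS _ _ _ (hits (F j) a b) (c ^+ d * r ^+ d.-1 * (b - a + r))) => //; last first.
    apply: hits_box => // x y Fx Fy; apply: le_trans (ltW Dr).
    have := enorm_le_ediam Fx Fy; rewrite DE lee_fin; apply: le_trans.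
    by apply: norm_le_coord => [|i]; [exact: sqrtr_ge0|exact: coord_le_enorm].
  apply: ler_pM.
  - by rewrite mulr_ge0 ?exprn_ge0// ltW.
  - by rewrite addr_ge0 ?subr_ge0// ltW.
  - rewrite -mulrA ler_pM2l ?exprn_gt0// mulrC ler_pdivlMr//.
    rewrite mulrC; apply: le_trans (ler_wpM2l (ltW w0) rD) _.
    by rewrite mulrDr [X in _ + X]mulrCA divff ?gt_eqF// mulr1 lerD2r.
  - by rewrite lerD2l; lra.
apply: (@volume_leS _ _ _ (\bigcup_j hits (F j) a b) _ _ _ (lexx _)).
  by move=> x [t tab /EF[j _ Fx]]; exists j => //; exists t.
apply: (volume_le_bigcup hitsF).
rewrite (eq_eseriesr (g := fun j => (c ^+ d / w * (b - a + e))%:E * (W j)%:E)%E); last first.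
  by move=> j _; rewrite -EFinM mulrAC.
rewrite nneseriesZl; last by move=> j _; rewrite lee_fin.
have -> : c ^+ d * 2 ^+ d.-1 / v * (h + e) * (b - a + e) = c ^+ d / w * (b - a + e) * (h + e).
  by rewrite /w invf_div !mulrA mulrAC.
rewrite (EFinM _ (h + e)); apply: lee_wpmul2l; first by rewrite lee_fin mulr_ge0.
rewrite [X in (h + X)%:E](splitr e) addrA EFinD /W.
under eq_eseriesr do rewrite EFinD fineK//.
rewrite nneseriesD; last 2 first.
- by move=> *; exact: hausdorff_weight_ge0.
- by move=> k _ _; rewrite lee_fin ltW.
by apply: leeD => //; exact: geometric_series_le (ltW e2).
Qed.

Lemma hits_null_hausdorff E (a b : R) : a <= b -> - T <= a -> b <= T ->
  hausdorff d.-1 E = 0%E -> volume_null (hits E a b).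
Proof.
move=> ab Ta bT E0 eps eps0; have [v v0 vle] := @unit_ball_volume_gt0 R d.-1.
pose M := c ^+ d * 2 ^+ d.-1 / v * (b - a + 1).
have M0 : 0 < M.
  rewrite /M mulr_gt0//; first by rewrite divr_gt0// mulr_gt0// exprn_gt0.
  by rewrite ltr_wpDl// subr_ge0.
pose e := Num.min 1 (eps / M).
have e0 : 0 < e by rewrite lt_min ltr01 divr_gt0.
have e1 : e <= 1 by rewrite ge_min lexx.
have eM : e * M <= eps by rewrite -ler_pdivlMr// ge_min lexx orbT.
have Eh : (hausdorff d.-1 E <= 0%:E)%E by rewrite E0.
apply: volume_leS (hits_hausdorff ab Ta bT e0 Eh v0 vle) => //.
apply: le_trans eM; rewrite add0r /M mulrA [e * _]mulrC.
rewrite ler_wpM2l//; last by rewrite lerD2l.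
by rewrite mulr_ge0 ?(ltW e0)// divr_ge0 ?(ltW v0)// mulr_ge0 ?exprn_ge0// ltW.
Qed.

End FlowHits.

(** * Sets swept out by pieces that are nearly flat along the field *)

Section GraphCover.
Context {R : realType} {d : nat}.

(** Only the d - 1 coordinates other than [i] are cut, since the graph condition controls the last
    one. Hence m^(d-1) pieces suffice; [eta] is the thickness allowed around the graph. *)
Lemma graph_cover (E : set 'rV[R]_d) (i : 'I_d) (x0 : 'rV[R]_d) (r L eta : R) (m : nat) :
  (0 < m)%N -> 0 <= r -> 0 <= L -> 0 <= eta -> (forall x, E x -> `|x - x0| <= r) ->
  (forall x y s, 0 <= s -> E x -> E y -> (forall j, j != i -> `|x 0 j - y 0 j| <= s) ->
    `|x 0 i - y 0 i| <= L * s + eta) ->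
  exists P : {ffun 'I_d.-1 -> 'I_m} -> set 'rV[R]_d,
    [/\ E `<=` \bigcup_f P f, forall f, P f `<=` E &
        forall f x y, P f x -> P f y -> `|x - y| <= (L + 1) * (2 * r / m%:R) + eta].
Proof.
move=> m0 r0 L0 eta0 Er graph.
pose st := 2 * r / m%:R.
have st0 : 0 <= st by rewrite divr_ge0 ?ler0n// mulr_ge0.
pose a (j : 'I_d.-1) := x0 0 (lift i j) - r.
pose P (f : {ffun 'I_d.-1 -> 'I_m}) := [set x | E x /\ forall j,
  a j + (f j)%:R * st <= x 0 (lift i j) <= a j + (f j)%:R * st + st].
exists P; split=> [x Ex|f x []//|f x y [Ex hx] [Ey hy]].
  have /choice[g hg] j : exists k : 'I_m,
      a j + k%:R * st <= x 0 (lift i j) <= a j + k%:R * st + st.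
    have h := le_trans (coord_le_norm (x - x0) (lift i j)) (Er x Ex).
    rewrite !mxE ler_norml in h; move/andP: h => [h1 h2].
    have [|k hk] := @interval_cut R (a j) (a j + 2 * r) (x 0 (lift i j)) m m0.
      by rewrite /a; apply/andP; split; lra.
    by exists k; move: hk; have -> : a j + 2 * r - a j = 2 * r by rewrite addrC addKr.
  by exists (finfun g) => //; split=> // j; rewrite ffunE.
have hj j : j != i -> `|x 0 j - y 0 j| <= st.
  case: (unliftP i j) => [k ->|->]; last by rewrite eqxx.
  move=> _; have /andP[x1 x2] := hx k; have /andP[y1 y2] := hy k.
  by rewrite ler_norml; apply/andP; split; lra.
apply: norm_le_coord => [|j]; first by rewrite addr_ge0// mulr_ge0// addr_ge0.
rewrite !mxE mulrDl mul1r; have [->|/hj h] := eqVneq j i.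
  by apply: le_trans (graph x y st st0 Ex Ey hj) _; rewrite addrAC lerDl.
by apply: le_trans h _; rewrite addrAC lerDr addr_ge0// mulr_ge0.
Qed.

End GraphCover.

Section FlatHits.
Context {R : realType} {d : nat}.
Hypothesis d_gt0 : (0 < d)%N.
Variables (F : 'rV[R]_d -> 'rV[R]_d) (Phi : 'rV[R]_d -> R -> 'rV[R]_d) (B C L T : R).
Hypotheses (B_ge0 : 0 <= B) (C_ge0 : 0 <= C) (L_ge0 : 0 <= L).
Hypothesis F_lip : forall x y, `|F x - F y| <= L * `|x - y|.
Hypothesis Phi_sol : forall x, solution F (Phi x).
Hypothesis Phi0 : forall x, Phi x 0 = x.
Hypothesis PhiD : forall x s t, Phi (Phi x s) t = Phi x (t + s).
Hypothesis Phi_time : forall x s t, `|Phi x s - Phi x t| <= B * `|s - t|.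
Hypothesis Phi_space : forall x y t, `|t| <= T -> `|Phi x t - Phi y t| <= C * `|x - y|.

(** Comparing with the field at a point [y] off the orbit allows one direction F y to serve for a
    whole piece. *)
Lemma flow_displacement x y s i :
  `|Phi x s 0 i - x 0 i - s * F y 0 i| <= `|s| * (L * (B * `|s| + `|x - y|)).
Proof.
have key a b : a <= b -> exists2 u, a <= u <= b &
    Phi x b 0 i - Phi x a 0 i = F (Phi x u) 0 i * (b - a).
  move=> ab; have sol (t : R) : is_derive t 1 (fun s => Phi x s 0 i) (F (Phi x t) 0 i).
    exact: Phi_sol.
  have [|u] := @MVT_segment R (fun s => Phi x s 0 i) (fun t => F (Phi x t) 0 i) a b ab.
    by apply: is_derive1_within_continuous => t _; exact: sol.
  by rewrite in_itv /= => uab e; exists u.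
have [u us e] : exists2 u, `|u| <= `|s| & Phi x s 0 i - x 0 i = s * F (Phi x u) 0 i.
  have [s0|/ltW s0] := leP 0 s.
    have [u /andP[u0 us] e] := key 0 s s0; exists u; first by rewrite !ger0_norm.
    by move: e; rewrite Phi0 subr0 mulrC.
  have [u /andP[us u0] e] := key s 0 s0; exists u; first by rewrite !ler0_norm// lerN2.
  by move: e; rewrite Phi0 sub0r mulrN mulrC => /eqP; rewrite -eqr_oppLR opprB => /eqP.
rewrite e -mulrBr normrM ler_wpM2l//; apply: le_trans (coord_dist_le _ _ _) _.
apply: le_trans (F_lip _ _) _; rewrite ler_wpM2l//.
apply: le_trans (ler_distD x _ _) _; rewrite lerD2r.
by rewrite -[X in `|_ - X|]Phi0; apply: le_trans (Phi_time _ _ _) _; rewrite subr0 ler_wpM2l.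
Qed.

Variables (Z : set 'rV[R]_d) (i : 'I_d) (z0 : 'rV[R]_d) (r0 L1 : R).
Hypotheses (r0_ge0 : 0 <= r0) (L1_ge0 : 0 <= L1).
Hypothesis Z_ball : forall z, Z z -> `|z - z0| <= r0.
Hypothesis Z_graph : forall x y s, 0 <= s -> Z x -> Z y ->
  (forall j, j != i -> `|x 0 j - y 0 j| <= s) -> `|x 0 i - y 0 i| <= L1 * s.
Hypothesis Z_flat : forall eps, 0 < eps -> exists2 delta, 0 < delta &
  forall y, Z y -> exists n : 'rV[R]_d, [/\ exists2 k, n 0 k = 1 & forall j, `|n 0 j| <= 1,
    dotv n (F y) = 0 &
    forall z, Z z -> `|z - y| <= delta -> `|dotv n (z - y)| <= eps * `|z - y|].

Let c1 := (L1 + 1) * (2 * r0) + 1.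
Let c3 := c1 + B.
Let c4 := 2 * (d%:R + 1) * c3 + 2 * (c1 + 1).

Let c1_gt0 : 0 < c1.
Proof. by rewrite ltr_wpDl// mulr_ge0 ?addr_ge0// mulr_ge0. Qed.

Let c3_gt0 : 0 < c3. Proof. by rewrite ltr_pwDl. Qed.

Let c4_gt0 : 0 < c4.
Proof.
rewrite ltr_pwDl//; last by rewrite mulr_ge0// addr_ge0// ltW.
by rewrite mulr_gt0// mulr_gt0// ltr_wpDl// ler0n.
Qed.

(* [E], of size 1/m, lies within eps/m of a hyperplane parallel to the field; its
   orbit over a time 1/m does as well, so it is covered by about eps^(1-d) sets
   of size eps/m. *)
Let hits_flat_piece (E : set 'rV[R]_d) (y n : 'rV[R]_d) (k : 'I_d) (eps : R) (m m2 : nat) (t : R) :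
  (0 < m)%N -> (0 < m2)%N -> 0 < eps -> eps^-1 <= m2%:R ->
  d%:R * L * (B + c1) <= eps * m%:R -> - T <= t <= T ->
  E y -> (forall z, E z -> `|z - y| <= c1 / m%:R) ->
  n 0 k = 1 -> (forall j, `|n 0 j| <= 1) -> dotv n (F y) = 0 ->
  (forall z, E z -> `|dotv n (z - y)| <= eps * `|z - y|) ->
  volume_le (hits Phi E t (t + m%:R^-1))
    (#|{ffun 'I_d.-1 -> 'I_m2}|%:R * (3 * ((C + 1) * (c4 * eps / m%:R))) ^+ d).
Proof.
move=> m0 m20 eps0 m2e me tT Ey Ed nk n1 nF flat.
have mR : 0 < m%:R :> R by rewrite ltr0n.
have m2R : 0 < m2%:R :> R by rewrite ltr0n.
pose h : R := m%:R^-1.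
have h0 : 0 < h by rewrite invr_gt0.
(* The possible positions at time [t] of the points whose orbit meets [E] in the window. *)
pose G := [set g | exists z s, [/\ E z, 0 <= s <= h & g = Phi z (- s)]].
have Gball g : G g -> `|g - y| <= c3 / m%:R.
  move=> [z [s [Ez /andP[s0 sh] ->]]]; rewrite /c3 mulrDl [leRHS]addrC.
  apply: le_trans (ler_distD z _ _) _; apply: lerD; last exact: Ed.
  rewrite -[X in `|_ - X|]Phi0; apply: le_trans (Phi_time _ _ _) _.
  by rewrite subr0 normrN ger0_norm// ler_wpM2l.
have nbound (v : 'rV[R]_d) e : (forall j, `|v 0 j| <= e) -> `|dotv n v| <= d%:R * e.
  move=> ve; apply: le_trans (ler_norm_sum _ _ _) _.
  rewrite -[X in X%:R * _]card_ord -sum1_card natr_sum mulr_suml; apply: ler_sum => j _.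
  by rewrite normrM mul1r -[leRHS]mul1r; apply: ler_pM.
have Gflat g : G g -> `|dotv n (g - y)| <= eps * (c1 + 1) / m%:R.
  move=> [z [s [Ez /andP[s0 sh] ->]]].
  have -> : dotv n (Phi z (- s) - y) =
      dotv n (z - y) + dotv n (\row_j (Phi z (- s) 0 j - z 0 j - (- s) * F y 0 j)).
    have e0 : \sum_j n 0 j * (s * F y 0 j) = 0.
      by under eq_bigr do rewrite mulrCA; rewrite -mulr_sumr -/(dotv n (F y)) nF mulr0.
    rewrite -[LHS]addr0 -[X in _ + X = _]e0 /dotv -!big_split /=.
    by apply: eq_bigr => j _; rewrite !mxE; ring.
  apply: le_trans (ler_normD _ _) _; rewrite mulrDr mulr1 mulrDl; apply: lerD.
    apply: le_trans (flat z Ez) _; rewrite -mulrA ler_wpM2l// ?(ltW eps0)//; exact: Ed.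
  apply: le_trans (nbound _ (h * (L * (B * h + c1 / m%:R))) _) _.
    move=> j; rewrite mxE; apply: le_trans (flow_displacement z y (- s) j) _.
    rewrite normrN (ger0_norm s0); apply: ler_pM => //.
      by rewrite mulr_ge0// addr_ge0// mulr_ge0.
    by rewrite ler_wpM2l// lerD// ?ler_wpM2l//; exact: Ed.
  rewrite -/h; have -> :
    d%:R * (h * (L * (B * h + c1 * h))) = (d%:R * L * (B + c1) * h) * h by ring.
  by rewrite ler_wpM2r ?(ltW h0)// ler_pdivrMr.
(* As n_k = 1, closeness to the hyperplane normal to [n] determines the k-th coordinate from the
   others up to the thickness: [G] is a thickened graph. *)
have graphG g1 g2 s : 0 <= s -> G g1 -> G g2 -> (forall j, j != k -> `|g1 0 j - g2 0 j| <= s) ->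
    `|g1 0 k - g2 0 k| <= d%:R * s + 2 * (eps * (c1 + 1) / m%:R).
  move=> s0 G1 G2 hs.
  have -> : g1 0 k - g2 0 k = (dotv n (g1 - y) - dotv n (g2 - y)) -
      \sum_(j | j != k) n 0 j * (g1 0 j - g2 0 j).
    rewrite /dotv -sumrB (bigD1 k)//= nk !mxE !mul1r.
    rewrite (eq_bigr (fun j => n 0 j * (g1 0 j - g2 0 j))); first by ring.
    by move=> j _; rewrite !mxE; ring.
  apply: le_trans (ler_normB _ _) _; rewrite addrC; apply: lerD; last first.
    apply: le_trans (ler_normB _ _) _; rewrite mulr2n mulrDl mul1r; apply: lerD; exact: Gflat.
  apply: le_trans (ler_norm_sum _ _ _) _.
  rewrite -[X in X%:R * _]card_ord -sum1_card natr_sum mulr_suml.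
  rewrite [leRHS](bigD1 k)//= mul1r -[leLHS]add0r; apply: lerD => //.
  by apply: ler_sum => j jk; rewrite normrM -[leRHS]mul1r; apply: ler_pM => //; exact: hs.
have [|||P [GP PG dP]] := @graph_cover R d G k y (c3 / m%:R) d%:R
    (2 * (eps * (c1 + 1) / m%:R)) m2 m20 _ _ _ Gball graphG.
- by rewrite divr_ge0 ?ltW.
- exact: ler0n.
- by rewrite mulr_ge0// divr_ge0 ?ler0n// mulr_ge0 ?(ltW eps0)// addr_ge0// ltW.
apply: (@volume_leS _ _ _ (\bigcup_f [set x | P f (Phi x t)]) _ _ _ (lexx _)).
  move=> x [s /andP[ts st] Es].
  have : G (Phi x t).
    exists (Phi x s), (s - t); split=> //; last by rewrite PhiD opprB subrK.
    by apply/andP; split; rewrite /h; lra.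
  by move=> /GP[f _ Pf]; exists f.
apply: volume_le_fin => f.
have r1 : 0 < (C + 1) * (c4 * eps / m%:R).
  by rewrite mulr_gt0 ?divr_gt0 ?mulr_gt0// ltr_wpDl.
apply: volume_le_diam => // x x' Px Px'.
have back z : z = Phi (Phi z t) (- t) by rewrite PhiD addNr Phi0.
rewrite (back x) (back x'); apply: le_trans (Phi_space _ _ _) _.
  by rewrite normrN ler_norml.
apply: ler_pM => //; first by rewrite lerDl.
apply: le_trans (dP f _ _ Px Px') _.
have e2 : 2 * (c3 / m%:R) / m2%:R <= 2 * (c3 / m%:R) * eps.
  rewrite ler_wpM2l//; first by rewrite mulr_ge0// divr_ge0 ?ltW.
  by rewrite invf_ple ?posrE// .
apply: le_trans (lerD (ler_wpM2l (addr_ge0 (ler0n R d) ler01) e2) (lexx _)) _.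
by rewrite /c4 le_eqVlt; apply/orP; left; apply/eqP; ring.
Qed.

(** There are m^(d-1) pieces, about m time windows, and for each of them about eps^(1-d) sets of
    volume of order (eps/m)^d. The product is of order eps, whatever [m]; [M] collects the
    constants. *)
Lemma flat_hits_null (a b : R) : a <= b -> - T <= a -> b <= T -> volume_null (hits Phi Z a b).
Proof.
move=> ab Ta bT e e0.
pose M := (b - a + 2) * 2 ^+ d.-1 * (3 * ((C + 1) * c4)) ^+ d.
have p1 : 0 < 3 * ((C + 1) * c4) by rewrite mulr_gt0// mulr_gt0// ltr_wpDl.
have ba2 : 0 < b - a + 2 by rewrite ltr_wpDl// subr_ge0.
have M0 : 0 < M by rewrite !mulr_gt0// exprn_gt0.
pose eps := Num.min 1 (e / M).
have eps0 : 0 < eps by rewrite lt_min ltr01 divr_gt0.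
have eps1 : eps <= 1 by rewrite ge_min lexx.
have epsM : eps * M <= e by rewrite -ler_pdivlMr// ge_min lexx orbT.
have [delta delta0 flat] := Z_flat eps0.
pose m2 := (Num.truncn eps^-1).+1.
have m2_ge : eps^-1 <= m2%:R by rewrite ltW// truncnS_gt.
have m2_le : m2%:R <= 2 / eps.
  have e1 : 1 <= eps^-1 by rewrite invf_ge1.
  have : (Num.truncn eps^-1)%:R <= eps^-1 by rewrite truncn_le// invr_ge0 ltW.
  by rewrite /m2 -natr1; lra.
(* Large enough for the pieces to be smaller than [delta] and for the variation of the field, during
   a window and over a piece, to displace a point by no more than eps/m. *)
pose m := (Num.truncn (c1 / delta + d%:R * L * (B + c1) / eps)).+1.
have mR : 0 < m%:R :> R by rewrite ltr0n.
have q1 : 0 <= c1 / delta by rewrite divr_ge0 ?ltW.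
have q2 : 0 <= d%:R * L * (B + c1) / eps.
  exact: divr_ge0 (mulr_ge0 (mulr_ge0 (ler0n R d) L_ge0) (addr_ge0 B_ge0 (ltW c1_gt0))) (ltW eps0).
have m_gt : c1 / delta + d%:R * L * (B + c1) / eps < m%:R by exact: truncnS_gt.
have m_delta : c1 / m%:R <= delta.
  by rewrite ler_pdivrMr// -ler_pdivrMl// mulrC; lra.
have m_eps : d%:R * L * (B + c1) <= eps * m%:R.
  by rewrite -ler_pdivrMl// mulrC; lra.
have graph0 x y s : 0 <= s -> Z x -> Z y -> (forall j, j != i -> `|x 0 j - y 0 j| <= s) ->
  `|x 0 i - y 0 i| <= L1 * s + 0 by rewrite addr0; exact: Z_graph.
have [P [ZP PZ dP]] := @graph_cover R d Z i z0 r0 L1 0 m isT r0_ge0 L1_ge0 (lexx 0) Z_ball graph0.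
pose w := (Num.truncn ((b - a) * m%:R)).+1.
have w_gt : (b - a) * m%:R < w%:R by exact: truncnS_gt.
have w_le : w%:R <= (b - a + 1) * m%:R.
  have : (Num.truncn ((b - a) * m%:R))%:R <= (b - a) * m%:R.
    by rewrite truncn_le// mulr_ge0 ?subr_ge0// ltW.
  have : 1 <= m%:R :> R by rewrite ler1n.
  rewrite /w -natr1 mulrDl; lra.
have wR : 0 < w%:R :> R by rewrite ltr0n.
have st_le : (b - a) / w%:R <= m%:R^-1.
  by rewrite ler_pdivrMr// mulrC -ler_pdivrMr ?invr_gt0// invrK ltW.
have st0 : 0 <= (b - a) / w%:R by rewrite divr_ge0 ?subr_ge0// ltW.
pose t_ (k : 'I_w) := a + k%:R * ((b - a) / w%:R).
have tT k : - T <= t_ k <= T.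
  have up : k%:R * ((b - a) / w%:R) <= b - a.
    apply: (@le_trans _ _ (w%:R * ((b - a) / w%:R))); last by rewrite mulrCA divff ?gt_eqF// mulr1.
    by rewrite ler_wpM2r// ler_nat ltnW.
  have lo : 0 <= k%:R * ((b - a) / w%:R) by rewrite mulr_ge0.
  by rewrite /t_; apply/andP; split; lra.
have piece f k : volume_le (hits Phi (P f) (t_ k) (t_ k + m%:R^-1))
    (#|{ffun 'I_d.-1 -> 'I_m2}|%:R * (3 * ((C + 1) * (c4 * eps / m%:R))) ^+ d).
  have [Pf0|/set0P[y Py]] := eqVneq (P f) set0.
    apply: (@volume_leS _ _ _ set0 0); first by move=> x [t _]; rewrite Pf0.
      have q3 : 0 <= c4 * eps / m%:R.
        by rewrite divr_ge0 ?ler0n// mulr_ge0 ?(ltW eps0)// ltW.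
      by rewrite mulr_ge0 ?ler0n// exprn_ge0// mulr_ge0// mulr_ge0// addr_ge0.
    exact: volume_le0.
  have [n [[k1 nk n1] nF nflat]] := flat y (PZ f y Py).
  have dPy z : P f z -> `|z - y| <= c1 / m%:R.
    move=> Pz; apply: le_trans (dP f z y Pz Py) _.
    rewrite addr0 mulrA ler_wpM2r ?invr_ge0 ?(ltW mR)// /c1 mulrA lerDl//.
  apply: (@hits_flat_piece (P f) y n k1 eps m m2) => //.
  by move=> z Pz; apply: nflat; [exact: PZ Pz|exact: le_trans (dPy z Pz) m_delta].
apply: (@volume_leS _ _ _ (\bigcup_f \bigcup_k hits Phi (P f) (t_ k) (t_ k + m%:R^-1)) _
    _ _ _ (volume_le_fin (fun f => volume_le_fin (piece f)))).
  move=> x [t tab Zx]; have [f _ Pfx] := ZP _ Zx.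
  have [k /andP[k1 k2]] := @interval_cut R a b t w isT tab.
  exists f => //; exists k => //; exists t => //.
  by rewrite k1/=; apply: le_trans k2 _; rewrite lerD2l.
apply: le_trans epsM; rewrite !card_ffun !card_ord !natrX.
have -> : (3 * ((C + 1) * (c4 * eps / m%:R))) ^+ d =
    (3 * ((C + 1) * c4)) ^+ d * (eps / m%:R) ^+ d by rewrite -exprMn; congr (_ ^+ d); ring.
set q := (3 * _) ^+ d.
have q0 : 0 < q by rewrite exprn_gt0.
have rd (x : R) : x ^+ d = x * x ^+ d.-1 by rewrite -exprS prednK.
have -> : m%:R ^+ d.-1 * (w%:R * (m2%:R ^+ d.-1 * (q * (eps / m%:R) ^+ d))) =
    q * (w%:R / m%:R) * (m2%:R * eps) ^+ d.-1 * eps.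
  rewrite (rd (eps / _)) !exprMn exprVn; field.
  by rewrite expf_neq0 ?gt_eqF.
rewrite [leRHS]mulrC ler_wpM2r ?(ltW eps0)//.
have -> : M = q * (b - a + 2) * 2 ^+ d.-1 by rewrite /M -/q; ring.
apply: ler_pM.
- by rewrite mulr_ge0 ?(ltW q0)// divr_ge0 ?ler0n.
- by rewrite exprn_ge0// mulr_ge0 ?ler0n// ltW.
- rewrite ler_wpM2l ?(ltW q0)// ler_pdivrMr//; apply: le_trans w_le _.
  by rewrite ler_wpM2r ?(ltW mR)//; lra.
- rewrite lerXn2r ?nnegrE ?ler0n ?mulr_ge0 ?ler0n ?(ltW eps0)//.
  by rewrite -ler_pdivlMr.
Qed.

End FlatHits.

(** * Second-order geometry of zero sets *)

Section Segments.
Context {R : realType} {V : normedModType R}.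
Implicit Types x y z : V.

Lemma mvt_points (f : V -> R) x y : (forall w, differentiable f w) ->
  exists2 t, 0 <= t <= 1 & f y - f x = 'D_(y - x) f (x + t *: (y - x)).
Proof.
move=> df; have := @segment_mvt R V f x (y - x) (fun _ _ => df _).
by rewrite [x + (y - x)]addrC subrK.
Qed.

Lemma convex_points x y z (r t : R) : `|z - x| < r -> `|z - y| < r ->
  0 <= t <= 1 -> `|z - (x + t *: (y - x))| < r.
Proof. by move=> zx zy; apply: convex_ball => //; rewrite [x + _]addrC subrK. Qed.

End Segments.

Section C2Functions.
Context {R : realType} {d : nat}.
Implicit Types (f rho : 'rV[R]_d -> R) (x y z v w : 'rV[R]_d).

Lemma C1_near_bound f z : Ck 1 f -> exists r M, [/\ 0 < r, 0 <= M &
  forall w v, `|z - w| < r -> `|'D_v f w| <= M * `|v|].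
Proof.
move=> [df cD].
have nearM : \forall w \near z, forall j,
    `|'D_(delta_mx 0 j : 'rV[R]_d) f w| <= `|'D_(delta_mx 0 j : 'rV[R]_d) f z| + 1.
  apply: (@filter_forall _ _ _ _ (nbhs_filter z)) => j.
  have /cvgrPdist_le/(_ 1 ltr01) := cD (delta_mx 0 j) z.
  apply: filterS => w h; rewrite -[X in `|X|](subrK ('D_(delta_mx 0 j : 'rV[R]_d) f z)).
  by apply: le_trans (ler_normD _ _) _; rewrite addrC lerD2l distrC.
have [r r0 hr] := @near_norm_ball R 'rV[R]_d z _ nearM.
exists r, (\sum_j (`|'D_(delta_mx 0 j : 'rV[R]_d) f z| + 1)); split=> // [|w v /hr hj].
  by apply: sumr_ge0 => j _; rewrite addr_ge0.
rewrite derive_sum_coord//; apply: le_trans (ler_norm_sum _ _ _) _; rewrite mulr_suml.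
by apply: ler_sum => j _; rewrite normrM mulrC; apply: ler_pM => //; exact: coord_le_norm.
Qed.

Lemma Ck2_diff rho x : Ck 2 rho -> differentiable rho x.
Proof. by case. Qed.

Lemma Ck2_derive_continuous rho v : Ck 2 rho -> continuous ('D_v rho).
Proof. by move=> [_ /(_ v)[d1 _]] x; exact: differentiable_continuous. Qed.

Lemma Ck2_Ck1 rho : Ck 2 rho -> Ck 1 rho.
Proof. by move=> C2; split=> [x|v]; [exact: Ck2_diff|exact: Ck2_derive_continuous]. Qed.

Lemma C2_near_bound rho z : Ck 2 rho -> exists r M, [/\ 0 < r, 0 <= M,
  forall y v, `|z - y| < r -> `|'D_v rho y| <= M * `|v|,
  forall x y v, `|z - x| < r -> `|z - y| < r ->
    `|'D_v rho y - 'D_v rho x| <= M * `|v| * `|y - x| &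
  forall x y, `|z - x| < r -> `|z - y| < r ->
    `|rho y - rho x - 'D_(y - x) rho x| <= M * `|y - x| ^+ 2].
Proof.
move=> C2; have [r1 [M1 [r10 M10 h1]]] := C1_near_bound z (Ck2_Ck1 C2).
have /choice[rM hrM] j : exists rM : R * R, [/\ 0 < rM.1, 0 <= rM.2 &
    forall w v, `|z - w| < rM.1 -> `|'D_v ('D_(delta_mx 0 j : 'rV[R]_d) rho) w| <= rM.2 * `|v|].
  have [_ /(_ (delta_mx 0 j)) C1] := C2.
  by have [r [M h]] := C1_near_bound z C1; exists (r, M).
pose r := \big[Num.min/r1]_j (rM j).1.
have r0 : 0 < r by apply: lt_bigmin => // j _; have [] := hrM j.
have rr1 : r <= r1 by exact: bigmin_le_id.
have rrj j : r <= (rM j).1 by exact: bigmin_le.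
pose M := M1 + \sum_j (rM j).2.
have M2 : 0 <= \sum_j (rM j).2 by apply: sumr_ge0 => j _; have [] := hrM j.
have DD x y v : `|z - x| < r -> `|z - y| < r ->
    `|'D_v rho y - 'D_v rho x| <= M * `|v| * `|y - x|.
  move=> zx zy; rewrite !derive_sum_coord; try exact: Ck2_diff.
  rewrite -sumrB; apply: le_trans (ler_norm_sum _ _ _) _.
  apply: (@le_trans _ _ (\sum_j (rM j).2 * `|v| * `|y - x|)); last first.
    by rewrite -!mulr_suml ler_wpM2r// ler_wpM2r// /M lerDr.
  apply: ler_sum => j _; rewrite -mulrBr normrM mulrAC [leRHS]mulrC.
  apply: ler_pM => //; first exact: coord_le_norm.
  have dj w : differentiable ('D_(delta_mx 0 j : 'rV[R]_d) rho) w.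
    by have [_ /(_ (delta_mx 0 j))[]] := C2.
  have [t t01 ->] := mvt_points x y dj; have [_ _] := hrM j; apply.
  by apply: lt_le_trans (rrj j); exact: convex_points.
exists r, M; split=> //.
- by rewrite addr_ge0.
- move=> y v zy; apply: le_trans (h1 y v (lt_le_trans zy rr1)) _.
  by rewrite ler_wpM2r// lerDl.
- move=> x y zx zy.
  have [t t01 ->] := mvt_points x y (fun w => Ck2_diff w C2).
  have zt := convex_points zx zy t01.
  apply: le_trans (DD x _ (y - x) zx zt) _.
  have -> : x + t *: (y - x) - x = t *: (y - x) by rewrite addrC addKr.
  rewrite normrZ.
  rewrite -mulrA expr2; apply: ler_wpM2l; first by rewrite addr_ge0.
  apply: ler_wpM2l => //; have /andP[t0 t1] := t01.
  by rewrite ger0_norm// ler_piMl.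
Qed.

Lemma grad_neq0 rho z : grad rho z != 0 ->
  exists i, 'D_(delta_mx 0 i : 'rV[R]_d) rho z != 0.
Proof.
move=> g0; apply: contrapT => /forallNP h; move/negP: g0; apply; apply/eqP/rowP => i.
by rewrite !mxE; apply/eqP; apply: contrapT => /negP; exact: h.
Qed.

(** The Lipschitz half of the implicit function theorem: on a segment joining two zeros some
    directional derivative vanishes, and the i-th partial derivative, bounded away from 0, forces
    the i-th coordinate to be controlled by the others. *)
Lemma zero_set_graph rho z : Ck 2 rho -> grad rho z != 0 ->
  exists i r L, [/\ 0 < r, 0 <= L & forall x y s, 0 <= s ->
    `|z - x| < r -> `|z - y| < r -> rho x = 0 -> rho y = 0 ->
    (forall j, j != i -> `|x 0 j - y 0 j| <= s) -> `|x 0 i - y 0 i| <= L * s].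
Proof.
move=> C2 /grad_neq0[i Di0]; have [r [M [r0 M0 D1 DD _]]] := C2_near_bound z C2.
set Dz := 'D__ rho z in Di0; pose c := `|Dz| / 2.
have c0 : 0 < c by rewrite divr_gt0// normr_gt0.
have nearc : \forall w \near z, `|Dz - 'D_(delta_mx 0 i : 'rV[R]_d) rho w| <= c.
  by have /cvgrPdist_le := @Ck2_derive_continuous rho (delta_mx 0 i) C2 z; apply.
have [r1 r10 hr1] := @near_norm_ball R 'rV[R]_d z _ nearc.
exists i, (Num.min r r1), (d%:R * M / c); split.
- by rewrite lt_min r0.
- by rewrite divr_ge0 ?(ltW c0)// mulr_ge0 ?ler0n.
move=> x y s s0; rewrite !lt_min => /andP[zx zx1] /andP[zy zy1] x0 y0 hs.
have [t t01] := mvt_points y x (fun w => Ck2_diff w C2).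
rewrite x0 y0 subrr; set w := y + _ => e.
have zw : `|z - w| < r by exact: convex_points.
have zw1 : `|z - w| < r1 by exact: convex_points.
move: e; rewrite derive_sum_coord; last exact: Ck2_diff.
rewrite (bigD1 i)//= => /esym/eqP; rewrite addr_eq0 => /eqP e.
have Dw : c <= `|'D_(delta_mx 0 i : 'rV[R]_d) rho w|.
  have : `|Dz| <= `|Dz - 'D_(delta_mx 0 i : 'rV[R]_d) rho w| +
    `|'D_(delta_mx 0 i : 'rV[R]_d) rho w|.
    by rewrite -{1}(subrK ('D_(delta_mx 0 i : 'rV[R]_d) rho w) Dz) ler_normD.
  have := hr1 w zw1; rewrite /c; lra.
rewrite mulrAC ler_pdivlMr//.
have -> : x 0 i - y 0 i = (x - y) 0 i by rewrite !mxE.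
apply: (@le_trans _ _ (`|(x - y) 0 i| * `|'D_(delta_mx 0 i : 'rV[R]_d) rho w|)).
  by rewrite ler_wpM2l.
rewrite -normrM e normrN; apply: le_trans (ler_norm_sum _ _ _) _.
rewrite -[X in X%:R * _ * _]card_ord -sum1_card natr_sum -mulrA mulr_suml.
rewrite [leRHS](bigD1 i)//= mul1r -[leLHS]add0r; apply: lerD; first by rewrite mulr_ge0.
apply: ler_sum => j ji; rewrite normrM mulrC; apply: ler_pM => //.
  apply: le_trans (D1 w _ zw) _; rewrite ler_piMr//; apply: norm_le_coord => // k.
  by rewrite !mxE; case: (_ && _); rewrite ?normr1 ?normr0.
by rewrite !mxE; exact: hs.
Qed.

(* Along [y + t e + s h] the equation [rho = 0] is solved by some [|s| <= K t],
   whereas there [rho'] is [t 'D_e rho' + O(t^2)]. *)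
Lemma tangent_direction_unique rho rho' y h : Ck 2 rho -> Ck 2 rho' ->
  grad rho' y != 0 -> rho y = 0 -> rho' y = 0 ->
  (\forall w \near y, rho w = 0 <-> rho' w = 0) ->
  'D_h rho' y = 0 -> 'D_h rho y = 0.
Proof.
move=> C2 C2' /grad_neq0[i Di0] y0 y0' same Dh'.
wlog Dh : h Dh' / 0 < 'D_h rho y.
  move=> wl; have [//|] := eqVneq ('D_h rho y) 0; rewrite neq_lt => /orP[neg|]; last exact: wl.
  have DN f : Ck 2 f -> 'D_(- h) f y = - 'D_h f y.
    by move=> Cf; rewrite !deriveE ?linearN//; exact: Ck2_diff.
  have := wl (- h); rewrite !DN// Dh' oppr0 oppr_gt0 => /(_ erefl neg)/eqP.
  by rewrite oppr_eq0 => /eqP.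
exfalso.
pose e : 'rV[R]_d := delta_mx 0 i; set ka := 'D_h rho y in Dh.
(* At s = K t and s = - K t the term s [ka] outweighs t 'D_e rho by t, which exceeds the
   second-order error, so [rho] takes both signs. *)
pose K := (`|'D_e rho y| + 1) / ka.
have K0 : 0 < K by rewrite divr_gt0// ltr_wpDl.
have [r [M [r0 M0 _ _ T2]]] := C2_near_bound y C2.
have [r' [M' [r'0 M'0 _ _ T2']]] := C2_near_bound y C2'.
have [r2 r20 hr2] := @near_norm_ball R 'rV[R]_d y _ same.
pose q := `|e| + K * `|h| + 1.
have q0 : 0 < q by rewrite ltr_wpDl// addr_ge0// mulr_ge0// ltW.
pose r3 := Num.min r (Num.min r' r2).
have r30 : 0 < r3 by rewrite !lt_min r0 r'0.
(* Since all displacements are at most t q, this keeps the points in the three balls and the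
   second-order errors below t for [rho], below t |'D_e rho'| for [rho']. *)
pose t := Num.min (r3 / (2 * q)) (Num.min ((2 * (M + 1) * q ^+ 2)^-1)
  (`|'D_e rho' y| / (2 * (M' + 1) * q ^+ 2))).
have M1 : 0 < M + 1 by rewrite ltr_wpDl.
have M'1 : 0 < M' + 1 by rewrite ltr_wpDl.
have q2 : 0 < q ^+ 2 by rewrite exprn_gt0.
have t0 : 0 < t.
  by rewrite !lt_min invr_gt0 !divr_gt0 ?mulr_gt0// normr_gt0.
have t1 : t * (2 * q) <= r3 by rewrite -ler_pdivlMr ?mulr_gt0// ge_min lexx.
have t2 : t * (2 * (M + 1) * q ^+ 2) <= 1.
  by rewrite -ler_pdivlMr ?mulr_gt0// mul1r !ge_min lexx orbT.
have t3 : t * (2 * (M' + 1) * q ^+ 2) <= `|'D_e rho' y|.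
  by rewrite -ler_pdivlMr ?mulr_gt0// !ge_min lexx !orbT.
pose p (s : R) := t *: e + s *: h.
have pE s : y + p s - y = p s by rewrite addrC addKr.
have p_le s : `|s| <= K * t -> `|p s| <= t * q.
  move=> sK; apply: le_trans (ler_normD _ _) _; rewrite !normrZ (ger0_norm (ltW t0)).
  have : `|s| * `|h| <= K * t * `|h| by rewrite ler_wpM2r.
  rewrite /q; lra.
have p_ball s : `|s| <= K * t -> `|y - (y + p s)| < r3.
  move=> /p_le sK; rewrite opprD addrA subrr add0r normrN; apply: le_lt_trans sK _.
  have := mulr_gt0 t0 q0; lra.
have ylt s : 0 < s -> `|y - y| < s by rewrite subrr normr0.
have exp f s : Ck 2 f -> 'D_(p s) f y = t * 'D_e f y + s * 'D_h f y.
  move=> Cf; rewrite deriveE; last exact: Ck2_diff.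
  by rewrite linearD !linearZ/= -!deriveE//; exact: Ck2_diff.
have taylor s : `|s| <= K * t -> `|rho (y + p s) - (t * 'D_e rho y + s * ka)| <= M * (t * q) ^+ 2.
  move=> sK; have := p_ball s sK; rewrite !lt_min => /andP[b1 _].
  have := T2 y (y + p s) (ylt _ r0) b1; rewrite pE exp// y0 subr0.
  move=> /le_trans; apply; rewrite ler_wpM2l// lerXn2r ?nnegrE//; last exact: p_le.
  by rewrite mulr_ge0// ltW.
have taylor' s : `|s| <= K * t -> `|rho' (y + p s) - t * 'D_e rho' y| <= M' * (t * q) ^+ 2.
  move=> sK; have := p_ball s sK; rewrite !lt_min => /andP[_ /andP[b1 _]].
  have := T2' y (y + p s) (ylt _ r'0) b1; rewrite pE exp// y0' subr0 Dh' mulr0 addr0.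
  move=> /le_trans; apply; rewrite ler_wpM2l// lerXn2r ?nnegrE//; last exact: p_le.
  by rewrite mulr_ge0// ltW.
have Kt0 : 0 < K * t by rewrite mulr_gt0.
have small : M * (t * q) ^+ 2 < t.
  have -> : M * (t * q) ^+ 2 = t * (t * (M * q ^+ 2)) by ring.
  rewrite gtr_pMr//; have h1 : t * q ^+ 2 > 0 by rewrite mulr_gt0.
  have h2 : 0 <= t * (M * q ^+ 2) by rewrite !mulr_ge0// ltW.
  have : t * (2 * (M + 1) * q ^+ 2) = 2 * (t * (M * q ^+ 2)) + 2 * (t * q ^+ 2) by ring.
  lra.
have small' : M' * (t * q) ^+ 2 < t * `|'D_e rho' y|.
  have -> : M' * (t * q) ^+ 2 = t * (t * (M' * q ^+ 2)) by ring.
  rewrite ltr_pM2l//; have h1 : t * q ^+ 2 > 0 by rewrite mulr_gt0.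
  have h2 : 0 <= t * (M' * q ^+ 2) by rewrite !mulr_ge0// ltW.
  have : t * (2 * (M' + 1) * q ^+ 2) = 2 * (t * (M' * q ^+ 2)) + 2 * (t * q ^+ 2) by ring.
  lra.
have Kka : K * t * ka = t * `|'D_e rho y| + t.
  by rewrite /K mulrAC divfK ?gt_eqF// mulrDl mul1r mulrC.
have hi : 0 < rho (y + p (K * t)).
  have := taylor (K * t); rewrite ger0_norm ?(ltW Kt0)// => /(_ (lexx _))/ler_normlP[h1 _].
  have : - (t * `|'D_e rho y|) <= t * 'D_e rho y.
    by rewrite -mulrN ler_wpM2l ?(ltW t0)// lerNl -normrN ler_norm.
  lra.
have lo : rho (y + p (- (K * t))) < 0.
  have := taylor (- (K * t));
    rewrite normrN ger0_norm ?(ltW Kt0)// => /(_ (lexx _))/ler_normlP[_ h1].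
  have : t * 'D_e rho y <= t * `|'D_e rho y| by rewrite ler_wpM2l ?(ltW t0)// ler_norm.
  rewrite mulNr in h1; lra.
have [|||s] := @IVT R (fun s => rho (y + p s)) (- (K * t)) (K * t) 0.
- lra.
- apply: is_derive1_within_continuous => s _.
  have -> : (fun s => rho (y + p s)) = (fun s => rho ((y + t *: e) + s *: h)).
    by apply/funext => u; rewrite /p addrA.
  by apply: is_derive_line; exact: Ck2_diff.
- by rewrite ge_min le_max (ltW lo) (ltW hi) orbT.
rewrite in_itv /= -ler_norml => sK rs0.
have : rho' (y + p s) = 0.
  by apply/hr2 => //; have := p_ball s sK; rewrite !lt_min => /andP[_ /andP[_]].
move=> r's; have := taylor' s sK; rewrite r's sub0r normrN normrM (ger0_norm (ltW t0)).
lra.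
Qed.

End C2Functions.

(** * Orbits meeting tangency points or intersections of interfaces *)

Section NullHits.
Context {R : realType} {d : nat}.
Hypothesis d_gt0 : (0 < d)%N.
Variables (F : 'rV[R]_d -> 'rV[R]_d) (Phi : 'rV[R]_d -> R -> 'rV[R]_d) (B C L T : R).
Hypotheses (B_ge0 : 0 <= B) (C_ge0 : 0 <= C) (L_ge0 : 0 <= L).
Hypothesis F_lip : forall x y, `|F x - F y| <= L * `|x - y|.
Hypothesis F_bnd : forall x, `|F x| <= B.
Hypothesis Phi_sol : forall x, solution F (Phi x).
Hypothesis Phi0 : forall x, Phi x 0 = x.
Hypothesis PhiD : forall x s t, Phi (Phi x s) t = Phi x (t + s).
Hypothesis Phi_time : forall x s t, `|Phi x s - Phi x t| <= B * `|s - t|.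
Hypothesis Phi_space : forall x y t, `|t| <= T -> `|Phi x t - Phi y t| <= C * `|x - y|.
Variables (a b : R).
Hypotheses (ab : a <= b) (Ta : - T <= a) (bT : b <= T).

(** A Lindelof argument: there are countably many dyadic cells, and each point of [Z] lies in one
    that is inside its good ball. The first condition in [A n k] discards the other cells. *)
Lemma hits_null_local (Z : set 'rV[R]_d) :
  (forall z, Z z -> exists2 r, 0 < r &
     volume_null (hits Phi (Z `&` [set y | `|z - y| < r]) a b)) ->
  volume_null (hits Phi Z a b).
Proof.
move=> loc.
pose cell n k : set 'rV[R]_d := [set x | @grid R d n (x, 0) = k].
pose A n k := [set x | volume_null (hits Phi (Z `&` cell n k) a b) /\
  hits Phi (Z `&` cell n k) a b x].
apply: (@volume_nullS _ _ _ (\bigcup_n \bigcup_k A n k)).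
  move=> x [t tab Zt]; have [r r0 hr] := loc _ Zt.
  have [n hn] := @near_grid R d (fun w => `|Phi x t - w.1| < r) (Phi x t, 0)
    (cvg_fst (near_dist_lt (Phi x t) r0)).
  exists n => //; exists (@grid R d n (Phi x t, 0)) => //; split; last by exists t.
  apply: volume_nullS hr => w [s sab [Zs cs]]; exists s => //; split=> //=.
  exact: (hn (Phi w s, 0)).
apply: volume_null_bigcup => n; apply: volume_null_bigcup => k.
have [nn|nn] := pselect (volume_null (hits Phi (Z `&` cell n k) a b)).
  by apply: volume_nullS nn => x [].
by move=> e e0; apply: volume_leS (volume_le0 (ltW e0)) => // x [].
Qed.

Lemma norm_coord_max (v : 'rV[R]_d) : v != 0 -> exists2 k, v 0 k != 0 & `|v| = `|v 0 k|.
Proof.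
move=> v0; have /mx_norm_neq0[[i k]] : mx_norm v != 0 by rewrite -[mx_norm v]/`|v| normr_eq0.
rewrite -[mx_norm v]/`|v| /= ord1 => e; exists k => //.
by rewrite -normr_eq0 -e normr_eq0.
Qed.

Lemma dotvZl (c : R) (x y : 'rV[R]_d) : dotv (c *: x) y = c * dotv x y.
Proof. by rewrite /dotv mulr_sumr; apply: eq_bigr => i _; rewrite mxE mulrA. Qed.

Lemma dotvC (x y : 'rV[R]_d) : dotv x y = dotv y x.
Proof. by apply: eq_bigr => i _; rewrite mulrC. Qed.

Lemma dotvBl (x y z : 'rV[R]_d) : dotv (x - y) z = dotv x z - dotv y z.
Proof. by rewrite /dotv -sumrB; apply: eq_bigr => i _; rewrite !mxE mulrBl. Qed.

(** A quadratic error is below any given multiple of the distance at short range. Dividing [n] by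
    its largest coordinate produces the normalisation of [flat_hits_null], and the lower bound [c]
    keeps the range uniform. *)
Lemma flat_hits_null_local (Z : set 'rV[R]_d) (rho : 'rV[R]_d -> R)
    (n : 'rV[R]_d -> 'rV[R]_d) (z : 'rV[R]_d) (r c K : R) :
  Ck 2 rho -> grad rho z != 0 -> 0 < r -> 0 < c -> 0 <= K ->
  (forall y, Z y -> `|z - y| < r -> [/\ rho y = 0, c <= `|n y| & dotv (n y) (F y) = 0]) ->
  (forall x y, Z x -> Z y -> `|z - x| < r -> `|z - y| < r ->
    `|dotv (n x) (y - x)| <= K * `|y - x| ^+ 2) ->
  exists2 r', 0 < r' & volume_null (hits Phi (Z `&` [set y | `|z - y| < r']) a b).
Proof.
move=> C2 g0 r0 c0 K0 hZ flat.
have [i [r1 [L1 [r10 L10 graph]]]] := zero_set_graph C2 g0.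
exists (Num.min r r1); first by rewrite lt_min r0.
apply: (@flat_hits_null R d d_gt0 F Phi B C L T B_ge0 C_ge0 L_ge0 F_lip Phi_sol Phi0 PhiD
  Phi_time Phi_space _ i z (Num.min r r1) L1) => //.
- by rewrite le_min !ltW.
- by move=> y [_ /= /ltW]; rewrite distrC.
- move=> x y s s0 [Zx /=]; rewrite lt_min => /andP[zx zx1] [Zy /=].
  rewrite lt_min => /andP[zy zy1]; apply: graph => //.
    by have [] := hZ x Zx zx.
  by have [] := hZ y Zy zy.
- move=> eps eps0; exists (eps * c / (K + 1)).
    by rewrite divr_gt0 ?mulr_gt0// ltr_wpDl.
  move=> y [Zy /=]; rewrite lt_min => /andP[zy _].
  have [_ cn nF] := hZ y Zy zy.
  have /norm_coord_max[k nk ek] : n y != 0.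
    by rewrite -normr_eq0 gt_eqF// (lt_le_trans c0).
  exists ((n y 0 k)^-1 *: n y); split.
  - exists k => [|j]; first by rewrite mxE mulVf.
    rewrite mxE normrM normfV mulrC ler_pdivrMr ?normr_gt0// mul1r -ek.
    exact: coord_le_norm.
  - by rewrite dotvZl nF mulr0.
  - move=> w [Zw /=]; rewrite lt_min => /andP[zw _] wy.
    rewrite dotvZl normrM normfV -ek mulrC ler_pdivrMr; last exact: lt_le_trans cn.
    apply: le_trans (flat y w Zy Zw zy zw) _; rewrite expr2 mulrA [leRHS]mulrAC.
    apply: ler_wpM2r => //; apply: (@le_trans _ _ (eps * c)); last by rewrite ler_wpM2l// ltW.
    apply: le_trans (_ : (K + 1) * `|w - y| <= _); first by rewrite ler_wpM2r// lerDl.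
    by rewrite mulrC -ler_pdivlMr// ltr_wpDl.
Qed.

Lemma continuous_dotv_grad rho (v : 'rV[R]_d -> 'rV[R]_d) : Ck 2 rho -> continuous v ->
  continuous (fun y => dotv (grad rho y) (v y)).
Proof.
move=> C2 cv; apply: continuous_sumr => i; apply: continuous_mulr.
  have -> : (fun y => grad rho y 0 i) = 'D_(delta_mx 0 i : 'rV[R]_d) rho.
    by apply/funext => y; rewrite mxE.
  exact: Ck2_derive_continuous.
move=> x; apply: (@continuous_comp _ _ _ v (fun N : 'rV[R]_d => N 0 i)); first exact: cv.
exact: coord_continuous.
Qed.

Let F_cont : continuous F. Proof. exact: lipschitz_continuous F_lip. Qed.

Let norm_ge_near (f : 'rV[R]_d -> R) z : {for z, continuous f} -> f z != 0 ->
  exists2 r, 0 < r & forall y, `|z - y| < r -> `|f z| / 2 <= `|f y|.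
Proof.
move=> cf fz0; have f2 : 0 < `|f z| / 2 by rewrite divr_gt0// normr_gt0.
have /cvgrPdist_le/(_ _ f2) h := cf.
have [r r0 hr] := @near_norm_ball R 'rV[R]_d z _ h.
exists r => // y /hr h1.
have : `|f z| <= `|f z - f y| + `|f y| by rewrite -{1}(subrK (f y) (f z)) ler_normD.
lra.
Qed.

Definition tangent_points (M : set 'rV[R]_d) : set 'rV[R]_d :=
  [set y | M y /\ exists2 rho, defining_function 2 M y rho & dotv (grad rho y) (F y) = 0].

(** Flatness is Taylor's formula for one [rho] near [z]. In [tangent_points] the defining function
    depends on the point; [tangent_direction_unique] transfers tangency to the fixed one. *)
Lemma hits_tangent_null (M : set 'rV[R]_d) : volume_null (hits Phi (tangent_points M) a b).
Proof.
apply: hits_null_local => z [Mz [rho [C2 g0 defM] _]].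
have [r1 r10 h1] := @near_norm_ball R 'rV[R]_d z _ defM.
have [r2 [K [r20 K0 _ _ taylor]]] := C2_near_bound z C2.
have [i Di0] := grad_neq0 g0.
have [r3 r30 h3] := norm_ge_near (@Ck2_derive_continuous _ _ rho (delta_mx 0 i) C2 z) Di0.
have Mrho y : `|z - y| < r1 -> M y -> rho y = 0 by move=> /h1[].
apply: (@flat_hits_null_local _ rho (grad rho) z (Num.min r1 (Num.min r2 r3))
  (`|'D_(delta_mx 0 i : 'rV[R]_d) rho z| / 2) K) => //.
- by rewrite !lt_min r10 r20.
- by rewrite divr_gt0// normr_gt0.
- move=> y [My [rho' [C2' g0' defM'] tg]]; rewrite !lt_min => /andP[zy1 /andP[zy2 zy3]].
  have near1 : \forall w \near y, M w <-> rho w = 0.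
    have : 0 < r1 - `|z - y| by rewrite subr_gt0.
    move=> /(near_dist_lt y); apply: filterS => w yw; apply: h1.
    apply: le_lt_trans (ler_distD y _ _) _; lra.
  split; first exact: Mrho.
    apply: le_trans (h3 y zy3) _; have := coord_le_norm (grad rho y) i.
    by rewrite mxE.
  rewrite dotvC -derive_grad; last exact: Ck2_diff.
  apply: (@tangent_direction_unique R d rho rho') => //.
  + exact: Mrho.
  + by have /nbhs_singleton[] := defM' => /(_ My).
  + by apply: filterS2 near1 defM' => w <- <-.
  + by rewrite derive_grad; [rewrite dotvC|exact: Ck2_diff].
- move=> x y [Mx _] [My _]; rewrite !lt_min => /andP[zx1 /andP[zx2 _]] /andP[zy1 /andP[zy2 _]].
  have := taylor x y zx2 zy2; rewrite (Mrho x)// (Mrho y)// subrr sub0r normrN.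
  by rewrite derive_grad ?(dotvC (y - x))//; exact: Ck2_diff.
Qed.

(** The combination of gradients is orthogonal to F y by construction. It vanishes when the
    gradients are parallel; otherwise it vanishes only if F y is tangent to both surfaces. *)
Definition transverse_points (M1 M2 : set 'rV[R]_d) : set 'rV[R]_d :=
  [set y | [/\ M1 y, M2 y & exists rho1 rho2,
    [/\ defining_function 2 M1 y rho1, defining_function 2 M2 y rho2 &
    dotv (grad rho2 y) (F y) *: grad rho1 y - dotv (grad rho1 y) (F y) *: grad rho2 y != 0]]].

(** On the intersection both surfaces are flat to second order, each along its own gradient, hence
    the intersection is flat along the combination [n], whose coefficients are bounded by K2 B and
    K1 B. *)
Lemma hits_transverse_null (M1 M2 : set 'rV[R]_d) :
  volume_null (hits Phi (transverse_points M1 M2) a b).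
Proof.
apply: hits_null_local => z [M1z M2z [rho1 [rho2 [[C21 g1 def1] [C22 g2 def2] n0]]]].
pose n y := dotv (grad rho2 y) (F y) *: grad rho1 y - dotv (grad rho1 y) (F y) *: grad rho2 y.
have [r1 r10 h1] := @near_norm_ball R 'rV[R]_d z _ def1.
have [r2 r20 h2] := @near_norm_ball R 'rV[R]_d z _ def2.
have [r3 [K1 [r30 K10 D1 _ taylor1]]] := C2_near_bound z C21.
have [r4 [K2 [r40 K20 D2 _ taylor2]]] := C2_near_bound z C22.
have /norm_coord_max[k nk _] := n0.
have cn : {for z, continuous (fun y => n y 0 k)}.
  have -> : (fun y => n y 0 k) = (fun y =>
      dotv (grad rho2 y) (F y) * 'D_(delta_mx 0 k : 'rV[R]_d) rho1 y -
      dotv (grad rho1 y) (F y) * 'D_(delta_mx 0 k : 'rV[R]_d) rho2 y).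
    by apply/funext => y; rewrite !mxE.
  by apply: continuousB; apply: continuousM; try exact: continuous_dotv_grad;
    exact: Ck2_derive_continuous.
have [r5 r50 h5] := norm_ge_near cn nk.
pose r := Num.min r1 (Num.min r2 (Num.min r3 (Num.min r4 r5))).
have gradF rho y K : Ck 2 rho -> 0 <= K -> (forall v, `|'D_v rho y| <= K * `|v|) ->
    `|dotv (grad rho y) (F y)| <= K * B.
  move=> C2 K0 h; rewrite dotvC -derive_grad; last exact: Ck2_diff.
  by apply: le_trans (h _) _; rewrite ler_wpM2l.
apply: (@flat_hits_null_local _ rho1 n z r (`|n z 0 k| / 2) (K2 * B * K1 + K1 * B * K2)) => //.
- by rewrite !lt_min r10 r20 r30 r40.
- by rewrite divr_gt0// normr_gt0.
- by rewrite addr_ge0 ?mulr_ge0.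
- move=> y [M1y M2y _]; rewrite !lt_min => /and5P[zy1 zy2 zy3 zy4 zy5]; split.
  + by have /h1[/(_ M1y)] := zy1.
  + by apply: le_trans (h5 y zy5) _; exact: coord_le_norm.
  + by rewrite /n dotvBl !dotvZl mulrC subrr.
- move=> x y [M1x M2x _] [M1y M2y _]; rewrite !lt_min.
  move=> /and5P[zx1 zx2 zx3 zx4 zx5] /and5P[zy1 zy2 zy3 zy4 zy5].
  have rho10 w : `|z - w| < r1 -> M1 w -> rho1 w = 0 by move=> /h1[].
  have rho20 w : `|z - w| < r2 -> M2 w -> rho2 w = 0 by move=> /h2[].
  have t1 := taylor1 x y zx3 zy3; rewrite !rho10// subrr sub0r normrN in t1.
  have t2 := taylor2 x y zx4 zy4; rewrite !rho20// subrr sub0r normrN in t2.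
  rewrite derive_grad in t1; last exact: Ck2_diff.
  rewrite derive_grad in t2; last exact: Ck2_diff.
  rewrite /n dotvBl !dotvZl [dotv (grad rho1 x) (y - x)]dotvC [dotv (grad rho2 x) (y - x)]dotvC.
  apply: le_trans (ler_normB _ _) _; rewrite mulrDl !normrM -!(mulrA (_ * B)).
  by apply: lerD; apply: ler_pM => //; apply: gradF => // v; [exact: D2|exact: D1].
Qed.

End NullHits.

(** * Uniform exit time *)

(** The rank counts the nodes from which i can be reached. Along an edge from i to j this set gains
    j itself: if i were reachable from j, a shortened path back would close a cycle through distinct
    nodes. *)
Lemma acyclic_rank (T : finType) (e : rel T) :
  ~ (exists2 c : seq T, c != [::] & ucycle e c) ->
  exists2 rk : T -> nat, forall i j, e i j -> (rk i < rk j)%N & forall i, (rk i <= #|T|)%N.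
Proof.
move=> acyc; exists (fun i => #|[pred j | connect e j i]|) => [i j eij|i]; last exact: max_card.
apply: proper_card; apply/properP; split.
  by apply/fintype.subsetP => k; rewrite !inE => /connect_trans; apply; exact: connect1.
exists j; rewrite !inE ?connect0//; apply/negP => /connectP[p ep lp].
apply: acyc; case: (shortenP ep) lp => p' ep' up' _ lp.
exists (j :: p') => //; apply/andP; split=> //=.
by rewrite rcons_path ep' -lp.
Qed.

Section LocalMonotone.
Context {R : realType}.

(** A supremum argument for a function that may jump: the comparison on the left of t0 reaches the
    supremum, the one on the right goes beyond it. *)
Lemma locally_nondecreasing (f : R -> R) (T : R) : 0 <= T ->
  (forall t0, 0 <= t0 <= T -> exists2 e, 0 < e & forall t, 0 <= t <= T ->
    (t0 <= t < t0 + e -> f t0 <= f t) /\ (t0 - e < t <= t0 -> f t <= f t0)) ->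
  f 0 <= f T.
Proof.
move=> T0 loc.
pose S := [set t | 0 <= t <= T /\ forall s, 0 <= s <= t -> f 0 <= f s].
have S0 : S 0.
  split; first by rewrite lexx.
  by move=> s /andP[s0 s1]; have -> : s = 0 by apply/eqP; rewrite eq_le s0 s1.
have ubS : ubound S T by move=> t [/andP[]].
have hsS : has_sup S by split; [exists 0|exists T].
set sg := sup S.
have sg0 : 0 <= sg by exact: ub_le_sup hsS.2 _ S0.
have sgT : sg <= T by apply: ge_sup => //; exists 0.
have below s : 0 <= s -> s < sg -> f 0 <= f s.
  move=> s0 ssg; have ssg0 : 0 < sg - s by rewrite subr_gt0.
  have [u [_ hu] su] := sup_adherent ssg0 hsS.
  by apply: hu; rewrite s0/=; apply/ltW; move: su; rewrite -/sg opprB addrC subrK.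
have sg0T : 0 <= sg <= T by rewrite sg0.
have [e e0 he] := loc sg sg0T.
have fsg : f 0 <= f sg.
  have [<-//|sgn0] := eqVneq 0 sg.
  have sgp : 0 < sg by rewrite lt_neqAle sgn0.
  pose s := Num.max 0 (sg - e / 2).
  have e2 : 0 < e / 2 by rewrite divr_gt0.
  have s0 : 0 <= s by rewrite le_max lexx.
  have ssg : s < sg by rewrite gt_max sgp/= gtrBl.
  apply: (le_trans (below s s0 ssg)); apply: (he s _).2.
    by rewrite s0/=; apply: le_trans (ltW ssg) sgT.
  rewrite (ltW ssg) andbT; apply: (@lt_le_trans _ _ (sg - e / 2)).
    by rewrite ltrD2l ltrN2 ltr_pdivrMr// ltr_pMr// ltrDl.
  by rewrite le_max lexx orbT.
have [<-//|sgnT] := eqVneq sg T.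
have sgT' : sg < T by rewrite lt_neqAle sgnT.
pose u := Num.min T (sg + e / 2).
have e2 : 0 < e / 2 by rewrite divr_gt0.
have ue : u < sg + e.
  rewrite gt_min; apply/orP; right.
  by rewrite ltrD2l ltr_pdivrMr// ltr_pMr// ltrDl.
have sgu : sg < u by rewrite lt_min sgT'/= ltrDl.
have uT : u <= T by rewrite ge_min lexx.
suff : S u by move=> /(ub_le_sup hsS.2); rewrite -/sg leNgt sgu.
split=> [|s /andP[s0 su]]; first by rewrite uT andbT (le_trans sg0)// ltW.
have [|sgs] := ltP s sg; first exact: below.
apply: (le_trans fsg); apply: (he s _).1; first by rewrite s0/= (le_trans su).
by rewrite sgs/= (le_lt_trans su).
Qed.

End LocalMonotone.

(** On [0, 1] the preimage of [A] is closed and is also the complement of the preimage of [B], hence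
    open; connectedness concludes. *)
Lemma segment_side (R : realType) (V : normedModType R) (A B : set V) (x v : V) :
  closed A -> closed B -> A x ->
  (forall t : R, 0 <= t <= 1 -> A (x + t *: v) \/ B (x + t *: v)) ->
  (forall t : R, 0 <= t <= 1 -> ~ (A (x + t *: v) /\ B (x + t *: v))) -> A (x + v).
Proof.
move=> cA cB Ax AB nAB.
pose p (t : R) := x + t *: v.
have cp : continuous p.
  apply: (@lipschitz_continuous R _ _ p `|v|) => s t.
  by rewrite /p opprD addrACA subrr add0r -scalerBl normrZ mulrC.
suff e : `[0, 1] `&` (p @^-1` A) = `[0, (1:R)]%classic.
  have : (`[0, (1:R)]%classic) 1 by rewrite /= in_itv/= ler01 lexx.
  by rewrite -e => -[_]; rewrite /p /= scale1r.
apply: (@segment_connected R 0 1).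
- by exists 0; split; rewrite /= ?in_itv/= ?lexx ?ler01// /p scale0r addr0.
- exists (~` (p @^-1` B)).
    by apply: closed_openC; apply: preimage_closed => // t _; exact: cp.
  apply/seteqP; split=> t [t01 /= h]; split=> //.
    by move=> Bt; apply: (nAB t) => //; move: t01; rewrite /= in_itv.
  by case: (AB t); rewrite // -[_ <= _ <= _]/(t \in `[0, 1]).
- by exists (p @^-1` A) => //; apply: preimage_closed => // t _; exact: cp.
Qed.

Section Curves.
Context {R : realType} {d : nat}.
Variables (F : 'rV[R]_d -> 'rV[R]_d).
Hypothesis F_cont : continuous F.

Lemma solution_dotv (g : R -> 'rV[R]_d) (w : 'rV[R]_d) (t : R) : solution F g ->
  is_derive t 1 (fun s => dotv (g s) w) (dotv (F (g t)) w).
Proof.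
move=> sol; rewrite /dotv.
apply: (@is_derive1_ext R (\sum_i (fun s => g s 0 i * w 0 i))).
- by move=> s; rewrite fct_sumE.
- reflexivity.
apply: is_derive_sum => i.
apply: (@is_derive1_ext R (w 0 i *: (fun s => g s 0 i))); last exact: is_deriveZ.
- by move=> s; rewrite mulrC.
- by rewrite mulrC.
Qed.

Lemma continuous_dotvl (w : 'rV[R]_d) : continuous (fun y => dotv (F y) w).
Proof.
apply: continuous_sumr => i; apply: continuous_mulr => x; last exact: cst_continuous.
apply: (@continuous_comp _ _ _ F (fun N : 'rV[R]_d => N 0 i)); first exact: F_cont.
exact: coord_continuous.
Qed.

Lemma solution_dotv_growth (g : R -> 'rV[R]_d) (w : 'rV[R]_d) (a t0 : R) :
  solution F g -> continuous g -> a < dotv (F (g t0)) w -> exists2 e, 0 < e &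
  forall s t, `|t0 - s| < e -> `|t0 - t| < e -> s <= t ->
    a * (t - s) <= dotv (g t) w - dotv (g s) w.
Proof.
move=> sol cg ha.
have [e e0 he] : exists2 e, 0 < e & forall t, `|t0 - t| < e -> a < dotv (F (g t)) w.
  apply: near_norm_ball.
  have : {for t0, continuous (fun t => dotv (F (g t)) w)}.
    apply: (@continuous_comp _ _ _ g (fun y => dotv (F y) w)); first exact: cg.
    exact: continuous_dotvl.
  have e0 : 0 < dotv (F (g t0)) w - a by rewrite subr_gt0.
  move=> /cvgrPdist_lt/(_ _ e0); apply: filterS => t.
  by move=> /ltr_distlBl; lra.
exists e => // s t hs ht st.
have := @derive_le R (fun u => a * u) (fun=> a) (fun u => dotv (g u) w)
  (fun u => dotv (F (g u)) w) s t st.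
rewrite -mulrBr; apply.
- move=> u _; apply: (@is_derive1_ext R (a *: id) _ u (a *: 1)) => //.
    by rewrite /GRing.scale /= mulr1.
- by move=> u _; exact: solution_dotv.
- move=> u /andP[su ut]; apply/ltW/he.
  by move: hs ht; rewrite !ltr_distlC => /andP[h1 h2] /andP[h3 h4]; apply/andP; split; lra.
Qed.

End Curves.

Section EuclideanDot.
Context {R : realType} {d : nat}.
Implicit Types (x y z nu : 'rV[R]_d).

Lemma dotv0l x : dotv 0 x = 0 :> R.
Proof. by rewrite /dotv big1// => i _; rewrite mxE mul0r. Qed.

Lemma dotvDl x y z : dotv (x + y) z = dotv x z + dotv y z.
Proof. by rewrite /dotv -big_split; apply: eq_bigr => i _; rewrite !mxE mulrDl. Qed.

Lemma dotvv_ge0 x : 0 <= dotv x x.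
Proof. by apply: sumr_ge0 => i _; rewrite -expr2 sqr_ge0. Qed.

Lemma enorm1_dotv nu : enorm nu = 1 -> dotv nu nu = 1.
Proof. by rewrite /enorm => e; rewrite -(sqr_sqrtr (dotvv_ge0 nu)) e expr1n. Qed.

Lemma norm_le_enorm x : `|x| <= enorm x.
Proof. by apply: norm_le_coord => [|i]; [exact: sqrtr_ge0|exact: coord_le_enorm]. Qed.

End EuclideanDot.

(** * Local position of two subdomains at an interface point *)

Section Sides.
Context {R : realType} {d N : nat}.
Variables (Om : set 'rV[R]_d) (Omi : 'I_N -> set 'rV[R]_d).
Hypotheses (open_Om : open Om) (part : is_partition Omi Om).

Lemma closure_interface i j y : i != j -> closure (Omi i) y -> closure (Omi j) y ->
  interface Omi i j y.
Proof.
have [dom disj _ _] := part.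
have aux k l z : k != l -> closure (Omi l) z -> ~ Omi k z.
  move=> kl cl Ok; have [[ok _ _] _] := dom k.
  have [w [lw kw]] := cl _ (open_nbhs_nbhs (conj ok Ok)).
  by have : (Omi k `&` Omi l) w by []; rewrite disj.
move=> ij ci cj; split; split=> // /(@interior_subset _ _ _).
  exact: aux ij cj.
by apply: aux ci; rewrite eq_sym.
Qed.

Lemma closure_cover y : Om y -> exists i, closure (Omi i) y.
Proof.
have [_ _ cov _] := part => Oy.
by have : closure Om y by [exact: subset_closure]; rewrite cov => -[i _ hi]; exists i.
Qed.

Lemma near_closures y : \forall z \near y, forall k, closure (Omi k) z -> closure (Omi k) y.
Proof.
apply: (@filter_forall _ _ _ _ (nbhs_filter y)) => k; have [ck|nk] := pselect (closure (Omi k) y).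
  by near=> z.
have : nbhs y (~` closure (Omi k)).
  by apply: open_nbhs_nbhs; split=> //; apply: closed_openC; exact: closed_closure.
by apply: filterS => z nz cz.
Unshelve. all: by end_near. Qed.

(** The interface separates from its tangent plane at second order only, so a small cone around [nu]
    avoids it. Each point of the cone thus lies in exactly one of the two closures, and segments
    inside the convex cone carry this choice over from a point y + t0 nu of the j-th subdomain. *)
Lemma interface_side i j y nu eta : Om y -> i != j -> interface Omi i j y ->
  interface_normal Omi i j y nu ->
  (forall k, closure (Omi k) y -> k = i \/ k = j) -> 0 < eta ->
  exists2 r, 0 < r & forall b, `|y - b| < r -> eta * `|b - y| < dotv (b - y) nu ->
    closure (Omi j) b /\ ~ closure (Omi i) b.
Proof.
move=> Oy ij Iy [nu1 [rho [C2 g0 zset] [c nuE]] sides] only eta0.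
have [r1 [M [r10 M0 _ _ tay]]] := C2_near_bound y C2.
have nOm : \forall z \near y, Om z by apply: open_nbhs_nbhs.
have nAll : \forall z \near y, [/\ Om z, (forall k, closure (Omi k) z -> closure (Omi k) y) &
    (interface Omi i j z <-> rho z = 0)].
  have := near_closures y; move: nOm zset.
  by apply: filterS3 => z; split.
have [r2 r20 hr2] := @near_norm_ball R 'rV[R]_d y _ nAll.
(* An opening of at most 1/2 puts the axis point y + t0 nu inside the cone, [nu] having sup norm at
   most 1. *)
pose e := Num.min eta (1 / 2).
have e0 : 0 < e by rewrite lt_min eta0/= divr_gt0.
have e2 : e <= 1 / 2 by rewrite ge_min lexx orbT.
have cM : 0 < `|c| * M + 1 by rewrite ltr_wpDl// mulr_ge0.
pose r := Num.min r1 (Num.min r2 (e / (`|c| * M + 1))).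
have r0 : 0 < r by rewrite !lt_min r10 r20 divr_gt0.
have rr1 : r <= r1 by rewrite ge_min lexx.
have rr2 : r <= r2 by rewrite !ge_min lexx orbT.
have rr3 : r * (`|c| * M + 1) <= e.
  by rewrite -ler_pdivlMr// !ge_min lexx !orbT.
have y0 : rho y = 0.
  by have [|_ _ h] := hr2 y; rewrite ?subrr ?normr0//; exact/h.
have cone z : `|y - z| < r -> e * `|z - y| < dotv (z - y) nu ->
    (closure (Omi j) z \/ closure (Omi i) z) /\ ~ (closure (Omi j) z /\ closure (Omi i) z).
  move=> yz ez; have [Oz clz Iz] := hr2 z (lt_le_trans yz rr2); split.
    by have [k ck] := closure_cover Oz; case: (only k (clz k ck)) => <-; [right|left].
  move=> [cj ci]; have /Iz z0 : interface Omi i j z by exact: closure_interface.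
  have yy : `|y - y| < r1 by rewrite subrr normr0.
  have := tay y z yy (lt_le_trans yz rr1).
  rewrite z0 y0 subrr sub0r normrN derive_grad; last exact: Ck2_diff.
  set D := dotv _ _; set q := `|z - y| => hD.
  have q0 : 0 <= q by exact: normr_ge0.
  have qr : q < r by rewrite /q distrC.
  move: ez; rewrite nuE dotvC dotvZl dotvC -/D -/q; apply/negP; rewrite -leNgt.
  apply: (le_trans (ler_norm _)); rewrite normrM.
  apply: (@le_trans _ _ (`|c| * (M * q ^+ 2))); first by rewrite ler_wpM2l.
  have -> : `|c| * (M * q ^+ 2) = (q * (`|c| * M)) * q by ring.
  rewrite ler_wpM2r//; apply: le_trans rr3; apply: ler_pM => //; first by rewrite mulr_ge0.
    exact: ltW.
  by rewrite lerDl.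
have [t0 t00 ht0] : exists2 t, 0 < t & t < r /\ Omi j (y + t *: nu).
  have near0 : \forall t \near (0 : R)^'+, t < r by exact: nbhs_right_lt.
  near (0 : R)^'+ => t; exists t => //; split; first by near: t.
  suff [] : Omi i (y - t *: nu) /\ Omi j (y + t *: nu) by [].
  by near: t.
have [t0r Oa] := ht0.
pose a := y + t0 *: nu.
have ay : a - y = t0 *: nu by rewrite addrC addKr.
have aq : `|a - y| <= t0.
  by rewrite ay normrZ gtr0_norm// ler_piMr ?(ltW t00)// -nu1 norm_le_enorm.
have ya : `|y - a| < r by rewrite distrC; exact: le_lt_trans t0r.
have da : e * `|a - y| < dotv (a - y) nu.
  rewrite ay dotvZl enorm1_dotv// mulr1 -ay; apply: (@le_lt_trans _ _ (1 / 2 * t0)); last lra.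
  by apply: ler_pM => //; exact: ltW.
exists r => // b yb eb.
have db : e * `|b - y| < dotv (b - y) nu.
  by apply: le_lt_trans eb; rewrite ler_wpM2r// ge_min lexx.
have seg t : 0 <= t <= 1 -> `|y - (a + t *: (b - a))| < r /\
    e * `|a + t *: (b - a) - y| < dotv (a + t *: (b - a) - y) nu.
  move=> t01; split; first exact: convex_points.
  have -> : a + t *: (b - a) - y = (1 - t) *: (a - y) + t *: (b - y).
    by apply/rowP => k; rewrite !mxE; ring.
  have /andP[t_0 t_1] := t01.
  rewrite dotvDl !dotvZl; apply: (@le_lt_trans _ _ ((1 - t) * (e * `|a - y|) + t * (e * `|b - y|))).
    have -> : (1 - t) * (e * `|a - y|) + t * (e * `|b - y|) =
      e * ((1 - t) * `|a - y| + t * `|b - y|) by ring.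
    rewrite ler_wpM2l ?(ltW e0)//; apply: le_trans (ler_normD _ _) _.
    by rewrite !normrZ !ger0_norm// subr_ge0.
  have [->|tn0] := eqVneq t 0; first by rewrite subr0 !mul1r !mul0r !addr0.
  apply: ler_ltD; first by rewrite ler_wpM2l ?subr_ge0// ltW.
  by rewrite ltr_pM2l// lt_neqAle eq_sym tn0.
have bE : b = a + (b - a) by rewrite addrC subrK.
have cb : closure (Omi j) b.
  rewrite bE; apply: (@segment_side _ _ _ (closure (Omi i))).
  - exact: closed_closure.
  - exact: closed_closure.
  - exact: subset_closure.
  - by move=> t /seg[h1 h2]; have [] := cone _ h1 h2.
  - by move=> t /seg[h1 h2]; have [] := cone _ h1 h2.
by split=> // ci; have [_] := cone b yb db; apply.
Unshelve. all: by end_near. Qed.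

Lemma interface_normalN i j y nu : interface_normal Omi i j y nu ->
  interface_normal Omi j i y (- nu).
Proof.
move=> [nu1 [rho rhoP [c nuE]] sides]; split.
- rewrite -nu1 /enorm; congr Num.sqrt; rewrite -scaleN1r dotvZl dotvC dotvZl; ring.
- exists rho; first by rewrite /interface setIC.
  by exists (- c); rewrite scaleNr nuE.
- by apply: filterS sides => t [h1 h2]; rewrite scalerN opprK.
Qed.

(** Without transversality and with nonzero fluxes the gradients are parallel, so the unit normals
    are equal or opposite. If equal, the j-th and k-th subdomains overlap just beyond [y], whence j
    = k; if opposite, the i-th and j-th ones would overlap. *)
Lemma neighbour_unique (F : 'rV[R]_d -> 'rV[R]_d) i j k y nu1 nu2 :
  interface_normal Omi i j y nu1 -> dotv (F y) nu1 != 0 ->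
  interface_normal Omi i k y nu2 -> dotv (F y) nu2 != 0 ->
  interface Omi i j y -> interface Omi i k y ->
  ~ transverse_points F (interface Omi i j) (interface Omi i k) y -> i != j -> j = k.
Proof.
have [_ disj _ _] := part.
move=> [n1 [rho1 rho1P [c1 e1]] s1] f1 [n2 [rho2 rho2P [c2 e2]] s2] f2 I1 I2 nT ij.
have /eqP : dotv (grad rho2 y) (F y) *: grad rho1 y - dotv (grad rho1 y) (F y) *: grad rho2 y == 0.
  by apply/negP => /negP h; apply: nT; split=> //; exists rho1, rho2; split.
set a := dotv (grad rho2 y) _; set b := dotv (grad rho1 y) _ => /eqP; rewrite subr_eq0 => /eqP ab.
have c1b : c1 * b != 0 by rewrite /b -dotvZl -e1 dotvC.
have c2a : c2 * a != 0 by rewrite /a -dotvZl -e2 dotvC.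
have [c20 a0] : c2 != 0 /\ a != 0 by move: c2a; rewrite mulf_eq0 negb_or => /andP[].
pose ka := c1 * b / (a * c2).
have nu12 : nu1 = ka *: nu2.
  rewrite e1 e2 scalerA /ka.
  have -> : c1 * b / (a * c2) * c2 = c1 / a * b by field; rewrite a0 c20.
  by rewrite -[RHS]scalerA -ab !scalerA divfK.
have : ka ^+ 2 = 1 ^+ 2.
  have := enorm1_dotv n1; rewrite nu12 dotvZl dotvC dotvZl enorm1_dotv// mulr1 => h;
    rewrite expr1n expr2; exact: h.
move/eqP; rewrite eqf_sqr => /orP[] /eqP kaE.
  apply/eqP; apply/negP => /negP jk; have := disj j k jk; apply/eqP/set0P.
  near (0 : R)^'+ => t; exists (y + t *: nu1); split.
    suff [] : Omi i (y - t *: nu1) /\ Omi j (y + t *: nu1) by [].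
    by near: t.
  rewrite nu12 kaE scale1r.
  suff [] : Omi i (y - t *: nu2) /\ Omi k (y + t *: nu2) by [].
  by near: t.
have dij := disj i j ij.
exfalso; suff : (Omi i `&` Omi j) !=set0 by rewrite dij => -[].
near (0 : R)^'+ => t; exists (y + t *: nu1); split.
  rewrite nu12 kaE scaleN1r scalerN.
  suff [] : Omi i (y - t *: nu2) /\ Omi k (y + t *: nu2) by [].
  by near: t.
suff [] : Omi i (y - t *: nu1) /\ Omi j (y + t *: nu1) by [].
by near: t.
Unshelve. all: by end_near. Qed.

End Sides.

(** * A quantity that grows along generic orbits *)

Section GenericTrajectory.
Context {R : realType} {d N : nat}.
Variables (Om : set 'rV[R]_d) (Omi : 'I_N -> set 'rV[R]_d).
Hypotheses (open_Om : open Om) (part : is_partition Omi Om).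
Variables (F : 'rV[R]_d -> 'rV[R]_d) (g : R -> 'rV[R]_d) (T B : R).
Hypotheses (F_cont : continuous F) (g_sol : solution F g) (B_ge0 : 0 <= B) (T_ge0 : 0 <= T).
Hypothesis g_lip : forall s t, `|g s - g t| <= B * `|s - t|.
Hypothesis g_in : forall t, 0 <= t <= T -> Om (g t).
Variables (rk : 'I_N -> nat) (v : 'I_N -> 'rV[R]_d) (dl : 'I_N -> R) (Q : R).
Hypotheses (Q_ge0 : 0 <= Q) (rk_le : forall i, (rk i <= N)%N) (dl_gt0 : forall i, 0 < dl i).
Hypothesis v_flux : forall i x, Om x -> closure (Omi i) x -> dl i < dotv (F x) (v i).
Hypothesis v_bnd : forall i x, Om x -> `|dotv x (v i) / dl i| <= Q.
Hypothesis crossing : forall t i j, 0 <= t <= T -> i != j -> interface Omi i j (g t) ->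
  exists nu, [/\ interface_normal Omi i j (g t) nu, dotv (F (g t)) nu != 0,
    0 < dotv (F (g t)) nu -> (rk i < rk j)%N & dotv (F (g t)) nu < 0 -> (rk j < rk i)%N].
Hypothesis no_triple : forall t i j k, 0 <= t <= T ->
  ~ transverse_points F (interface Omi i j) (interface Omi i k) (g t).

Let g_cont : continuous g. Proof. exact: lipschitz_continuous g_lip. Qed.

Let at_most_two t i j k : 0 <= t <= T -> i != j -> closure (Omi i) (g t) ->
  closure (Omi j) (g t) -> closure (Omi k) (g t) -> k = i \/ k = j.
Proof.
move=> tT ij ci cj ck; have [->|ki] := eqVneq k i; [by left|right].
have Iij : interface Omi i j (g t) by exact: (closure_interface part).
have Iik : interface Omi i k (g t) by apply: (closure_interface part) => //; rewrite eq_sym.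
have [nu1 [n1 f1 _ _]] := crossing tT ij Iij.
have ik : i != k by rewrite eq_sym.
have [nu2 [n2 f2 _ _]] := crossing tT ik Iik.
by apply/esym; apply: (neighbour_unique part n1 f1 n2 f2) => //; exact: no_triple.
Qed.

(* [kap = 1] looks forward in time, [kap = -1] backward. *)
Let side t0 i j nu kap : 0 <= t0 <= T -> kap = 1 \/ kap = -1 -> i != j ->
  closure (Omi i) (g t0) -> closure (Omi j) (g t0) ->
  interface_normal Omi i j (g t0) nu -> 0 < kap * dotv (F (g t0)) nu ->
  exists2 e, 0 < e & forall s, 0 < s < e ->
    closure (Omi j) (g (t0 + kap * s)) /\ ~ closure (Omi i) (g (t0 + kap * s)).
Proof.
move=> t0T kapE ij ci cj nuP f0.
set f := _ * _ in f0.
have Iij : interface Omi i j (g t0) by exact: (closure_interface part).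
have eta0 : 0 < f / (2 * (B + 1)) / 2 by rewrite !divr_gt0// mulr_gt0// ltr_wpDl.
have [r r0 hr] := interface_side open_Om part (g_in t0T) ij Iij nuP
  (fun k => @at_most_two t0 i j k t0T ij ci cj) eta0.
have flt : f / 2 < dotv (F (g t0)) (kap *: nu) by rewrite dotvC dotvZl dotvC -/f; lra.
have [e e0 he] := solution_dotv_growth F_cont g_sol g_cont flt.
have kap1 : `|kap| = 1 by case: kapE => ->; rewrite ?normrN normr1.
exists (Num.min e (r / (B + 1))); first by rewrite lt_min e0 divr_gt0// ltr_wpDl.
move=> s /andP[s0]; rewrite lt_min => /andP[se sr].
have B1 : 0 < B + 1 by rewrite ltr_wpDl.
have dist : `|g (t0 + kap * s) - g t0| <= B * s.
  apply: (le_trans (g_lip _ _)); rewrite addrC addKr normrM kap1 mul1r gtr0_norm//.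
apply: hr; first by rewrite distrC; apply: le_lt_trans dist _; move: sr;
  rewrite ltr_pdivlMr//; nra.
have t0e : `|t0 - t0| < e by rewrite subrr normr0.
have t0s : `|t0 - (t0 + kap * s)| < e.
  by rewrite opprD addNKr normrN normrM kap1 mul1r gtr0_norm.
have grow : f / 2 * s <= dotv (g (t0 + kap * s) - g t0) nu.
  rewrite dotvBl; case: kapE => kE.
    have := he _ _ t0e t0s; rewrite kE !mul1r scale1r lerDl => /(_ (ltW s0)).
    by rewrite addrC addKr.
  have := he _ _ t0s t0e; rewrite kE !mulN1r scaleN1r gerBl => /(_ (ltW s0)).
  by rewrite opprB addrC subrK -scaleN1r ![dotv _ (_ *: _)]dotvC !dotvZl !(dotvC nu); lra.
apply: lt_le_trans grow.
have -> : f / (2 * (B + 1)) / 2 = f / 2 * (2 * (B + 1))^-1 by ring.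
have f20 : 0 < f / 2 by rewrite divr_gt0.
rewrite -[ltLHS]mulrA (ltr_pM2l f20) mulrC ltr_pdivrMr ?mulr_gt0//.
by apply: le_lt_trans dist _; nra.
Qed.

(* [W i] does not decrease while the orbit stays in the i-th subdomain, and the
   weight [2 Q] of the rank makes up for the jump when an interface is crossed. *)
Let W i t := dotv (g t) (v i) / dl i + (rk i)%:R * (2 * Q) - t.

Let W_growth t0 i : 0 <= t0 <= T -> closure (Omi i) (g t0) -> exists2 e, 0 < e &
  forall s t, `|t0 - s| < e -> `|t0 - t| < e -> s <= t -> W i s <= W i t.
Proof.
move=> t0T ci.
have [e e0 he] := solution_dotv_growth F_cont g_sol g_cont (v_flux (g_in t0T) ci).
exists e => // s t hs ht st; have := he s t hs ht st.
rewrite /W -ler_pdivlMl// mulrBr ![(dl i)^-1 * _]mulrC; lra.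
Qed.

Let W_rank t i j : 0 <= t <= T -> (rk i < rk j)%N -> W i t <= W j t.
Proof.
move=> tT ij; rewrite /W lerD2r.
have /ler_normlP[_ h1] := v_bnd i (g_in tT).
have /ler_normlP[h2 _] := v_bnd j (g_in tT).
have : (rk i)%:R + 1 <= (rk j)%:R :> R by rewrite natr1 ler_nat.
have Q2 : 0 <= 2 * Q by rewrite mulr_ge0.
by move=> /(ler_wpM2r Q2); lra.
Qed.

Let local t0 : 0 <= t0 <= T -> exists2 e, 0 < e &
  forall i t, `|t0 - t| < e -> closure (Omi i) (g t) -> closure (Omi i) (g t0) /\
    (t0 <= t -> W i t0 <= W i t) /\ (t <= t0 -> W i t <= W i t0).
Proof.
move=> t0T.
have nc : \forall t \near t0, forall k, closure (Omi k) (g t) -> closure (Omi k) (g t0).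
  exact: (g_cont (near_closures Omi (g t0))).
have [e e0 he] := @near_norm_ball R R t0 _ nc.
have /choice[r hr] i : exists r, 0 < r /\ (closure (Omi i) (g t0) ->
    forall s t, `|t0 - s| < r -> `|t0 - t| < r -> s <= t -> W i s <= W i t).
  have [ci|nci] := pselect (closure (Omi i) (g t0)); last by exists 1; split.
  by have [r r0 hr] := W_growth t0T ci; exists r.
exists (\big[Num.min/e]_i r i).
  by apply: lt_bigmin => // i _; have [] := hr i.
move=> i t ht ci.
have te : `|t0 - t| < e by apply: lt_le_trans ht _; exact: bigmin_le_id.
have tr : `|t0 - t| < r i by apply: lt_le_trans ht _; exact: bigmin_le.
have ci0 := he t te i ci; split=> //.
have [ri0 /(_ ci0) W_r] := hr i.
have t0r : `|t0 - t0| < r i by rewrite subrr normr0.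
by split=> le; apply: W_r.
Qed.

(** If the flux points to the neighbour j, passing to j increases the rank and [W_rank] applies. If
    it points to i, then by [side] the orbit is out of the closure of the j-th subdomain just after
    t0. *)
Let succ t0 i : 0 <= t0 <= T -> closure (Omi i) (g t0) -> exists2 e, 0 < e &
  forall t, t0 <= t < t0 + e -> t <= T ->
    exists2 m, closure (Omi m) (g t) & W i t0 <= W m t.
Proof.
move=> t0T ci; have [e e0 he] := local t0T.
have [e1 e10 he1] : exists2 e1, 0 < e1 & forall j t, j != i -> closure (Omi j) (g t0) ->
    t0 < t < t0 + e1 -> closure (Omi j) (g t) -> W i t0 <= W j t0.
  have [[j [ji cj]]|none] := pselect (exists j, j != i /\ closure (Omi j) (g t0)); last first.
    by exists 1 => // j t ji cj; exfalso; apply: none; exists j.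
  have ij : i != j by rewrite eq_sym.
  have Iij : interface Omi i j (g t0) by exact: (closure_interface part).
  have [nu [nuP f0 fp fn]] := crossing t0T ij Iij.
  have uniq k : k != i -> closure (Omi k) (g t0) -> k = j.
    by move=> ki ck; case: (at_most_two t0T ij ci cj ck) => // ki'; rewrite ki' eqxx in ki.
  have [fpos|fneg] := ltP 0 (dotv (F (g t0)) nu).
    by exists 1 => // k t ki ck _ _; rewrite (uniq k ki ck); apply: W_rank => //; exact: fp.
  have f' : 0 < 1 * dotv (F (g t0)) (- nu).
    by rewrite mul1r dotvC -scaleN1r dotvZl dotvC mulN1r oppr_gt0 lt_neqAle f0.
  have [e1 e10 he1] := side t0T (or_introl erefl) ji cj ci (interface_normalN nuP) f'.
  exists e1 => // k t ki ck /andP[t0t te] cjt; exfalso.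
  have [|_] := he1 (t - t0); first by rewrite subr_gt0 t0t ltrBlDl.
  by rewrite mul1r addrC subrK -(uniq k ki ck).
exists (Num.min e e1); first by rewrite lt_min e0.
move=> t /andP[t0t]; rewrite -ltrBlDl lt_min => /andP[te te1] tT.
have [t00 _] := andP t0T.
have tin : 0 <= t <= T by rewrite tT (le_trans t00).
have [<-|tn] := eqVneq t0 t; first by exists i.
have [m cm] := closure_cover part (g_in tin).
have dt : `|t0 - t| < e by rewrite distrC ger0_norm// subr_ge0.
have [cm0 [up _]] := he m t dt cm.
exists m => //; apply: le_trans (up t0t).
have [->//|mi] := eqVneq m i.
by apply: (he1 m t) => //; rewrite lt_neqAle tn t0t -ltrBlDl.
Qed.

(** On an interface two indices compete, and the maximum avoids choosing one. The default value
    exceeds no [W i t] with t in [0, T], by [W_ge]. *)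
Let G t := \big[Num.max/(- Q - T)]_(i | `[< closure (Omi i) (g t) >]) W i t.

Let W_ge t i : 0 <= t <= T -> - Q - t <= W i t.
Proof.
move=> tT; have /ler_normlP[h _] := v_bnd i (g_in tT).
have := mulr_ge0 (ler0n R (rk i)) (mulr_ge0 (ler0n R 2) Q_ge0).
rewrite /W; lra.
Qed.

Let W_le t i : 0 <= t <= T -> W i t <= Q + 2 * Q * N%:R - t.
Proof.
move=> tT; have /ler_normlP[_ h] := v_bnd i (g_in tT).
have : (rk i)%:R <= N%:R :> R by rewrite ler_nat.
have Q2 : 0 <= 2 * Q by rewrite mulr_ge0.
by move=> /(ler_wpM2r Q2); rewrite /W; lra.
Qed.

Let G_ge t i : closure (Omi i) (g t) -> W i t <= G t.
Proof. by move=> ci; apply: le_bigmax_cond; apply/asboolP. Qed.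

(** [G] does not decrease, starts at - Q or above and is at most Q + 2 Q N - T at the end, because
    [W] contains the term - t. *)
Lemma generic_trajectory_exit : T <= 2 * Q + 2 * Q * N%:R.
Proof.
have T0T : 0 <= (0 : R) <= T by rewrite lexx T_ge0.
have TT : 0 <= T <= T by rewrite lexx T_ge0.
have mono : G 0 <= G T.
  apply: locally_nondecreasing => // t0 t0T.
  have [e e0 he] := local t0T.
  have /choice[r hr] i : exists r, 0 < r /\ (closure (Omi i) (g t0) ->
      forall t, t0 <= t < t0 + r -> t <= T ->
      exists2 m, closure (Omi m) (g t) & W i t0 <= W m t).
    have [ci|nci] := pselect (closure (Omi i) (g t0)); last by exists 1; split.
    by have [r r0 hr] := succ t0T ci; exists r.
  exists (\big[Num.min/e]_i r i).
    by apply: lt_bigmin => // i _; have [] := hr i.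
  move=> t /andP[t_0 tT]; split=> /andP[h1 h2].
    apply: bigmax_le => [|i /asboolP ci]; first exact: bigmax_ge_id.
    have [_ /(_ ci t) [||m cm le]//] := hr i.
      by rewrite h1/=; apply: lt_le_trans h2 _; rewrite lerD2l; exact: bigmin_le.
    exact: le_trans le (G_ge cm).
  apply: bigmax_le => [|i /asboolP ci]; first exact: bigmax_ge_id.
  have dt : `|t0 - t| < e.
    rewrite ger0_norm ?subr_ge0// ltrBlDr -ltrBlDl; apply: le_lt_trans h1.
    by rewrite lerD2l lerN2; exact: bigmin_le_id.
  have [ci0 [_ /(_ h2) le]] := he i t dt ci.
  exact: le_trans le (G_ge ci0).
have [k ck] := closure_cover part (g_in T0T).
have lo : - Q <= G 0 by apply: le_trans (G_ge ck); have := W_ge k T0T; rewrite subr0.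
have hi : G T <= Q + 2 * Q * N%:R - T.
  apply: bigmax_le => [|i _]; last exact: W_le.
  by rewrite lerD2r; apply: (@le_trans _ _ 0); rewrite ?oppr_le0// addr_ge0// !mulr_ge0.
lra.
Qed.

End GenericTrajectory.

Section ExitTime.
Context {R : realType} {d N : nat}.
Hypothesis d_gt0 : (0 < d)%N.
Variables (Om : set 'rV[R]_d) (H : 'rV[R]_d -> 'rV[R]_d) (Omi : 'I_N -> set 'rV[R]_d).
Hypotheses (open_Om : open Om) (bnd_Om : bounded_set Om) (Om_neq0 : Om !=set0).
Hypotheses (part : is_partition Omi Om) (cB : ConditionB H Omi) (cC : ConditionC H Omi).
Variables (F : 'rV[R]_d -> 'rV[R]_d) (Phi : 'rV[R]_d -> R -> 'rV[R]_d) (B L : R).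
Hypotheses (B_ge0 : 0 <= B) (L_gt0 : 0 < L).
Hypothesis F_lip : forall x y, `|F x - F y| <= L * `|x - y|.
Hypothesis F_bnd : forall x, `|F x| <= B.
Hypothesis FH : forall x, Om x -> F x = H x.
Hypothesis Phi_sol : forall x, solution F (Phi x).
Hypothesis Phi0 : forall x, Phi x 0 = x.
Hypothesis PhiD : forall x s t, Phi (Phi x s) t = Phi x (t + s).
Hypothesis Phi_time : forall x s t, `|Phi x s - Phi x t| <= B * `|s - t|.
Hypothesis Phi_space : forall x y t,
  `|Phi x t - Phi y t| <= d%:R * expR (L * d%:R * `|t|) * `|x - y|.

Lemma flow_near x t e : 0 < e ->
  \forall t' \near t & x' \near x, `|Phi x t - Phi x' t'| < e.
Proof.
move=> e0; pose C := d%:R * expR (L * d%:R * `|t|).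
have C0 : 0 <= C by rewrite mulr_ge0// expR_ge0.
have q0 : 0 < e / 2 / (B + C + 1) by rewrite !divr_gt0// ltr_wpDl// addr_ge0.
exists ([set t' | `|t - t'| < e / 2 / (B + C + 1)], [set x' | `|x - x'| < e / 2 / (B + C + 1)]).
  by split; [exact: (@near_dist_lt R R t)|exact: (@near_dist_lt R 'rV[R]_d x)].
move=> [t' x'] [/= ht hx'].
have -> : Phi x t - Phi x' t' = (Phi x t - Phi x' t) + (Phi x' t - Phi x' t').
  by rewrite addrA subrK.
apply: (le_lt_trans (ler_normD _ _)).
have h1 := Phi_space x x' t; have h2 := Phi_time x' t t'.
apply: (le_lt_trans (lerD h1 h2)); rewrite -/C.
move: ht hx'; rewrite !ltr_pdivlMr ?ltr_wpDl ?addr_ge0//.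
have p0 := normr_ge0 (t - t'); have p0' := normr_ge0 (x - x').
by have := mulr_ge0 C0 p0; have := mulr_ge0 B_ge0 p0'; lra.
Qed.

(** The tube lemma for the compact time interval. *)
Lemma stays_open a : open [set x | forall t, 0 <= t <= a -> Om (Phi x t)].
Proof.
rewrite openE => x hx.
have := @compact_near_coveringP R `[0, a]%classic; case=> + _.
move=> /(_ (@segment_compact R 0 a)) cov.
have := cov 'rV[R]_d (nbhs x) (fun x' t => Om (Phi x' t)) _.
suff step : forall t, `[0, a]%classic t ->
    \forall t' \near t & x' \near x, Om (Phi x' t').
  move=> /(_ (nbhs_filter x) step); apply: filterS => x' hx' t t0a; apply: hx'.
  by rewrite /= in_itv.
move=> t; rewrite /= in_itv/= => t0a.
have nOm : \forall z \near Phi x t, Om z.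
  by apply: open_nbhs_nbhs; split=> //; exact: hx.
have [r r0 hr] := @near_norm_ball R 'rV[R]_d (Phi x t) _ nOm.
by apply: filterS (flow_near x t r0) => -[t' x'] /= h; apply: hr.
Qed.

Section fixed_time.
Variables (T : R) (T_ge0 : 0 <= T).
Let C := d%:R * expR (L * d%:R * T).

Let C_ge0 : 0 <= C. Proof. by rewrite mulr_ge0// expR_ge0. Qed.

Lemma flow_space x y t : `|t| <= T -> `|Phi x t - Phi y t| <= C * `|x - y|.
Proof.
move=> tT; apply: (le_trans (Phi_space x y t)); rewrite ler_wpM2r// ler_wpM2l//.
by rewrite ler_expR ler_wpM2l// mulr_ge0// ltW.
Qed.

(** The set to avoid is the whole interface if its area is 0, the exceptional null set of the flux
    condition if the flux has a strict sign, and this set together with the tangency points if the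
    flux vanishes, in which case nothing of the interface inside [Om] remains. *)
Lemma crossing_generic i j : i != j -> exists Z,
  volume_null (hits Phi Z 0 T) /\ forall y, Om y -> interface Omi i j y -> ~ Z y ->
    exists nu, [/\ interface_normal Omi i j y nu, dotv (F y) nu != 0,
      0 < dotv (F y) nu -> Lambda H Omi i j & dotv (F y) nu < 0 -> Lambda H Omi j i].
Proof.
move=> ij.
have null Z : hausdorff d.-1 Z = 0%E -> volume_null (hits Phi Z 0 T).
  move=> Z0; apply: (hits_null_hausdorff d_gt0 B_ge0 C_ge0 Phi0 PhiD Phi_time flow_space) => //.
  by rewrite oppr_le0.
have ae P : ae_flux H Omi P i j -> exists Z, volume_null (hits Phi Z 0 T) /\
    forall y, interface Omi i j y -> ~ Z y ->
      exists2 nu, interface_normal Omi i j y nu & P (dotv (H y) nu).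
  move=> [Z [mZ Z0 sub]]; exists Z; split; first exact: null.
  by move=> y Iy nZ; apply: contrapT => nP; apply/nZ/sub => /(_ Iy).
have [I0|] := eqVneq (surface d (interface Omi i j)) 0%E.
  by exists (interface Omi i j); split; [exact: null|move=> y _ Iy nI].
rewrite neq_lt ltNge measure_ge0/= => Ipos.
have I' : (0 < surface d (interface Omi j i))%E by rewrite /interface setIC.
case: (cB.1 i j ij) => fl; have [Z [nZ hZ]] := ae _ fl.
- exists Z; split=> // y Oy Iy Zy; have [nu nuP f0] := hZ y Iy Zy.
  exists nu; rewrite FH//; split=> //; first by rewrite gt_eqF.
    by move=> _; apply/asboolP; split.
  by move=> f1; have := lt_trans f0 f1; rewrite ltxx.
- exists Z; split=> // y Oy Iy Zy; have [nu nuP f0] := hZ y Iy Zy.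
  exists nu; rewrite FH//; split=> //; first by rewrite lt_eqF.
    by move=> f1; have := lt_trans f0 f1; rewrite ltxx.
  move=> _; apply/asboolP; split=> //; first by rewrite eq_sym.
  move: fl => [E [mE E0 sub]]; exists E; split=> // z nz; apply: sub => hz; apply: nz.
  rewrite /interface setIC => Iz.
  have [nu' nu'P f'] := hz Iz; exists (- nu'); first exact: interface_normalN.
  by rewrite dotvC -scaleN1r dotvZl dotvC mulN1r oppr_gt0.
- exists (Z `|` tangent_points F (interface Omi i j)); split.
    have NT_le0 : - T <= 0 by rewrite oppr_le0.
    have := hits_tangent_null d_gt0 B_ge0 C_ge0 (ltW L_gt0) F_lip Phi_sol Phi0 PhiD
      Phi_time flow_space T_ge0 NT_le0 (lexx T) (interface Omi i j).
    move=> /(volume_nullU nZ); apply: volume_nullS => x [t t0T [h|h]].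
      by left; exists t.
    by right; exists t.
  move=> y Oy Iy nZy; exfalso; apply: nZy.
  have [|Zy] := pselect (Z y); first by left.
  right; split=> //; have [nu [nu1 [rho rhoP [c nuE]] _] f0] := hZ y Iy Zy.
  exists rho => //; move: f0; rewrite FH// nuE dotvC dotvZl => /eqP.
  rewrite mulf_eq0 => /orP[/eqP c0|/eqP//].
  by move: nu1; rewrite nuE c0 scale0r /enorm dotv0l sqrtr0 => /eqP; rewrite eq_sym oner_eq0.
Qed.

End fixed_time.

Lemma exit_time : exists2 T, 0 < T & forall x, Om x -> exists2 t, 0 <= t <= T & ~ Om (Phi x t).
Proof.
have [rk rk_lt rk_le] := acyclic_rank cC.
have /choice[dv hdv] i : exists p : R * 'rV[R]_d, 0 < p.1 /\
    forall x, closure (Omi i) x -> p.1 < dotv (H x) p.2.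
  by have [dl dl0 [v v1 hv]] := cB.2 i; exists (dl, v).
have [M M0 hM] : exists2 M, 0 <= M & forall x, Om x -> `|x| <= M.
  have cid : {within closure Om, continuous (id : 'rV[R]_d -> 'rV[R]_d)}.
    by apply: continuous_subspaceT => x; exact: cvg_id.
  have [M M0 hM] := within_compact_bounded (compact_closure_bounded bnd_Om) cid.
  by exists M => // x Ox; apply: hM; exact: subset_closure.
(* A bound for |x . v_i| / delta_i on [Om]. *)
pose q i := d%:R * M * `|(dv i).2| / (dv i).1.
have q0 i : 0 <= q i by rewrite !mulr_ge0// invr_ge0 ltW// (hdv i).1.
pose Q := \sum_i q i.
have Q0 : 0 <= Q by apply: sumr_ge0 => i _.
have qQ i : q i <= Q by rewrite /Q (bigD1 i)//= lerDl sumr_ge0.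
(* One more than the bound of [generic_trajectory_exit], for the final contradiction. *)
pose T := 2 * Q + 2 * Q * N%:R + 1.
have T0 : 0 < T by rewrite ltr_wpDl// addr_ge0// !mulr_ge0.
exists T => // x Ox; apply: contrapT => nexit.
pose U := [set x | forall t, 0 <= t <= T -> Om (Phi x t)].
have Ux : U x.
  by move=> t t0T; apply: contrapT => nO; apply: nexit; exists t.
have oU : open U by exact: stays_open.
have T0' := ltW T0.
have /choice[Z hZ] (p : 'I_N * 'I_N) : exists Z, volume_null (hits Phi Z 0 T) /\
    (p.1 != p.2 -> forall y, Om y -> interface Omi p.1 p.2 y -> ~ Z y ->
    exists nu, [/\ interface_normal Omi p.1 p.2 y nu, dotv (F y) nu != 0,
      0 < dotv (F y) nu -> Lambda H Omi p.1 p.2 & dotv (F y) nu < 0 -> Lambda H Omi p.2 p.1]).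
  have [e|ne] := eqVneq p.1 p.2.
    exists set0; split=> // e0 e00; apply: volume_leS (volume_le0 (ltW e00)) => // z [t _ []].
  by have [Z [nZ hZ]] := crossing_generic T0' ne; exists Z.
pose Z3 (p : 'I_N * 'I_N * 'I_N) :=
  transverse_points F (interface Omi p.1.1 p.1.2) (interface Omi p.1.1 p.2).
have nZ3 p : volume_null (hits Phi (Z3 p) 0 T).
  have C0 : 0 <= d%:R * expR (L * d%:R * T) by rewrite mulr_ge0// expR_ge0.
  have NT_le0 : - T <= 0 by rewrite oppr_le0.
  exact: (hits_transverse_null d_gt0 B_ge0 C0 (ltW L_gt0) F_lip F_bnd Phi_sol Phi0 PhiD Phi_time
    (@flow_space T) T0' NT_le0 (lexx T)).
have nN : volume_null ((\bigcup_p hits Phi (Z p) 0 T) `|` (\bigcup_p hits Phi (Z3 p) 0 T)).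
  by apply: volume_nullU; apply: volume_null_fin => // p; have [] := hZ p.
have [z [Uz nz]] : exists z, U z /\
    ~ ((\bigcup_p hits Phi (Z p) 0 T) `|` (\bigcup_p hits Phi (Z3 p) 0 T)) z.
  apply: contrapT => /forallNP none; apply: (open_not_null oU); first by exists x.
  apply: volume_nullS nN => z Uz; apply: contrapT => nz; exact: (none z).
have rk_le' i : (rk i <= N)%N by rewrite -[N in leqRHS]card_ord.
have : T <= 2 * Q + 2 * Q * N%:R.
  apply: (@generic_trajectory_exit R d N Om Omi open_Om part F (Phi z) T B _ _ B_ge0 T0' _ Uz
    rk (fun i => (dv i).2) (fun i => (dv i).1) Q) => //.
  - exact: lipschitz_continuous F_lip.
  - by move=> i; have [] := hdv i.
  - by move=> i y Oy cy; rewrite FH//; apply: (hdv i).2.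
  - move=> i y Oy; apply: le_trans (qQ i); rewrite normrM normfV (gtr0_norm (hdv i).1).
    rewrite /q ler_wpM2r// ?invr_ge0 ?(ltW (hdv i).1)//.
    apply: (le_trans (ler_norm_sum _ _ _)); rewrite -[X in X%:R * _ * _]card_ord -sum1_card.
    rewrite natr_sum -mulrA mulr_suml; apply: ler_sum => k _; rewrite mul1r normrM.
    apply: ler_pM => //; last exact: coord_le_norm.
    by apply: le_trans (coord_le_norm _ _) _; exact: hM.
  - move=> t i j t0T ij Iij; have [_ /(_ ij _ (Uz t t0T) Iij)] := hZ (i, j).
    case=> [Zt|nu [nuP f0 fp fn]].
      by apply: nz; left; exists (i, j) => //; exists t.
    by exists nu; split=> // [/fp|/fn]; exact: rk_lt.
  - by move=> t i j k t0T tr; apply: nz; right; exists (i, j, k) => //; exists t.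
by rewrite /T gerDl ler10.
Qed.

End ExitTime.

(** * Energy estimate along the orbits *)

Section AlongCurves.
Context {R : realType}.

Lemma derive_integral_bound (q dq k : R -> R) (a : R) : 0 < a -> continuous k ->
  (forall t : R, is_derive t 1 q (dq t)) ->
  (forall t, 0 <= t <= a -> - k t <= dq t) ->
  ((q 0)%:E <= (q a)%:E + \int[lebesgue_measure]_(t in `[0%R, a]) (k t)%:E)%E.
Proof.
move=> a0 ck dq' le; have [P [P0 dP]] := primitive_exists ck.
rewrite (@continuous_FTC2 _ k P)//; last 3 first.
- by apply: continuous_subspaceT => x; exact: ck.
- split=> [x _||]; first by have [] := dP x.
    by apply: cvg_at_right_filter; apply: is_derive1_continuous (dP 0).
  by apply: cvg_at_left_filter; apply: is_derive1_continuous (dP a).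
- by move=> x _; rewrite derive1E; apply: derive_val.
rewrite P0 sube0 -EFinD lee_fin.
have dNP (t : R) : is_derive t 1 (fun s => - P s) (- k t) by apply: is_deriveN.
have := @derive_le R (fun t => - P t) (fun t => - k t) q dq 0 a (ltW a0)
  (fun t _ => dNP t) (fun t _ => dq' t) le.
by rewrite P0; lra.
Qed.

Lemma derive_along_curve d (w : 'rV[R]_d * R -> R) (g dg : R -> 'rV[R]_d) (t : R) :
  differentiable w (g t, t) -> (forall i, is_derive t 1 (fun s => g s 0 i) (dg t 0 i)) ->
  is_derive t 1 (fun s => w (g s, s)) ('D_(dg t, 1) w (g t, t)).
Proof.
move=> dw dg'.
have dgt : derivable g t 1.
  by apply/derivable_mxP => i j; rewrite ord1; have [] := dg' j.
have vgt : 'D_1 g t = dg t.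
  by rewrite derive_mx//; apply/rowP => j; rewrite mxE; exact: derive_val.
have diffg : differentiable g t by exact/derivable1_diffP.
have diffp : differentiable (fun s : R => (g s, s)) t by exact: differentiable_pair.
have dc : differentiable (w \o (fun s : R => (g s, s))) t by exact: differentiable_comp.
apply: DeriveDef; first exact/derivable1_diffP.
rewrite (deriveE _ dc) diff_comp//= deriveE//; congr ('d w _ _).
rewrite diff_pair// -deriveE// vgt; congr pair.
by rewrite diff_val.
Qed.

End AlongCurves.

(** * Exit moment and exit map *)

Section ExitMap.
Context {R : realType} {d : nat}.
Variables (Om : set 'rV[R]_d) (Phi : 'rV[R]_d -> R -> 'rV[R]_d) (B L T0 : R).
Hypotheses (open_Om : open Om) (B_ge0 : 0 <= B) (T0_gt0 : 0 < T0).
Hypothesis Phi0 : forall x, Phi x 0 = x.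
Hypothesis Phi_time : forall x s t, `|Phi x s - Phi x t| <= B * `|s - t|.
Hypothesis Phi_space : forall x y t,
  `|Phi x t - Phi y t| <= d%:R * expR (L * d%:R * `|t|) * `|x - y|.
Hypothesis exits : forall x, Om x -> exists2 t, 0 <= t <= T0 & ~ Om (Phi x t).
Let V := ('rV[R]_d * R)%type.
Let X := ('rV[R]_d * measurableTypeR R)%type.

Let S x := [set t | 0 <= t <= T0 /\ forall s, 0 <= s <= t -> Om (Phi x s)].

(* For [x] outside [Om] the set is empty and the value is the junk [sup set0 = 0]. *)
Definition exit_moment x : R := sup (S x).

Let tau := exit_moment.

Let S0 x : Om x -> S x 0.
Proof.
move=> Ox; split=> [|s s0]; first by rewrite lexx ltW.
by have -> : s = 0 by [apply/eqP; rewrite eq_le andbC]; rewrite Phi0.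
Qed.

Let S_sup x : Om x -> has_sup (S x).
Proof. by move=> /S0 S0x; split; [exists 0|exists T0 => t [/andP[]]]. Qed.

Lemma exit_moment_ge0 x : 0 <= tau x.
Proof.
have [Ox|nOx] := pselect (Om x).
  exact: ub_le_sup (S_sup Ox).2 _ (S0 Ox).
rewrite /tau /exit_moment; suff -> : S x = set0 by rewrite sup0.
apply/seteqP; split=> t // -[/andP[t0 _] h]; apply: nOx.
by rewrite -(Phi0 x); apply: h; rewrite lexx.
Qed.

Lemma exit_moment_le x : tau x <= T0.
Proof.
have [Ox|nOx] := pselect (Om x).
  by apply: ge_sup; [exists 0; exact: S0|move=> t [/andP[]]].
rewrite /tau /exit_moment; suff -> : S x = set0 by rewrite sup0 ltW.
apply/seteqP; split=> t // -[/andP[t0 _] h]; apply: nOx.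
by rewrite -(Phi0 x); apply: h; rewrite lexx.
Qed.

Lemma before_exit x s : Om x -> 0 <= s < tau x -> Om (Phi x s).
Proof.
move=> Ox /andP[s0 st]; have st0 : 0 < tau x - s by rewrite subr_gt0.
have [u [_ hu] su] := sup_adherent st0 (S_sup Ox).
apply: hu; rewrite s0/=; apply/ltW; move: su.
by rewrite -/(exit_moment x) -/tau opprB addrC subrK.
Qed.

Lemma stays_le_exit x a : 0 <= a -> (forall t, 0 <= t <= a -> Om (Phi x t)) -> a <= tau x.
Proof.
move=> a0 stay; have Ox : Om x by rewrite -(Phi0 x); apply: stay; rewrite lexx.
apply: ub_le_sup; first exact: (S_sup Ox).2.
split=> //; rewrite a0/= leNgt; apply/negP => T0a.
have [t /andP[t0 tT]] := exits Ox; apply; apply: stay.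
by rewrite t0/= (le_trans tT)// ltW.
Qed.

Lemma exit_outside x : Om x -> ~ Om (Phi x (tau x)).
Proof.
move=> Ox Oe.
have nOm : \forall z \near Phi x (tau x), Om z by apply: open_nbhs_nbhs.
have [r r0 hr] := @near_norm_ball R 'rV[R]_d (Phi x (tau x)) _ nOm.
pose e := r / 2 / (B + 1); have B1 : 0 < B + 1 by rewrite ltr_wpDl.
have e0 : 0 < e by rewrite !divr_gt0.
have : tau x + e <= tau x.
  apply: stays_le_exit; first by rewrite addr_ge0 ?exit_moment_ge0// ltW.
  move=> t /andP[t0 te]; have [tt|tt] := ltP t (tau x).
    by apply: before_exit; rewrite ?t0.
  apply: hr; apply: le_lt_trans (Phi_time _ _ _) _; rewrite distrC ger0_norm ?subr_ge0//.
  apply: (@le_lt_trans _ _ (B * e)); first by rewrite ler_wpM2l// lerBlDl.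
  apply: (@le_lt_trans _ _ ((B + 1) * e)); first by rewrite ler_wpM2r ?(ltW e0)// lerDl.
  by rewrite /e mulrC divfK ?gt_eqF//; lra.
by rewrite gerDl leNgt e0.
Qed.

Lemma exit_moment_gt0 x : Om x -> 0 < tau x.
Proof.
move=> Ox; rewrite lt_neqAle exit_moment_ge0 andbT; apply/negP => /eqP t0.
by apply: (exit_outside Ox); rewrite -t0 Phi0.
Qed.

Lemma exit_bdry x : Om x -> bdry Om (Phi x (tau x)).
Proof.
move=> Ox; split; last by move=> /(@interior_subset _ _ _); exact: exit_outside.
move=> A /(@near_norm_ball R 'rV[R]_d)[r r0 hr].
have B1 : 0 < B + 1 by rewrite ltr_wpDl.
pose e := Num.min (tau x) (r / 2 / (B + 1)).
have e0 : 0 < e by rewrite lt_min exit_moment_gt0//= !divr_gt0.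
exists (Phi x (tau x - e)); split.
  by apply: before_exit => //; rewrite subr_ge0 ge_min lexx gtrBl.
apply: hr; apply: le_lt_trans (Phi_time _ _ _) _; rewrite opprB addrC subrK gtr0_norm//.
apply: (@le_lt_trans _ _ ((B + 1) * e)); first by rewrite ler_wpM2r ?(ltW e0)// lerDl.
have : e <= r / 2 / (B + 1) by rewrite ge_min lexx orbT.
by rewrite ler_pdivlMr// mulrC; lra.
Qed.

(** Remaining in the open set [Om] during a compact time is an open condition. Continuity may fail
    at an orbit that touches the boundary tangentially. *)
Lemma exit_moment_lsc x a : a < tau x -> \forall x' \near x, a < tau x'.
Proof.
move=> ax; have [a0|a0] := ltP a 0.
  by near=> y; apply: (lt_le_trans a0); exact: exit_moment_ge0.
have Ox : Om x.
  apply: contrapT => nOx; move: ax; rewrite ltNge /tau /exit_moment.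
  suff -> : S x = set0 by rewrite sup0 a0.
  apply/seteqP; split=> t // -[/andP[t0 _] h]; apply: nOx.
  by rewrite -(Phi0 x); apply: h; rewrite lexx.
pose a' := (a + tau x) / 2.
have aa' : a < a' by rewrite /a'; lra.
have a't : a' < tau x by rewrite /a'; lra.
have : nbhs x [set y | forall t, 0 <= t <= a' -> Om (Phi y t)].
  apply: open_nbhs_nbhs; split; first exact: (stays_open open_Om B_ge0 Phi_time Phi_space).
  by move=> t /andP[t0 ta]; apply: before_exit => //; rewrite t0 (le_lt_trans ta).
apply: filterS => y hy; apply: (lt_le_trans aa'); apply: stays_le_exit => //.
by apply: ltW; exact: le_lt_trans aa'.
Unshelve. all: by end_near. Qed.

Lemma measurable_exit_moment :
  measurable_fun setT (tau : 'rV[R]_d -> measurableTypeR R).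
Proof.
have : measurable_fun setT ((fun z => tau z.1) : X -> measurableTypeR R).
  apply: measurable_lsc => [z|z e e0]; first exact: exit_moment_ge0.
  have lt : tau z.1 - e < tau z.1 by rewrite gtrBl.
  exists ([set y | tau z.1 - e < tau y], setT).
    by split; [exact: exit_moment_lsc|exact: filterT].
  by move=> [y s] [/= hy _]; exact: ltW.
move=> h; have -> : tau = (fun z : X => tau z.1) \o (fun x => (x, 0)) by [].
apply: measurableT_comp => //; apply: measurable_fun_pair => //.
Qed.

Definition flow_map (z : V) : V := (Phi z.1 z.2, z.2).

Lemma flow_map_continuous : continuous flow_map.
Proof.
move=> [x t]; apply/cvgrPdist_lt => e e0.
have [[P Q] [/= hP hQ] PQ] := flow_near B_ge0 Phi_time Phi_space x t e0.
exists (Q, P `&` [set t' | `|t - t'| < e]).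
  split=> //; apply: filterI => //; exact: (@near_dist_lt R R t).
move=> [x' t'] [/= Qx [Pt tt']]; rewrite prod_normE /= gt_max tt' andbT.
exact: (PQ (t', x')).
Qed.

Lemma measurable_flow_map : measurable_fun setT (flow_map : X -> X).
Proof.
apply: measurable_fun_pair; last exact: measurable_snd.
apply: measurable_fun_rV => i; apply: continuous_measurable_rVR => z.
apply: (@continuous_comp _ _ _ (fst \o flow_map) (fun N : 'rV[R]_d => N 0 i)).
  by apply: continuous_comp; [exact: flow_map_continuous|exact: cvg_fst].
exact: coord_continuous.
Qed.

Lemma measurable_exit_map : measurable_fun setT ((fun x => flow_map (x, tau x)) : 'rV[R]_d -> X).
Proof.
apply: (measurableT_comp measurable_flow_map).
by apply: measurable_fun_pair => //; exact: measurable_exit_moment.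
Qed.

End ExitMap.

(** * Comparison of image measures *)

Section Comparison.
Context {R : realType}.

Lemma integral_mrestr disp (T : measurableType disp) (mu : {measure set T -> \bar R})
    (D : set T) (mD : measurable D) (f : T -> \bar R) :
  measurable_fun setT f -> (forall x, 0 <= f x)%E ->
  (\int[mrestr mu mD]_x f x = \int[mu]_(x in D) f x)%E.
Proof.
move=> mf f0; rewrite (@ge0_negligible_integral _ _ _ _ setT (~` D))//; last 2 first.
- exact: measurableC.
- by change (mu (~` D `&` D) = 0%E); rewrite setICl measure0.
rewrite setTD setCK; apply: eq_measure_integral => A mA AD.
by rewrite /mrestr; congr (mu _); apply/setIidPl.
Qed.

Lemma lsc_indic (V : topologicalType) (f : V -> R) (U : set V) : continuous f ->
  (forall z, 0 <= f z) -> open U ->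
  forall z e, 0 < e -> \forall z' \near z, f z * \1_U z - e <= f z' * \1_U z'.
Proof.
move=> cf f0 oU z e e0.
have f1 y : 0 <= f y * \1_U y by rewrite mulr_ge0// indicE.
have [Uz|nUz] := pselect (U z).
  have nU : \forall y \near z, U y by apply: open_nbhs_nbhs.
  have : \forall y \near z, `|f z - f y| < e by move: (cf z) => /cvgrPdist_lt/(_ _ e0).
  apply: filterS2 nU => y Uy; rewrite !indicE !mem_set// !mulr1 => /ltr_distlBl; lra.
by near=> y; rewrite indicE memNset// mulr0 sub0r; apply: le_trans (f1 y); rewrite oppr_le0 ltW.
Unshelve. all: by end_near. Qed.

Lemma integral_pushforward_mrestr disp1 disp2 (T1 : measurableType disp1)
    (T2 : measurableType disp2) (mu : {measure set T1 -> \bar R}) (D : set T1)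
    (mD : measurable D) (phi : T1 -> T2) (mphi : measurable_fun setT phi) (f : T2 -> \bar R) :
  measurable_fun setT f -> (forall y, 0 <= f y)%E ->
  (\int[pushforward (mrestr mu mD) phi]_y f y = \int[mu]_(x in D) f (phi x))%E.
Proof.
move=> mf f0; rewrite ge0_integral_pushforward// preimage_setT integral_mrestr//;
  last by move=> x; exact: f0.
exact: measurableT_comp.
Qed.

(** The domains of integration are absorbed into restricted measures and the maps into their images,
    so that both sides live on space-time, where [lsc_le_integral] needs cubes only. *)
Lemma lsc_pushforward_le d disp1 disp2 (T1 : measurableType disp1) (T2 : measurableType disp2)
    (mu : {measure set T1 -> \bar R}) (nu : {measure set T2 -> \bar R}) (D : set T1) (E : set T2)
    (phi : T1 -> 'rV[R]_d * measurableTypeR R) (psi : T2 -> 'rV[R]_d * measurableTypeR R)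
    (k : R) (g : 'rV[R]_d * R -> R) :
  measurable D -> measurable E -> measurable_fun setT phi -> measurable_fun setT psi -> 0 <= k ->
  (forall z, 0 <= g z) ->
  (forall z e, 0 < e -> \forall z' \near z, g z - e <= g z') ->
  (forall (a : 'rV[R]_d) (b s : R), 0 < s ->
    (mu (phi @^-1` (cube a s `*` `[b, (b + s)%R[%classic) `&` D) <=
    k%:E * nu (psi @^-1` (cube a s `*` `[b, (b + s)%R[%classic) `&` E))%E) ->
  (\int[mu]_(x in D) (g (phi x))%:E <= k%:E * \int[nu]_(y in E) (g (psi y))%:E)%E.
Proof.
move=> mD mE mphi mpsi k0 g0 glsc cells.
pose X : measurableType _ := ('rV[R]_d * measurableTypeR R)%type.
have mg : measurable_fun setT ((fun z => (g z)%:E) : X -> \bar R).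
  by apply/measurable_EFinP; exact: measurable_lsc.
have gE0 (z : X) : (0 <= (g z)%:E)%E by rewrite lee_fin.
rewrite -(integral_pushforward_mrestr mu mD mphi mg gE0).
rewrite -(integral_pushforward_mrestr nu mE mpsi mg gE0).
pose lam : {measure set X -> \bar R} :=
  measure_function_pushforward__canonical__measure_function_Measure (mrestr mu mD) mphi.
pose mu' : {measure set X -> \bar R} :=
  measure_function_pushforward__canonical__measure_function_Measure (mrestr nu mE) mpsi.
have := @lsc_le_integral R d lam (mscale (NngNum k0) mu') g g0 glsc cells.
by rewrite (@ge0_integral_mscale _ _ _ mu' setT measurableT (NngNum k0) _ mg).
Qed.

End Comparison.

Section SurfaceMeasurable.
Context {R : realType} {d : nat}.
Implicit Types A Om : set 'rV[R]_d.

Lemma measurable_surface A : measurable A -> measurable (A : set (surface_space d)).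
Proof. by move=> mA; rewrite -[A]setTI; exact: measurable_surface_id. Qed.

Lemma measurable_bdry Om : measurable (bdry Om).
Proof.
apply: measurableD; last by apply: open_measurable_rV; exact: open_interior.
rewrite -[closure Om]setCK; apply: measurableC; apply: open_measurable_rV.
by apply: closed_openC; exact: closed_closure.
Qed.

Lemma measurable_lateral Om (T : R) : measurable (lateral Om T).
Proof. by apply: measurableX => //; apply: measurable_surface; exact: measurable_bdry. Qed.

(** The two sides carry different sigma-algebras; this lets Borel functions of space-time be
    integrated against [dSdt]. *)
Lemma measurable_surface_time : measurable_fun setT
  (id : surface_space d * measurableTypeR R -> 'rV[R]_d * measurableTypeR R).
Proof.
have -> : (id : surface_space d * measurableTypeR R -> 'rV[R]_d * measurableTypeR R) =
  (fun z => (z.1, z.2)) by apply/funext => -[].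
apply: measurable_fun_pair; last exact: measurable_snd.
exact: (measurableT_comp measurable_surface_id measurable_fst).
Qed.

End SurfaceMeasurable.

Section FlowComparison.
Context {R : realType} {d : nat}.
Hypothesis d_gt0 : (0 < d)%N.
Variables (Om : set 'rV[R]_d) (Phi : 'rV[R]_d -> R -> 'rV[R]_d) (B L T0 T : R).
Hypotheses (open_Om : open Om) (B_ge0 : 0 <= B) (T0_gt0 : 0 < T0) (L_gt0 : 0 < L).
Hypothesis T0T : T0 < T.
Hypothesis Phi0 : forall x, Phi x 0 = x.
Hypothesis PhiD : forall x s t, Phi (Phi x s) t = Phi x (t + s).
Hypothesis Phi_time : forall x s t, `|Phi x s - Phi x t| <= B * `|s - t|.
Hypothesis Phi_space : forall x y t,
  `|Phi x t - Phi y t| <= d%:R * expR (L * d%:R * `|t|) * `|x - y|.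
Hypothesis exits : forall x, Om x -> exists2 t, 0 <= t <= T0 & ~ Om (Phi x t).
Let V := ('rV[R]_d * R)%type.
Let X := ('rV[R]_d * measurableTypeR R)%type.
Let C := d%:R * expR (L * d%:R * T).
Let tau := exit_moment Om Phi T0.
Let c := 3 * (C + B + 1).

Let C_ge0 : 0 <= C. Proof. by rewrite mulr_ge0// expR_ge0. Qed.
Let c_gt0 : 0 < c. Proof. by rewrite mulr_gt0// ltr_wpDl// addr_ge0. Qed.
Let T_gt0 : 0 < T. Proof. exact: lt_trans T0T. Qed.
Let NT_le b : - T <= Num.max 0 b.
Proof. by rewrite le_max oppr_le0 (ltW T_gt0). Qed.

Let mOm : measurable Om. Proof. exact: open_measurable_rV. Qed.

Let exit_map (x : 'rV[R]_d) : X := flow_map Phi (x, tau x).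

Let m_exit_map : measurable_fun setT exit_map.
Proof. exact: (measurable_exit_map open_Om B_ge0 T0_gt0 Phi0 Phi_time Phi_space exits). Qed.

Let m_flow : measurable_fun setT (flow_map Phi : X -> X).
Proof. exact: (measurable_flow_map B_ge0 Phi_time Phi_space). Qed.

(** For a cube of side [s] in space-time, the starting points visiting its spatial part in the
    window of length [s] have volume at most (c s)^d by [hits_short], that is c^d times the volume
    of that part. *)
Lemma flow_integral_le (g : V -> R) : (forall z, 0 <= g z) ->
  (forall (z : V) e, 0 < e -> \forall z' \near z, g z - e <= g z') ->
  (\int[dxdt]_(z in setT `*` `[0%R, T]) (g (flow_map Phi z))%:E <=
     (c ^+ d)%:E * \int[@dxdt R d]_z (g z)%:E)%E.
Proof.
move=> g0 glsc.
have mD : measurable (setT `*` `[0%R, T] : set X) by apply: measurableX.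
have k0 : 0 <= c ^+ d by rewrite exprn_ge0// ltW.
apply: (@lsc_pushforward_le R d _ _ X X _ _ _ setT (flow_map Phi) id) => // a b s s0.
have mI : measurable (`[b, (b + s)%R[%classic : set (measurableTypeR R)) by [].
(* The window is clipped to [0, T], where the spatial Lipschitz constant of the flow is uniform. *)
have [N [mN sub leN]] : volume_le (hits Phi (cube a s) (Num.max 0 b) (Num.min T (b + s)))
    ((c * s) ^+ d).
  apply: (hits_short B_ge0 C_ge0 Phi0 PhiD Phi_time (flow_space (T := T) L_gt0 Phi_space)) => //.
  - have h1 : Num.min T (b + s) <= b + s by rewrite ge_min lexx orbT.
    by have h2 : b <= Num.max 0 b; [rewrite le_max lexx orbT|lra].
  - by rewrite ge_min lexx.
  - move=> x y cx cy; apply: norm_le_coord; first exact: ltW.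
    move=> i; rewrite !mxE ler_norml.
    by have /andP[] := cx i; have /andP[] := cy i; lra.
apply: (@le_trans _ _ (@dxdt R d (N `*` `[b, (b + s)%R[%classic))).
  apply: le_measure; rewrite ?inE//.
  - apply: measurableI => //; rewrite -[X in measurable X]setTI; apply: m_flow => //.
    by apply: measurableX => //; exact: measurable_cube.
  - exact: measurableX.
  - move=> [x t] [[/= cx]]; rewrite in_itv/= => /andP[bt ts] [_ /=];
      rewrite in_itv/= => /andP[t0 tT].
    split=> /=; last by rewrite bt.
    by apply: sub; exists t => //; rewrite ge_max le_min t0 bt tT ltW.
have prodE A : measurable A -> (@dxdt R d (A `*` `[b, (b + s)%R[%classic) =
    lebesgue_rV d A * lebesgue_measure (`[b, (b + s)%R[%classic : set (measurableTypeR R)))%E.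
  by move=> mA; exact: product_measure1E.
rewrite setIT preimage_id !prodE//; last exact: measurable_cube.
rewrite lebesgue_cube ?(ltW s0)// lebesgue_measure_itv/= lte_fin ltrDl s0 -EFinD addrAC subrr add0r.
rewrite muleA; apply: lee_wpmul2r; first by rewrite lee_fin ltW.
by rewrite -EFinM -exprMn.
Qed.

(** A point whose exit falls in a given space-time cube has an orbit that visits the boundary part
    of this cube in the corresponding window, so [hits_hausdorff] bounds the volume of such points
    by area times duration. *)
Lemma exit_integral_le : exists2 k : R, 0 < k & forall g : V -> R, (forall z, 0 <= g z) ->
  (forall (z : V) e, 0 < e -> \forall z' \near z, g z - e <= g z') ->
  (\int[lebesgue_rV d]_(x in Om) (g (flow_map Phi (x, tau x)))%:E <=
     k%:E * \int[dSdt]_(y in bdry Om `*` setT) (g y)%:E)%E.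
Proof.
have [v v0 hv] := @unit_ball_volume_gt0 R d.-1.
pose k := c ^+ d * 2 ^+ d.-1 / v.
have k0 : 0 < k by rewrite divr_gt0// mulr_gt0// exprn_gt0.
exists k => // g g0 glsc.
apply: (@lsc_pushforward_le R d _ _ _ (surface_space d * measurableTypeR R)%type _ _ _
  (bdry Om `*` setT) exit_map id) => //.
- apply: measurableX; [exact: measurable_surface (measurable_bdry _)|exact: measurableT].
- exact: measurable_surface_time.
- exact: ltW.
move=> a b s s0; set A := _ `&` Om; rewrite preimage_id.
have mI : measurable (`[b, (b + s)%R[%classic : set (measurableTypeR R)) by [].
set Ec := bdry Om `&` cube a s.
have mEc : measurable (Ec : set (surface_space d)).
  by apply: measurable_surface; apply: measurableI; [exact: measurable_bdry|exact: measurable_cube].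
have -> : (cube a s `*` `[b, b + s[) `&` (bdry Om `*` setT) = Ec `*` `[b, (b + s)%R[%classic.
  by apply/seteqP; split=> -[y t] /=; rewrite /Ec /=; tauto.
have -> : (dSdt (Ec `*` `[b, (b + s)%R[%classic) =
    hausdorff d.-1 Ec * lebesgue_measure (`[b, (b + s)%R[%classic : set (measurableTypeR R)))%E.
  exact: product_measure1E.
rewrite lebesgue_measure_itv/= lte_fin ltrDl s0 -EFinD addrAC subrr add0r.
have mA : measurable A.
  apply: measurableI => //; rewrite -[X in measurable X]setTI; apply: m_exit_map => //.
  by apply: measurableX => //; exact: measurable_cube.
have [->|/set0P[x0 Ax0]] := eqVneq A set0.
  rewrite measure0; apply: mule_ge0; first by rewrite lee_fin ltW.
  by apply: mule_ge0; [exact: hausdorff_ge0|rewrite lee_fin ltW].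
have AP x : A x -> [/\ 0 < tau x, tau x <= T0, b <= tau x < b + s & Ec (Phi x (tau x))].
  move=> [[/= cx]]; rewrite in_itv/= => bt Ox; split=> //.
  - exact: (exit_moment_gt0 open_Om B_ge0 T0_gt0 Phi0 Phi_time exits).
  - exact: exit_moment_le.
  - by split=> //; exact: (exit_bdry open_Om B_ge0 T0_gt0 Phi0 Phi_time exits).
have between x : A x -> Num.max 0 b <= tau x <= Num.min T (b + s).
  move=> /AP[t0 tT /andP[bt ts] _].
  by rewrite ge_max le_min (ltW t0) bt (le_trans tT (ltW T0T)) ltW.
have ab : Num.max 0 b <= Num.min T (b + s) by have /andP[] := between _ Ax0; exact: le_trans.
(* Infinite area makes the right-hand side infinite. *)
have [Einf|Efin] := eqVneq (hausdorff d.-1 Ec) +oo%E.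
  by rewrite Einf gt0_mulye ?lte_fin// gt0_muley ?lte_fin// leey.
have Efin' : hausdorff d.-1 Ec \is a fin_num by rewrite ge0_fin_numE ?ltey//; exact: hausdorff_ge0.
set h := fine (hausdorff d.-1 Ec).
have h0 : 0 <= h by rewrite fine_ge0//; exact: hausdorff_ge0.
have Eh : (hausdorff d.-1 Ec = h%:E)%E by rewrite fineK.
rewrite Eh -!EFinM; apply/lee_addgt0Pr => eps eps0.
have hs : 0 < h + s + 1 by rewrite ltr_wpDl// addr_ge0// ltW.
(* Makes k (h + e) (s + e) exceed k h s by at most [eps]. *)
pose e := Num.min 1 (eps / (k * (h + s + 1))).
have e0 : 0 < e by rewrite lt_min ltr01/= divr_gt0// mulr_gt0.
have e1 : e <= 1 by rewrite ge_min lexx.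
have khs : 0 < k * (h + s + 1) by rewrite mulr_gt0.
have e2 : e * (k * (h + s + 1)) <= eps by rewrite -(ler_pdivlMr _ _ khs) ge_min lexx orbT.
have minT : Num.min T (b + s) <= T by rewrite ge_min lexx.
have hEh : (hausdorff d.-1 Ec <= h%:E)%E by rewrite Eh.
have [N [mN sub leN]] := hits_hausdorff d_gt0 B_ge0 C_ge0 Phi0 PhiD Phi_time
  (flow_space (T := T) L_gt0 Phi_space) ab (NT_le b) minT e0 hEh v0 hv.
apply: (@le_trans _ _ (lebesgue_rV d N)).
  apply: le_measure; rewrite ?inE// => x Ax; apply: sub; exists (tau x); first exact: between.
  by have [] := AP x Ax.
apply: (le_trans leN); rewrite lee_fin -/C -/c -/k.
have len : Num.min T (b + s) - Num.max 0 b <= s.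
  have h1 : Num.min T (b + s) <= b + s by rewrite ge_min lexx orbT.
  by have h2 : b <= Num.max 0 b; [rewrite le_max lexx orbT|lra].
apply: (@le_trans _ _ (k * (h + e) * (s + e))).
  by rewrite ler_wpM2l ?lerD2r// mulr_ge0 ?addr_ge0// ltW.
have -> : k * (h + e) * (s + e) = k * (h * s) + e * (k * (h + s + e)) by ring.
rewrite lerD2l; apply: le_trans e2.
by rewrite ler_wpM2l ?(ltW e0)// ler_wpM2l ?(ltW k0)// lerD2l.
Qed.

End FlowComparison.

Section SigmaFinite.
Context {R : realType} {disp : measure_display} {T : measurableType disp}.
Variables (mu : {measure set T -> \bar R}) (mu_sf : sigma_finite setT mu).

(** [lebesgue_rV] is typed as a mere measure, while Tonelli's theorem takes the bundled
    structure. *)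
Definition sigma_finite_of : {sigma_finite_measure set T -> \bar R} :=
  SigmaFiniteMeasure.Pack (SigmaFiniteMeasure.Class
    (Measure.measure_function_Content_isMeasure_mixin (Measure.class mu))
    (isSFinite.phant_Build (sfinite_measure_sigma_finite mu_sf))
    (isSigmaFinite.phant_Build mu_sf)).

End SigmaFinite.

Section Rectangle.
Context {R : realType} {d1 d2 : measure_display}.
Context {T1 : measurableType d1} {T2 : measurableType d2}.
Variables (m1 : {sigma_finite_measure set T1 -> \bar R}).
Variables (m2 : {sigma_finite_measure set T2 -> \bar R}).
Variables (A : set T1) (B : set T2) (f : T1 * T2 -> \bar R).
Hypotheses (mA : measurable A) (mB : measurable B) (mf : measurable_fun setT f).
Hypothesis f0 : forall z, (0 <= f z)%E.

Let restrict_section (E : set T1) x : E x ->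
  (\int[m2]_t (f \_ (E `*` B)) (x, t) = \int[m2]_(t in B) f (x, t))%E.
Proof.
move=> Ex; rewrite [RHS]integral_mkcond; apply: eq_integral => t _; rewrite !patchE.
by congr (if _ then _ else _); apply/idP/idP => /set_mem h; apply/mem_set => //; case: h.
Qed.

Let mfr (E : set T1) : measurable E -> measurable_fun setT (f \_ (E `*` B)).
Proof.
move=> mE; apply/(measurable_restrictT _ _).1; first exact: measurableX.
exact: measurable_funTS.
Qed.

Let fr0 (E : set T1) z : (0 <= (f \_ (E `*` B)) z)%E.
Proof. exact: erestrict_ge0. Qed.

Lemma measurable_section_integral :
  measurable_fun setT (fun x => \int[m2]_(t in B) f (x, t))%E.
Proof.
have := @measurable_fun_fubini_tonelli_F _ _ _ _ _ m2 _ (mfr measurableT) (fr0 setT).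
by congr measurable_fun; apply/funext => x; exact: restrict_section.
Qed.

Lemma integral_rectangle :
  (\int[m1]_(x in A) \int[m2]_(t in B) f (x, t) = \int[m1 \x m2]_(z in A `*` B) f z)%E.
Proof.
rewrite [RHS]integral_mkcond (fubini_tonelli1 _ (mfr mA) (fr0 A)).
rewrite integral_mkcond; apply: eq_integral => x _; rewrite /fubini_F patchE.
case: ifPn => [/set_mem Ax|/negP nA]; first by rewrite restrict_section.
rewrite integral0_eq// => t _; rewrite patchE; case: ifPn => // /set_mem[/= Ax _].
by exfalso; apply: nA; exact/mem_set.
Qed.

End Rectangle.

(** * Smooth functions: trace inequality at time 0 and transport defect *)

Section Smooth.
Context {R : realType} {d : nat}.
Let V := ('rV[R]_d * R)%type.
Let X := ('rV[R]_d * measurableTypeR R)%type.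

Lemma smooth_differentiable (w : V -> R) z : smooth w -> differentiable w z.
Proof. by move=> /(_ 1%N)[]. Qed.

Lemma smooth_derive_continuous (w : V -> R) v : smooth w -> continuous ('D_v w).
Proof. by move=> /(_ 1%N)[_]; exact. Qed.

Lemma smooth_continuous (w : V -> R) : smooth w -> continuous w.
Proof. by move=> /(_ 0%N). Qed.

Lemma derive_time_space (w : V -> R) (z : V) (y : 'rV[R]_d) : differentiable w z ->
  'D_(y, 1) w z = 'D_(0, 1) w z + \sum_i y 0 i * 'D_(delta_mx 0 i, 0) w z.
Proof.
move=> dw; rewrite !deriveE//.
have -> : (y, 1) = (0, 1) + \sum_i y 0 i *: ((delta_mx 0 i, 0) : V) :> V.
  have -> : \sum_i y 0 i *: ((delta_mx 0 i, 0) : V) = (y, 0).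
    rewrite [in RHS](row_sum_delta y); elim: (index_enum _) => [|i s IH]; first by rewrite !big_nil.
    by rewrite !big_cons IH; congr pair; rewrite /= scaler0 add0r.
  by congr pair; rewrite /= ?add0r ?addr0.
rewrite linearD linear_sum; congr (_ + _); apply: eq_bigr => i _.
by rewrite linearZ/= deriveE.
Qed.

Lemma integral_dxdt_rectangle (A : set 'rV[R]_d) (B : set (measurableTypeR R)) (f : X -> \bar R) :
  measurable A -> measurable B -> measurable_fun setT f -> (forall z, 0 <= f z)%E ->
  (\int[lebesgue_rV d]_(x in A) \int[lebesgue_measure]_(t in B) f (x, t) =
   \int[dxdt]_(z in A `*` B) f z)%E.
Proof.
move=> mA mB mf f0.
exact: (@integral_rectangle _ _ _ _ _ (sigma_finite_of (@sigma_finite_lebesgue_rV R d))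
  lebesgue_measure).
Qed.

Lemma continuous_pair (U : topologicalType) (f : U -> 'rV[R]_d) (g : U -> R) :
  continuous f -> continuous g -> continuous (fun x => (f x, g x)).
Proof.
move=> cf cg x A [[P Q] [/= hP hQ] sub].
have h1 : nbhs x (f @^-1` P) := cf x P hP; have h2 : nbhs x (g @^-1` Q) := cg x Q hQ.
by apply: filterS (filterI h1 h2) => y [Py Qy]; exact: (sub (f y, g y)).
Qed.

Lemma continuous_section (k : V -> R) (t : R) : continuous k -> continuous (fun x => k (x, t)).
Proof.
move=> ck x; apply: (@continuous_comp _ _ _ (fun x => (x, t)) k); last exact: ck.
have cid : continuous (fun y : 'rV[R]_d => y) by move=> y; exact: cvg_id.
have ct : continuous (fun _ : 'rV[R]_d => t) by move=> y; exact: cst_continuous.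
exact: (continuous_pair cid ct).
Qed.

Lemma continuous_cosection (k : V -> R) (g : R -> 'rV[R]_d) : continuous g -> continuous k ->
  continuous (fun t => k (g t, t)).
Proof.
move=> cg ck t; apply: (@continuous_comp _ _ _ (fun t => (g t, t)) k); last exact: ck.
by apply: continuous_pair t => [|y]; [exact: cg|exact: cvg_id].
Qed.

(** The factor 1 - t/T removes the value at [T]; its derivative gives the term w^2 / T, and 2 |w
    w_t| <= w^2 + w_t^2 gives the rest. *)
Lemma initial_integral_le (Om : set 'rV[R]_d) (T : R) : open Om -> 0 < T ->
  forall w : V -> R, smooth w ->
  (\int[lebesgue_rV d]_(x in Om) ((w (x, 0)) ^+ 2)%:E <=
   \int[dxdt]_(z in cylinder Om T) ((T^-1 + 1) * w z ^+ 2 + ('D_(0, 1) w z) ^+ 2)%:E)%E.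
Proof.
move=> oOm T0 w sw; have mOm := open_measurable_rV oOm.
have Ti0 : 0 < T^-1 by rewrite invr_gt0.
pose k z := (T^-1 + 1) * w z ^+ 2 + ('D_(0, 1) w z) ^+ 2.
have k0 z : 0 <= k z by rewrite addr_ge0 ?sqr_ge0// mulr_ge0 ?sqr_ge0// addr_ge0// ltW.
have cw := smooth_continuous sw.
have cDw := @smooth_derive_continuous w (0, 1) sw.
have ck : continuous k.
  apply: continuous_addr; last exact: continuous_mulr.
  apply: continuous_mulr; last exact: continuous_mulr.
  by move=> z; exact: cst_continuous.
have mk : measurable_fun setT ((fun z => (k z)%:E) : X -> \bar R).
  by apply/measurable_EFinP; exact: continuous_measurable_rVR.
have kE0 (z : X) : (0 <= (k z)%:E)%E by rewrite lee_fin.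
rewrite /cylinder -(integral_dxdt_rectangle mOm _ mk kE0)//.
apply: ge0_le_integral => //.
- by move=> x _; rewrite lee_fin sqr_ge0.
- suff h : measurable_fun setT ((fun x => w (x, 0) ^+ 2) : 'rV[R]_d -> measurableTypeR R).
    exact/measurable_funTS/measurable_EFinP.
  apply: continuous_measurable_rV => x.
  by apply: continuousM; exact: (@continuous_section w 0 cw x).
- apply/measurable_funTS; apply: (measurable_section_integral lebesgue_measure _ mk) => //.
move=> x Ox.
pose q t := (1 - t / T) * w (x, t) ^+ 2.
pose dw t := 'D_(0, 1) w (x, t).
have dq (t : R) : is_derive t 1 q ((1 - t / T) * (2 * w (x, t) * dw t) - T^-1 * w (x, t) ^+ 2).
  have dwt : is_derive t 1 (fun s => w (x, s)) (dw t).
    apply: (@derive_along_curve _ _ w (fun=> x) (fun=> 0)) => [|i].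
      exact: smooth_differentiable.
    by rewrite mxE; exact: is_derive_cst.
  have d2 := is_deriveM dwt dwt.
  have d1 : is_derive t 1 (fun s : R => 1 - s / T) (- T^-1).
    have h := is_deriveB (is_derive_cst (1 : R) t (1 : R)) (is_deriveZ T^-1 (is_derive_id t (1 :
      R))).
    apply: is_derive1_ext h => [s|]; first by rewrite !fctE /GRing.scale/= mulrC.
    by rewrite sub0r /GRing.scale/= mulr1.
  apply: is_derive1_ext (is_deriveM d1 d2) => [s|]; first by rewrite /q !fctE expr2.
  by rewrite !fctE /GRing.scale/=; ring.
have ckx : continuous (fun t => k (x, t)).
  by apply: (continuous_cosection (g := fun=> x)) => // y; exact: cst_continuous.
have := @derive_integral_bound R q _ (fun t => k (x, t)) T T0 ckx dq.
rewrite {1 2}/q mul0r subr0 mul1r divff ?gt_eqF// subrr mul0r add0e.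
rewrite integral_itv_bndoo; last first.
  by apply/measurable_EFinP/measurable_funTS; exact: continuous_measurable_fun.
apply=> t /andP[t0 tT].
have : 0 <= 1 - t / T <= 1.
  by rewrite subr_ge0 ler_pdivrMr// mul1r tT/= gerBl divr_ge0// ltW.
have := sqr_ge0 (w (x, t) + dw t); have := sqr_ge0 (w (x, t) - dw t).
rewrite /k -/(dw t); move: (w _) (dw t) (1 - t / T) => a b c; nra.
Qed.

End Smooth.

Lemma integral_indicM (R : realType) disp (T : measurableType disp)
    (mu : {measure set T -> \bar R}) (D E : set T) (f : T -> R) :
  (\int[mu]_(x in D) (f x * \1_E x)%:E = \int[mu]_(x in D `&` E) (f x)%:E)%E.
Proof.
rewrite [RHS]integral_mkcondr; apply: eq_integral => x _; rewrite patchE indicE.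
by case: ifPn => h; rewrite ?mulr1 ?mulr0.
Qed.

Lemma open_cylinder (R : realType) (d : nat) (Om : set 'rV[R]_d) (T : R) :
  open Om -> open (cylinder Om T).
Proof.
rewrite !openE => oOm [x t] [/= Ox tT]; exists (Om, `]0, T[%classic) => //=.
by split; [exact: oOm|apply: open_nbhs_nbhs; split=> //; exact: interval_open].
Qed.

Section Defect.
Context {R : realType} {d : nat}.
Variables (F : 'rV[R]_d -> 'rV[R]_d).
Let V := ('rV[R]_d * R)%type.

Definition transport_derivative (w : V -> R) (z : V) : R :=
  'D_(0, 1) w z + \sum_i F z.1 0 i * 'D_(delta_mx 0 i, 0) w z.

(* Bounded by [|w_t + F . grad w + p w|] for every potential [|p| <= M], but unlike
   it continuous. *)
Definition defect (M : R) (w : V -> R) (z : V) : R :=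
  Num.max 0 (`|transport_derivative w z| - M * `|w z|).

Lemma defect_continuous M w : continuous F -> smooth w -> continuous (defect M w).
Proof.
move=> cF sw; have ct : continuous (transport_derivative w).
  apply: continuous_addr; first exact: smooth_derive_continuous.
  apply: continuous_sumr => i; apply: continuous_mulr; last exact: smooth_derive_continuous.
  move=> z; apply: (@continuous_comp _ _ _ (F \o fst) (fun N : 'rV[R]_d => N 0 i)).
    by apply: continuous_comp; [exact: cvg_fst|exact: cF].
  exact: coord_continuous.
have cabs (f : V -> R) : continuous f -> continuous (fun z => `|f z|).
  move=> cf z; apply: (@continuous_comp _ _ _ f (fun x : R => `|x|)); first exact: cf.
  exact: norm_continuous.
have ck : continuous (fun z => `|transport_derivative w z| - M * `|w z|).
  have -> : (fun z => `|transport_derivative w z| - M * `|w z|) =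
    (fun z => `|transport_derivative w z| + - M * `|w z|) by apply/funext => z; rewrite mulNr.
  apply: continuous_addr; first exact: cabs.
  apply: continuous_mulr; first by move=> z; exact: cst_continuous.
  by apply: cabs; exact: smooth_continuous.
move=> z; suff : {for z, continuous ((fun=> 0) \max (fun z =>
  `|transport_derivative w z| - M * `|w z|))} by [].
by apply: continuous_max; [exact: cst_continuous|exact: ck].
Qed.

Lemma defect_ge0 M w z : 0 <= defect M w z.
Proof. by rewrite le_max lexx. Qed.

End Defect.

(** * Estimate for smooth functions *)

Section Energy.
Context {R : realType} {d : nat}.
Hypothesis d_gt0 : (0 < d)%N.
Variables (Om : set 'rV[R]_d) (F : 'rV[R]_d -> 'rV[R]_d) (Phi : 'rV[R]_d -> R -> 'rV[R]_d).
Variables (B L T0 T M : R).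
Hypotheses (open_Om : open Om) (B_ge0 : 0 <= B) (T0_gt0 : 0 < T0) (L_gt0 : 0 < L).
Hypotheses (T0T : T0 < T) (M_ge0 : 0 <= M) (F_cont : continuous F).
Hypothesis Phi_sol : forall x, solution F (Phi x).
Hypothesis Phi0 : forall x, Phi x 0 = x.
Hypothesis PhiD : forall x s t, Phi (Phi x s) t = Phi x (t + s).
Hypothesis Phi_time : forall x s t, `|Phi x s - Phi x t| <= B * `|s - t|.
Hypothesis Phi_space : forall x y t,
  `|Phi x t - Phi y t| <= d%:R * expR (L * d%:R * `|t|) * `|x - y|.
Hypothesis exits : forall x, Om x -> exists2 t, 0 <= t <= T0 & ~ Om (Phi x t).
Let V := ('rV[R]_d * R)%type.
Let X := ('rV[R]_d * measurableTypeR R)%type.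
Let tau := exit_moment Om Phi T0.
(** The derivative of w^2 along an orbit is at least - 2 |w| (M |w| + h): the part 2 M absorbs the
    potential, and 1 comes from 2 |w| h <= w^2 + h^2. *)
Let K := 2 * M + 1.
Let T_gt0 : 0 < T. Proof. exact: lt_trans T0T. Qed.

Section smooth_function.
Variables (w : V -> R) (sw : smooth w).
Let h := defect F M w.
Let G z := h z ^+ 2 * \1_(cylinder Om T) z.

Let ch : continuous h. Proof. exact: defect_continuous. Qed.

Let cflow x : continuous (fun t => h (Phi x t, t) ^+ 2).
Proof.
apply: (@continuous_cosection _ _ (fun z => h z ^+ 2)).
  exact: lipschitz_continuous (Phi_time x).
exact: continuous_mulr.
Qed.

Lemma defect_indic_lsc z e : 0 < e -> \forall z' \near z, G z - e <= G z'.
Proof.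
apply: lsc_indic; [|by move=> y; exact: sqr_ge0|exact: open_cylinder].
by apply: continuous_mulr.
Qed.

Lemma defect_indic_ge0 z : 0 <= G z.
Proof. by rewrite mulr_ge0 ?sqr_ge0// indicE. Qed.

Let mG : measurable_fun setT (G : X -> measurableTypeR R).
Proof. exact: (measurable_lsc defect_indic_ge0 defect_indic_lsc). Qed.

Lemma measurable_defect_flow : measurable_fun setT ((fun z =>
  (G (flow_map Phi z))%:E) : X -> \bar R).
Proof.
apply/measurable_EFinP.
exact: (measurableT_comp mG (measurable_flow_map B_ge0 Phi_time Phi_space)).
Qed.

Lemma energy_along_flow x : Om x ->
  ((w (x, 0) ^+ 2)%:E <= (expR (K * T))%:E * ((w (Phi x (tau x), tau x) ^+ 2)%:E +
     \int[lebesgue_measure]_(t in `]0%R, T[) (G (flow_map Phi (x, t)))%:E))%E.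
Proof.
move=> Ox; have t0 : 0 < tau x.
  exact: (exit_moment_gt0 open_Om B_ge0 T0_gt0 Phi0 Phi_time exits).
have tT : tau x < T by apply: le_lt_trans T0T; exact: exit_moment_le.
have K0 : 0 <= K by rewrite addr_ge0// mulr_ge0.
have mhx : measurable_fun setT ((fun t =>
  h (Phi x t, t) ^+ 2) : measurableTypeR R -> measurableTypeR R).
  by apply: continuous_measurable_fun; exact: cflow.
pose q t := expR (K * t) * w (Phi x t, t) ^+ 2.
pose k t := transport_derivative F w (Phi x t, t).
have dq (t : R) : is_derive t 1 q (expR (K * t) * (K * w (Phi x t, t) ^+ 2 + 2 * w (Phi x t, t) *
  k t)).
  have dw : is_derive t 1 (fun s => w (Phi x s, s)) (k t).
    rewrite /k /transport_derivative /= -derive_time_space; last exact: smooth_differentiable.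
    apply: (@derive_along_curve _ _ w (Phi x) (fun t => F (Phi x t))).
      exact: smooth_differentiable.
    by move=> i; exact: Phi_sol.
  have de : is_derive t 1 (fun s => expR (K * s)) (expR (K * t) * K).
    have h1 : is_derive t 1 (fun y : R => K * y) K.
      by have := @is_deriveZ R R R id K t 1 1 (is_derive_id _ _); rewrite [_ *: _]mulr1.
    exact: is_derive1_comp (is_derive_expR (K * t)) h1.
  apply: is_derive1_ext (is_deriveM de (is_deriveM dw dw)) => [s|].
    by rewrite /q !fctE expr2.
  by rewrite !fctE /GRing.scale/=; ring.
have ck : continuous (fun t => expR (K * T) * h (Phi x t, t) ^+ 2).
  by apply: continuous_mulr; [move=> t; exact: cst_continuous|exact: cflow].
have := @derive_integral_bound R q _ _ (tau x) t0 ck dq.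
rewrite {1}/q mulr0 expR0 mul1r Phi0 => /(_ _)/le_trans; apply.
  move=> t /andP[t_0 tt].
  have eE : expR (K * t) <= expR (K * T) by rewrite ler_expR ler_wpM2l// (le_trans tt)// ltW.
  have h_ge : `|k t| - M * `|w (Phi x t, t)| <= h (Phi x t, t) by rewrite le_max lexx orbT.
  have h0 : 0 <= h (Phi x t, t) by exact: defect_ge0.
  rewrite lerNl; apply: (@le_trans _ _ (expR (K * t) * h (Phi x t, t) ^+ 2)); last first.
    by rewrite ler_wpM2r ?sqr_ge0.
  rewrite -mulrN ler_wpM2l ?expR_ge0//.
  move: h_ge h0; rewrite /K; move: (w _) (k t) (h _) => a c b h_ge h0.
  have a2 : a ^+ 2 = `|a| ^+ 2 by rewrite -normrX ger0_norm// sqr_ge0.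
  have ac : - (a * c) <= `|a| * `|c| by rewrite -normrM -normrN ler_norm.
  have := ler_wpM2l (normr_ge0 a) h_ge; have := sqr_ge0 (`|a| - b).
  have -> : 2 * a * c = 2 * (a * c) by ring.
  rewrite a2; lra.
rewrite muleDr//.
apply: leeD.
  by rewrite -EFinM lee_fin /q ler_wpM2r ?sqr_ge0// ler_expR ler_wpM2l// ltW.
under eq_integral do rewrite EFinM.
rewrite ge0_integralZl_EFin//; last 2 first.
- by move=> t _; rewrite lee_fin sqr_ge0.
- by apply/measurable_EFinP/measurable_funTS; exact: mhx.
apply: lee_wpmul2l; first by rewrite lee_fin expR_ge0.
rewrite integral_itv_bndoo; last first.
  by apply/measurable_EFinP/measurable_funTS; exact: mhx.
have mGx : measurable_fun setT (fun t : measurableTypeR R => (G (flow_map Phi (x, t)))%:E).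
  apply: (@measurableT_comp _ _ _ _ _ _ (fun z : X => (G (flow_map Phi z))%:E)) => //.
  exact: measurable_defect_flow.
(* Up to the exit the indicator in [G] equals 1. Later returns of the orbit to [Om] only add
   nonnegative terms. *)
apply: (@le_trans _ _ (\int[lebesgue_measure]_(t in `]0%R, tau x[) (G (flow_map Phi (x, t)))%:E)%E).
  apply: ge0_le_integral => //.
  - by move=> t _; rewrite lee_fin sqr_ge0.
  - by apply/measurable_EFinP/measurable_funTS; exact: mhx.
  - exact: measurable_funTS.
  move=> t; rewrite /= in_itv/= => /andP[t_0 tt].
  rewrite lee_fin /G /flow_map /= indicE mem_set ?mulr1//; split=> /=.
    by apply: (before_exit T0_gt0 Phi0 Ox); rewrite (ltW t_0).
  by rewrite in_itv/= t_0 (lt_trans tt).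
apply: ge0_subset_integral => //.
- exact: measurable_funTS.
- by move=> t _; rewrite lee_fin defect_indic_ge0.
- by move=> t; rewrite /= !in_itv/= => /andP[-> ts]; exact: lt_trans tT.
Qed.



Lemma exit_flow_estimate :
  (\int[lebesgue_rV d]_(x in Om) (w (x, 0) ^+ 2)%:E <= (expR (K * T))%:E *
    (\int[lebesgue_rV d]_(x in Om) (w (flow_map Phi (x, tau x)) ^+ 2 *
        \1_(setT `*` `]0%R, T[) (flow_map Phi (x, tau x)))%:E +
     \int[dxdt]_(z in cylinder Om T) (G (flow_map Phi z))%:E))%E.
Proof.
(* Exit moments lie in ]0, T0], so the indicator is 1 at every exit; it will cut the boundary
   integral down to [lateral]. *)
pose g1 (z : V) := w z ^+ 2 * \1_(setT `*` `]0, T[) z.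
have g10 z : 0 <= g1 z by rewrite mulr_ge0 ?sqr_ge0// indicE.
have mOm : measurable Om by exact: open_measurable_rV.
have cw := smooth_continuous sw.
have mw : measurable_fun setT ((fun x => w (x, 0) ^+ 2) : 'rV[R]_d -> measurableTypeR R).
  apply: continuous_measurable_rV; apply: continuous_mulr; exact: (@continuous_section _ _ w 0 cw).
have mg1 : measurable_fun setT (g1 : X -> measurableTypeR R).
  apply: measurable_funM; first by apply: continuous_measurable_rVR; exact: continuous_mulr.
  by apply: measurable_indic; apply: measurableX.
have mexit := measurable_exit_map open_Om B_ge0 T0_gt0 Phi0 Phi_time Phi_space exits.
have mg1e : measurable_fun setT (fun x => (g1 (flow_map Phi (x, tau x)))%:E).
  by apply/measurable_EFinP; exact: (measurableT_comp mg1 mexit).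
have GE0 (z : X) : (0 <= (G (flow_map Phi z))%:E)%E by rewrite lee_fin defect_indic_ge0.
have mI : measurable (`]0%R, T[%classic : set (measurableTypeR R)) by [].
have mGt := measurable_section_integral lebesgue_measure mI measurable_defect_flow GE0.
rewrite /cylinder -(integral_dxdt_rectangle mOm mI measurable_defect_flow GE0).
rewrite -ge0_integralD//; last 4 first.
- by move=> x _; rewrite lee_fin; exact: g10.
- exact: measurable_funTS.
- by move=> x _; apply: integral_ge0 => t _; exact: GE0.
- exact: measurable_funTS.
rewrite -ge0_integralZl_EFin//; last 2 first.
- move=> x _; apply: adde_ge0; first by rewrite lee_fin; exact: g10.
  by apply: integral_ge0 => t _; exact: GE0.
- by apply: measurable_funTS; exact: emeasurable_funD.
apply: ge0_le_integral => //.
- by move=> x _; rewrite lee_fin sqr_ge0.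
- exact/measurable_funTS/measurable_EFinP.
- by apply: measurable_funTS; apply: measurable_funeM; exact: emeasurable_funD.
move=> x Ox; apply: (le_trans (energy_along_flow Ox)).
apply: lee_wpmul2l; first by rewrite lee_fin expR_ge0.
rewrite leeD2r// lee_fin indicE mem_set ?mulr1//; split=> //=.
rewrite in_itv/= (exit_moment_gt0 open_Om B_ge0 T0_gt0 Phi0 Phi_time exits)//=.
by apply: le_lt_trans T0T; exact: exit_moment_le.
Qed.

End smooth_function.

Lemma energy_estimate : exists2 k : R, 0 < k & forall w : V -> R, smooth w ->
  (\int[lebesgue_rV d]_(x in Om) (w (x, 0) ^+ 2)%:E <=
   k%:E * (\int[dSdt]_(y in lateral Om T) (w y ^+ 2)%:E +
           \int[dxdt]_(z in cylinder Om T) (defect F M w z ^+ 2)%:E))%E.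
Proof.
have [k1 k10 hk1] := exit_integral_le d_gt0 open_Om B_ge0 T0_gt0 L_gt0 T0T Phi0 PhiD Phi_time
  Phi_space exits.
have hk2 := flow_integral_le B_ge0 T0_gt0 L_gt0 T0T Phi0 PhiD Phi_time Phi_space.
set k2 := (_ ^+ d) in hk2.
have k20 : 0 <= k2 by rewrite exprn_ge0// mulr_ge0// !addr_ge0// mulr_ge0// expR_ge0.
exists (expR (K * T) * (k1 + k2)); first by rewrite mulr_gt0 ?expR_gt0// ltr_wpDr.
move=> w sw; have cw := smooth_continuous sw.
have cw2 : continuous (fun z => w z ^+ 2) by exact: continuous_mulr.
apply: (le_trans (exit_flow_estimate sw)).
rewrite EFinM -muleA; apply: lee_wpmul2l; first by rewrite lee_fin expR_ge0.
have I1 : (0 <= \int[dSdt]_(y in lateral Om T) (w y ^+ 2)%:E)%E.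
  by apply: integral_ge0 => y _; rewrite lee_fin sqr_ge0.
have I2 : (0 <= \int[dxdt]_(z in cylinder Om T) (defect F M w z ^+ 2)%:E)%E.
  by apply: integral_ge0 => y _; rewrite lee_fin sqr_ge0.
have step1 := hk1 (fun z => w z ^+ 2 * \1_(setT `*` `]0, T[) z).
have step2 := hk2 (fun z => defect F M w z ^+ 2 * \1_(cylinder Om T) z).
have mOm : measurable Om by exact: open_measurable_rV.
have h1 : (\int[lebesgue_rV d]_(x in Om) (w (flow_map Phi (x, tau x)) ^+ 2 *
    \1_(setT `*` `]0%R, T[) (flow_map Phi (x, tau x)))%:E <=
    k1%:E * \int[dSdt]_(y in lateral Om T) (w y ^+ 2)%:E)%E.
  apply: le_trans (step1 _ _) _.
  - by move=> z; rewrite mulr_ge0 ?sqr_ge0// indicE.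
  - apply: lsc_indic => //; first by move=> z; exact: sqr_ge0.
    by have := @open_cylinder R d setT T openT; rewrite /cylinder; apply.
  rewrite integral_indicM; apply: lee_wpmul2l; first by rewrite lee_fin ltW.
  suff -> : (bdry Om `*` setT) `&` (setT `*` `]0, T[) = lateral Om T by [].
  by apply/seteqP; split=> -[y t] /=; rewrite /lateral /=; tauto.
have h2 : (\int[dxdt]_(z in cylinder Om T) (defect F M w (flow_map Phi z) ^+ 2 *
    \1_(cylinder Om T) (flow_map Phi z))%:E <=
    k2%:E * \int[dxdt]_(z in cylinder Om T) (defect F M w z ^+ 2)%:E)%E.
  apply: le_trans (le_trans _ (step2 _ _)) _.
  - apply: ge0_subset_integral.
    + by apply: measurableX.
    + by apply: measurableX.
    + exact: measurable_funTS (measurable_defect_flow sw).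
    + by move=> z _; rewrite lee_fin; exact: defect_indic_ge0.
    + move=> [x t] [/= _]; rewrite in_itv/= => /andP[t0 tT]; split=> //=.
      by rewrite in_itv/= !ltW.
  - by move=> z; exact: defect_indic_ge0.
  - exact: defect_indic_lsc.
  by rewrite integral_indicM setTI.
apply: (le_trans (leeD h1 h2)).
have k12 (u v : R) (I J : \bar R) : 0 <= u -> 0 <= v -> (0 <= I -> 0 <= J ->
    u%:E * I + v%:E * J <= (u + v)%:E * (I + J))%E.
  move=> u0 v0 I0 J0; rewrite muleDr// ?ge0_adde_def ?inE//.
  by apply: leeD; apply: lee_wpmul2r => //; rewrite lee_fin ?lerDl ?lerDr.
exact: (k12 _ _ _ _ (ltW k10) k20 I1 I2).
Qed.

End Energy.

(** * Passage to the limit *)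

Section SquareIntegrals.
Context {R : realType} {disp : measure_display} {T : measurableType disp}.
Variables (mu : {measure set T -> \bar R}) (D : set T) (mD : measurable D).
Implicit Types f g : T -> R.
Local Open Scope ereal_scope.

Lemma normL2E f : normL mu D 2%:E f = (\int[mu]_(x in D) (f x ^+ 2)%:E) `^ 2^-1.
Proof.
rewrite /normL unlock; congr (_ `^ _); rewrite [RHS]integral_mkcond.
apply: eq_integral => x _; rewrite /= !patchE; case: ifPn => _.
  by rewrite powR_mulrn// real_normK ?num_real.
by rewrite normr0 powR0.
Qed.

Lemma sqint_ge0 f : 0 <= \int[mu]_(x in D) (f x ^+ 2)%:E.
Proof. by apply: integral_ge0 => x _; rewrite lee_fin sqr_ge0. Qed.

Lemma normL2_sqr f : (normL mu D 2%:E f) `^ 2 = \int[mu]_(x in D) (f x ^+ 2)%:E.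
Proof. by rewrite normL2E -poweRrM mulVf// poweRe1// sqint_ge0. Qed.

Lemma normL2_le f (e : R) : (0 <= e)%R -> normL mu D 2%:E f <= e%:E ->
  \int[mu]_(x in D) (f x ^+ 2)%:E <= (e ^+ 2)%:E.
Proof.
move=> e0 fe; rewrite -normL2_sqr -powR_mulrn// -poweR_EFin.
apply: gt0_ler_poweR => //; rewrite in_itv/= ?lee_fin// ?e0 ?leey ?andbT//.
by rewrite normL2E poweR_ge0.
Qed.

Lemma inL2_sqint f : inL mu D 2%:E f -> exists2 a : R, (0 <= a)%R &
  \int[mu]_(x in D) (f x ^+ 2)%:E = a%:E.
Proof.
move=> [_ ffin]; have fe : normL mu D 2%:E f \is a fin_num.
  by rewrite ge0_fin_numE// normL2E poweR_ge0.
exists (fine (\int[mu]_(x in D) (f x ^+ 2)%:E)); first by rewrite fine_ge0// sqint_ge0.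
by rewrite fineK// -normL2_sqr fin_num_poweR.
Qed.

Lemma near_sqint (f : nat -> T -> R) (e : R) : (0 < e)%R ->
  normL mu D 2%:E (f n) @[n --> \oo] --> 0 ->
  \forall n \near \oo, \int[mu]_(x in D) (f n x ^+ 2)%:E <= e%:E.
Proof.
move=> e0 /fine_cvgP[fin /cvgrPdist_le/(_ (Num.sqrt e))].
rewrite sqrtr_gt0 => /(_ e0); apply: filterS2 fin => n fin.
rewrite sub0r normrN => h.
have -> : e%:E = (Num.sqrt e ^+ 2)%:E by rewrite sqr_sqrtr// ltW.
apply: normL2_le; first exact: sqrtr_ge0.
by rewrite -(fineK fin) lee_fin; apply: le_trans h; exact: ler_norm.
Qed.

Lemma integral_le_sum_sq (I : finType) (F : T -> R) (g : I -> T -> R) (k e : R) : (0 <= k)%R ->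
  (0 <= e)%R ->
  (forall x, D x -> 0 <= F x)%R -> measurable_fun D (F : T -> measurableTypeR R) ->
  (forall i, measurable_fun D (g i : T -> measurableTypeR R)) ->
  {ae mu, forall x, D x -> F x <= k * \sum_i g i x ^+ 2}%R ->
  (forall i, \int[mu]_(x in D) (g i x ^+ 2)%:E <= e%:E) ->
  \int[mu]_(x in D) (F x)%:E <= (k * #|I|%:R * e)%:E.
Proof.
move=> k0 e0 F0 mF mg le_ae ge.
have mg2 i : measurable_fun D (fun x => (g i x ^+ 2)%:E).
  by apply/measurable_EFinP; exact: measurable_funM (mg i) (mg i).
have sum0 x : 0 <= \sum_i (g i x ^+ 2)%:E.
  by apply: sume_ge0 => i _; rewrite lee_fin sqr_ge0.
have msum : measurable_fun D (fun x => \sum_i (g i x ^+ 2)%:E) by exact: emeasurable_sum.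
apply: (@le_trans _ _ (\int[mu]_(x in D) (k%:E * \sum_i (g i x ^+ 2)%:E))).
  apply: ae_ge0_le_integral => //.
  - exact/measurable_EFinP.
  - by move=> x _; apply: mule_ge0; rewrite ?lee_fin.
  - exact: measurable_funeM.
  by move: le_ae; apply: filterS => x le Dx; rewrite sumEFin -EFinM lee_fin le.
rewrite ge0_integralZl_EFin//.
rewrite ge0_integral_sum//; last by move=> i x _; rewrite lee_fin sqr_ge0.
rewrite -mulrA EFinM; apply: lee_wpmul2l; first by rewrite lee_fin.
rewrite -sum1_card natr_sum mulr_suml -sumEFin; apply: lee_sum => i _.
by rewrite mul1r.
Qed.

Lemma integral_sq_add f g (a b : R) : (0 <= a)%R -> (0 <= b)%R ->
  measurable_fun D (f : T -> measurableTypeR R) -> measurable_fun D (g : T -> measurableTypeR R) ->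
  \int[mu]_(x in D) (f x ^+ 2)%:E <= a%:E -> \int[mu]_(x in D) (g x ^+ 2)%:E <= b%:E ->
  \int[mu]_(x in D) ((f x + g x) ^+ 2)%:E <= (4 * (a + b))%:E.
Proof.
move=> a0 b0 mf mg fa gb.
have := @integral_le_sum_sq bool (fun x => (f x + g x) ^+ 2)%R (fun c => if c then f else g)
  2 (a + b)%R.
rewrite card_bool (_ : 2 * 2%:R = 4 :> R)%R; last by ring.
apply=> //.
- exact: addr_ge0.
- by move=> x _; exact: sqr_ge0.
- by apply: measurable_funX; exact: measurable_funD.
- by case.
- apply: aeW => x _; rewrite big_bool/=.
  by have := sqr_ge0 (f x - g x)%R; lra.
- by case; [apply: le_trans fa _|apply: le_trans gb _]; rewrite lee_fin ?lerDl ?lerDr.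
Qed.

Lemma ae_imply2 (P1 P2 P3 : T -> Prop) : {ae mu, forall x, P1 x} -> {ae mu, forall x, P2 x} ->
  (forall x, P1 x -> P2 x -> P3 x) -> {ae mu, forall x, P3 x}.
Proof. by move=> h1 h2 h; apply: filterS2 h1 h2. Qed.

End SquareIntegrals.

Section SmoothSub.
Context {R : realType} {V : normedModType R}.

Lemma Ck_sub k (f g : V -> R) : Ck k f -> Ck k g -> Ck k (f - g).
Proof.
elim: k f g => [|k IH] f g /=; first by move=> cf cg x; exact: cvgB (cf x) (cg x).
move=> [df cf] [dg cg]; split=> [x|v]; first exact: differentiableB.
have -> : 'D_v (f - g) = 'D_v f - 'D_v g; last exact: IH.
by apply/funext => x; rewrite deriveB//; exact: diff_derivable.
Qed.

End SmoothSub.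

Lemma sqr_sum_le (R : realType) (n : nat) (x : 'I_n -> R) :
  (\sum_i x i) ^+ 2 <= n%:R * \sum_i x i ^+ 2.
Proof.
rewrite expr2 big_distrlr/=.
apply: (@le_trans _ _ (\sum_i \sum_j (x i ^+ 2 + x j ^+ 2) / 2)).
  apply: ler_sum => i _; apply: ler_sum => j _.
  by have := sqr_ge0 (x i - x j); lra.
have -> : \sum_i \sum_j (x i ^+ 2 + x j ^+ 2) / 2 = n%:R * \sum_i x i ^+ 2; last by [].
under eq_bigr do rewrite -mulr_suml big_split/= sumr_const card_ord.
rewrite -mulr_suml big_split/= sumr_const card_ord sumrMnl -mulr2n -mulr_natl.
by rewrite -[_ *+ 2]mulr_natl -[_ *+ n]mulr_natl; field.
Qed.

(** In [defect_le_err], [A], [S1] and [C] are the errors on the time derivative, on the gradient and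
    on the function itself. *)
Lemma square_three (R : realType) (A B M C S1 S2 d : R) : 0 <= S2 -> 0 <= d ->
  S1 ^+ 2 <= d * S2 ->
  (A + B * S1 + M * C) ^+ 2 <= 3 * (1 + B ^+ 2 * d + M ^+ 2) * (C ^+ 2 + A ^+ 2 + S2).
Proof.
move=> S20 d0 S12.
apply: (@le_trans _ _ (3 * (A ^+ 2 + B ^+ 2 * S1 ^+ 2 + M ^+ 2 * C ^+ 2))).
  have := sqr_ge0 (A - B * S1); have := sqr_ge0 (A - M * C).
  by have := sqr_ge0 (B * S1 - M * C); lra.
have Bb : B ^+ 2 * S1 ^+ 2 <= B ^+ 2 * d * S2 by rewrite -mulrA ler_wpM2l ?sqr_ge0.
have Bd : 0 <= B ^+ 2 * d by rewrite mulr_ge0 ?sqr_ge0.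
have M2 := sqr_ge0 M; have A2 := sqr_ge0 A; have C2 := sqr_ge0 C.
have := mulr_ge0 Bd A2; have := mulr_ge0 Bd C2; have := mulr_ge0 M2 A2.
have := mulr_ge0 M2 S20; lra.
Qed.

Section Passage.
Context {R : realType} {d : nat}.
Variables (Om : set 'rV[R]_d) (T : R).
Hypotheses (open_Om : open Om) (T_gt0 : 0 < T).
Variables (F H : 'rV[R]_d -> 'rV[R]_d) (p : 'rV[R]_d -> R) (B M : R).
Hypotheses (B_ge0 : 0 <= B) (M_ge0 : 0 <= M) (F_cont : continuous F).
Hypotheses (F_bnd : forall x, `|F x| <= B) (FH : forall x, Om x -> F x = H x).
Hypothesis p_le : {ae lebesgue_rV d, forall x, Om x -> `|p x| <= M}.
Variable u : 'rV[R]_d * R -> R.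
Hypotheses (H1u : inH1 (cylinder Om T) u) (Pu : transport_equation Om T H p u).
Let V := ('rV[R]_d * R)%type.
Let X := ('rV[R]_d * measurableTypeR R)%type.
Let Q : set X := cylinder Om T.
Let e_t : V := (0, 1).
Let e_x i : V := (delta_mx 0 i, 0).

Let mOm : measurable Om. Proof. exact: open_measurable_rV. Qed.
Let mQ : measurable Q. Proof. by apply: measurableX. Qed.

Let mu_ : measurable_fun Q (u : X -> measurableTypeR R). Proof. by have [[]] := H1u. Qed.

Let mwderiv v : measurable_fun Q (wderiv Q v u : X -> measurableTypeR R).
Proof. by have [_ /(_ v)[g hg]] := H1u; have [[]] := @xgetPex _ (fun=> 0) _ (ex_intro _ g hg). Qed.

(** One finite index type, so that all the errors become small for the same n. *)
Let err (w : V -> R) (j : bool + 'I_d) : V -> R :=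
  match j with
  | inl true => fun z => w z - u z
  | inl false => fun z => 'D_e_t w z - wderiv Q e_t u z
  | inr i => fun z => 'D_(e_x i) w z - wderiv Q (e_x i) u z
  end.

Let m_err w j : smooth w -> measurable_fun Q (err w j : X -> measurableTypeR R).
Proof.
move=> sw; have mD v : measurable_fun Q ('D_v w : X -> measurableTypeR R).
  apply: measurable_funTS; apply: continuous_measurable_rVR; exact: smooth_derive_continuous.
have mw : measurable_fun Q (w : X -> measurableTypeR R).
  by apply: measurable_funTS; apply: continuous_measurable_rVR; exact: smooth_continuous.
by case: j => [[]|i]; [exact: measurable_funB mw mu_|exact: measurable_funB (mD _) (mwderiv _)
  |exact: measurable_funB (mD _) (mwderiv _)].
Qed.

Lemma potential_le : {ae dxdt, forall z, cylinder Om T z -> `|p z.1| <= M}.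
Proof.
have [N [mN N0 sub]] := p_le; exists (N `*` setT); split; first exact: measurableX.
  have := product_measure1E (lebesgue_rV d) (@lebesgue_measure R) mN (@measurableT _
    (measurableTypeR R)).
  by rewrite N0 mul0e.
by move=> [x t] /= nz; split=> //=; apply: sub => hx; apply: nz => -[/= Ox _]; exact: hx.
Qed.

(** Subtracting the equation of [u], the transport derivative of [w] is a combination of errors
    minus p u, and |p u| is at most M |w| plus M times the error on the function. The term M |w| is
    the one that [defect] subtracts. *)
Lemma defect_le_err w : smooth w -> {ae dxdt, forall z, Q z ->
  defect F M w z ^+ 2 <= 3 * (1 + B ^+ 2 * d%:R + M ^+ 2) * \sum_j err w j z ^+ 2}.
Proof.
move=> sw; apply: (ae_imply2 Pu potential_le) => z Pz pz Qz.
have {}pz := pz Qz; have {}Pz := Pz Qz; have [Oz _] := Qz.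
set a := err w (inl false) z; set c := err w (inl true) z; pose b i := err w (inr i) z.
rewrite big_sumType/= big_bool/= -/a -/c.
have TD : transport_derivative F w z = a + \sum_i F z.1 0 i * b i - p z.1 * u z.
  have bE : \sum_i F z.1 0 i * b i = \sum_i F z.1 0 i * 'D_(e_x i) w z -
      \sum_i F z.1 0 i * wderiv Q (e_x i) u z.
    by rewrite -sumrB; apply: eq_bigr => i _; rewrite /b /err mulrBr.
  have Pz' : wderiv Q e_t u z + \sum_i F z.1 0 i * wderiv Q (e_x i) u z + p z.1 * u z = 0.
    by rewrite FH.
  by rewrite bE /a /err /transport_derivative -/e_t; move: Pz'; rewrite /e_x; lra.
have h_le : defect F M w z <= `|a| + B * \sum_i `|b i| + M * `|c|.
  rewrite /defect ge_max; apply/andP; split.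
    by rewrite !addr_ge0// mulr_ge0// sumr_ge0.
  rewrite TD lerBlDr.
  have h1 : `|a + \sum_i F z.1 0 i * b i - p z.1 * u z| <=
      `|a| + `|\sum_i F z.1 0 i * b i| + `|p z.1 * u z|.
    by apply: (le_trans (ler_normB _ _)); rewrite lerD2r ler_normD.
  have h2 : `|\sum_i F z.1 0 i * b i| <= B * \sum_i `|b i|.
    apply: (le_trans (ler_norm_sum _ _ _)); rewrite mulr_sumr; apply: ler_sum => i _.
    by rewrite normrM ler_wpM2r// (le_trans (coord_le_norm _ _)).
  have h3 : `|p z.1 * u z| <= M * `|c| + M * `|w z|.
    rewrite normrM -mulrDr; apply: ler_pM => //.
    apply: (@le_trans _ _ `|w z - c|); first by rewrite /c /err/= subKr.
    by rewrite [leRHS]addrC; exact: ler_normB.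
  by move: h1 h2 h3; lra.
have s0 : 0 <= \sum_i `|b i| by apply: sumr_ge0.
have b2 : (\sum_i `|b i|) ^+ 2 <= d%:R * \sum_i b i ^+ 2.
  apply: (le_trans (sqr_sum_le _)); rewrite ler_wpM2l//.
  by apply: ler_sum => i _; rewrite real_normK ?num_real.
have sb0 : 0 <= \sum_i b i ^+ 2 by apply: sumr_ge0 => i _; exact: sqr_ge0.
apply: (@le_trans _ _ ((`|a| + B * \sum_i `|b i| + M * `|c|) ^+ 2)).
  by rewrite ler_pXn2r// nnegrE ?defect_ge0// !addr_ge0// mulr_ge0.
have := square_three `|a| B M `|c| sb0 (ler0n R d) b2.
by rewrite (real_normK (num_real a)) (real_normK (num_real c)).
Qed.

Variable k1 : R.
Hypothesis k1_gt0 : 0 < k1.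
Hypothesis energy : forall w : V -> R, smooth w ->
  (\int[lebesgue_rV d]_(x in Om) (w (x, 0%R) ^+ 2)%:E <=
   k1%:E * (\int[dSdt]_(y in lateral Om T) (w y ^+ 2)%:E +
            \int[dxdt]_(z in cylinder Om T) (defect F M w z ^+ 2)%:E))%E.

Let near_err w e : 0 < e -> (forall n, smooth (w n)) ->
  normL dxdt Q 2%:E (fun z => w n z - u z) @[n --> \oo] --> 0%E ->
  (forall v, normL dxdt Q 2%:E (fun z => 'D_v (w n) z - wderiv Q v u z) @[n --> \oo] --> 0%E) ->
  \forall n \near \oo, forall j, (\int[dxdt]_(z in Q) (err (w n) j z ^+ 2)%:E <= e%:E)%E.
Proof.
move=> e0 sw w0 wD; apply: filter_forall => -[[]|i].
- exact: near_sqint e0 w0.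
- exact: near_sqint e0 (wD e_t).
- exact: near_sqint e0 (wD (e_x i)).
Qed.

Let K2 := 3 * (1 + B ^+ 2 * d%:R + M ^+ 2) * #|{: bool + 'I_d}|%:R.
Let K3 := 2 * (T^-1 + 1) * #|{: bool * bool}|%:R.

Let K2_ge0 : 0 <= K2.
Proof. by rewrite mulr_ge0// mulr_ge0// !addr_ge0 ?sqr_ge0// mulr_ge0 ?sqr_ge0. Qed.

Let K3_ge0 : 0 <= K3.
Proof. by rewrite mulr_ge0// mulr_ge0// addr_ge0// invr_ge0 ltW. Qed.

Let defect_small w e : 0 <= e -> smooth w ->
  (forall j, (\int[dxdt]_(z in Q) (err w j z ^+ 2)%:E <= e%:E)%E) ->
  (\int[dxdt]_(z in Q) (defect F M w z ^+ 2)%:E <= (K2 * e)%:E)%E.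
Proof.
move=> e0 sw small; apply: integral_le_sum_sq => //.
- by rewrite mulr_ge0// !addr_ge0 ?sqr_ge0// mulr_ge0 ?sqr_ge0.
- by move=> z _; exact: sqr_ge0.
- apply: measurable_funTS; apply: continuous_measurable_rVR.
  by apply: continuous_mulr; exact: defect_continuous.
- by move=> j; exact: m_err.
- exact: defect_le_err.
Qed.

(** The two traces come with unrelated approximating sequences. Both are close to [u] in the norm
    that controls the value at t = 0, hence close to each other there. *)
Let initial_small w w' e : 0 <= e -> smooth w -> smooth w' ->
  (forall j, (\int[dxdt]_(z in Q) (err w j z ^+ 2)%:E <= e%:E)%E) ->
  (forall j, (\int[dxdt]_(z in Q) (err w' j z ^+ 2)%:E <= e%:E)%E) ->
  (\int[lebesgue_rV d]_(x in Om) ((w (x, 0%R) - w' (x, 0%R)) ^+ 2)%:E <= (K3 * e)%:E)%E.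
Proof.
move=> e0 sw sw' small small'.
have sv : smooth (w - w') by move=> k; exact: Ck_sub.
apply: (le_trans (initial_integral_le open_Om T_gt0 sv)).
have Ti0 : 0 <= T^-1 by rewrite invr_ge0 ltW.
apply: (@integral_le_sum_sq _ _ _ _ _ mQ (bool * bool)%type _
  (fun ij => err (if ij.1 then w else w') (inl ij.2))) => //.
- by rewrite mulr_ge0// addr_ge0.
- by move=> z _; rewrite addr_ge0 ?sqr_ge0// mulr_ge0 ?sqr_ge0// addr_ge0.
- apply: measurable_funTS; apply: continuous_measurable_rVR; apply: continuous_addr.
    apply: continuous_mulr; first by move=> z; exact: cst_continuous.
    by apply: continuous_mulr; exact: smooth_continuous.
  by apply: continuous_mulr; exact: smooth_derive_continuous.
- by move=> -[[] b]; exact: m_err.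
- apply: aeW => z _; rewrite -(pair_bigA _ (fun i j => err (if i then w else w') (inl j) z ^+ 2))/=.
  rewrite !big_bool/= deriveB; try by apply: diff_derivable; exact: smooth_differentiable.
  rewrite -/e_t -/Q; set a := w z - u z; set a' := w' z - u z.
  set b := _ - wderiv Q e_t u z; set b' := 'D_e_t w' z - wderiv Q e_t u z.
  have -> : (w - w') z = a - a' by rewrite /a /a' !fctE; ring.
  have -> : 'D_e_t w z - 'D_e_t w' z = b - b' by rewrite /b /b'; ring.
  have := sqr_ge0 (a + a'); have := sqr_ge0 (b + b').
  have q1 := mulr_ge0 Ti0 (sqr_ge0 (a + a')).
  have q2 := mulr_ge0 Ti0 (sqr_ge0 b); have q3 := mulr_ge0 Ti0 (sqr_ge0 b').
  lra.
- by move=> -[[] b].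
Qed.

(** The chain goes from [ub] to w', from w' to [w] at t = 0, and from [w] to [u0]. Each of these
    three passages costs a factor 4 by [integral_sq_add], whence 64; [K] collects the coefficients
    of the vanishing error [e]. *)
Lemma trace_estimate u0 ub : initial_trace Om T u u0 -> lateral_trace Om T u ub ->
  (normL (lebesgue_rV d) Om 2%:E u0 <=
     (Num.sqrt (64 * k1))%:E * normL dSdt (lateral Om T) 2%:E ub)%E.
Proof.
move=> [[mu0 _] [w [sw wu wD w0]]] [inub [w' [sw' wu' wD' wb]]].
have mS : measurable (lateral Om T : set (surface_space d * measurableTypeR R)).
  exact: measurable_lateral.
have [a a0 ubE] := inL2_sqint inub.
have k10 := ltW k1_gt0.
have msec (v : V -> R) : smooth v -> measurable_fun Om ((fun x =>
  v (x, 0)) : 'rV[R]_d -> measurableTypeR R).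
  move=> sv; apply: measurable_funTS; apply: continuous_measurable_rV.
  exact: (@continuous_section _ _ v 0 (smooth_continuous sv)).
have m_id := @measurable_surface_time R d.
have mlat (v : V -> R) : smooth v -> measurable_fun (lateral Om T)
    (v : surface_space d * measurableTypeR R -> measurableTypeR R).
  move=> sv; apply: measurable_funTS; apply: (measurableT_comp _ m_id).
  by apply: continuous_measurable_rVR; exact: smooth_continuous.
pose K := 4 + 16 * K3 + 16 * k1 * (4 + K2).
have K4 : 0 <= 4 + K2 by exact: addr_ge0 (ler0n R 4) K2_ge0.
have K0 : 0 <= K by have := K3_ge0; have := mulr_ge0 k10 K4; rewrite /K; lra.
have est e : 0 < e ->
    (\int[lebesgue_rV d]_(x in Om) (u0 x ^+ 2)%:E <= (64 * k1 * a + K * e)%:E)%E.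
  move=> e0; have e0' := ltW e0.
  have n1 := near_err e0 sw wu wD; have n2 := near_err e0 sw' wu' wD'.
  have n3 := near_sqint e0 w0; have n4 := near_sqint e0 wb.
  have [n [[small small'] [small0 smallb]]] := filter_ex (filterI (filterI n1 n2) (filterI n3 n4)).
  have lat : (\int[dSdt]_(y in lateral Om T) (w' n y ^+ 2)%:E <= (4 * (e + a))%:E)%E.
    have := integral_sq_add mS e0' a0 (measurable_funB (mlat _ (sw' n)) inub.1) inub.1 smallb.
    rewrite ubE => /(_ (lexx _)); apply: le_trans.
    by under [leRHS]eq_integral do rewrite subrK.
  have b1 : (\int[lebesgue_rV d]_(x in Om) (w' n (x, 0%R) ^+ 2)%:E <=
      (k1 * (4 * (e + a) + K2 * e))%:E)%E.
    apply: (le_trans (energy (sw' n))); rewrite EFinM; apply: lee_wpmul2l; first by rewrite lee_fin.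
    by rewrite EFinD; apply: leeD lat _; exact: defect_small.
  have b1_ge0 : 0 <= k1 * (4 * (e + a) + K2 * e).
    by rewrite mulr_ge0// addr_ge0// mulr_ge0// addr_ge0.
  have b2 : (\int[lebesgue_rV d]_(x in Om) (w n (x, 0%R) ^+ 2)%:E <=
      (4 * (K3 * e + k1 * (4 * (e + a) + K2 * e)))%:E)%E.
    have := integral_sq_add mOm _ b1_ge0 (measurable_funB (msec _ (sw n)) (msec _ (sw' n)))
      (msec _ (sw' n)) (initial_small e0' (sw n) (sw' n) small small') b1.
    rewrite mulr_ge0// => /(_ isT); apply: le_trans.
    by under [leRHS]eq_integral do rewrite subrK.
  have b2_ge0 : 0 <= 4 * (K3 * e + k1 * (4 * (e + a) + K2 * e)).
    by rewrite mulr_ge0// addr_ge0// mulr_ge0.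
  have small0' : (\int[lebesgue_rV d]_(x in Om) ((u0 x - w n (x, 0%R)) ^+ 2)%:E <= e%:E)%E.
    by under eq_integral do rewrite -sqrrN opprB.
  have := integral_sq_add mOm e0' b2_ge0 (measurable_funB mu0 (msec _ (sw n))) (msec _ (sw n))
    small0' b2.
  under eq_integral do rewrite subrK.
  move=> /le_trans; apply; rewrite lee_fin /K; lra.
have bound : (\int[lebesgue_rV d]_(x in Om) (u0 x ^+ 2)%:E <= (64 * k1 * a)%:E)%E.
  apply/lee_addgt0Pr => e e0; have K1 : 0 < K + 1 by rewrite ltr_wpDl.
  apply: (le_trans (est (e / (K + 1)) _)); first by rewrite divr_gt0.
  rewrite -EFinD lee_fin lerD2l mulrCA ger_pMr// ler_pdivrMr// mul1r lerDl.
  exact: ler01.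
rewrite !normL2E// ubE poweR_EFin -EFinM -powR12_sqrt ?mulr_ge0//.
rewrite -powRM ?mulr_ge0// -poweR_EFin; apply: gt0_ler_poweR => //.
- by rewrite in_itv/= sqint_ge0 leey.
- by rewrite in_itv/= lee_fin leey !mulr_ge0.
Qed.

End Passage.

Lemma essentially_bounded (R : realType) (d : nat) (Om : set 'rV[R]_d) (p : 'rV[R]_d -> R) :
  open Om -> Om !=set0 -> inL (lebesgue_rV d) Om +oo%E p ->
  exists2 M, 0 <= M & {ae lebesgue_rV d, forall x, Om x -> `|p x| <= M}.
Proof.
move=> oOm Om0 [_]; rewrite /normL unlock.
(* The norm of exponent +oo is an essential supremum only when the whole space has positive
   measure. *)
have -> : (0 < lebesgue_rV d [set: 'rV[R]_d])%E.
  rewrite lt_neqAle measure_ge0 andbT; apply/negP => /eqP muT.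
  apply: (open_not_null oOm Om0) => e e0; exists setT; split=> //.
  by rewrite -muT lee_fin ltW.
set s := ess_sup _ _ => sfin.
have s_ge := @ess_sup_ge _ _ _ (lebesgue_rV d) (abse \o (EFin \o (p \_ Om))).
exists (Num.max 0 (fine s)); first by rewrite le_max lexx.
move: s_ge; rewrite -/s; apply: filterS => x /= h Ox.
move: h; rewrite patchE mem_set// => h.
have sf : s \is a fin_num by rewrite ge0_fin_numE// (le_trans _ h)// lee_fin.
by move: h; rewrite -(fineK sf) lee_fin => h; rewrite le_max h orbT.
Qed.

Theorem theorem4p1 (R : realType) (d : nat) (d_gt0 : (0 < d)%N)
    (Om : set 'rV[R]_d) (dom_Om : domain Om) (bnd_Om : bounded_set Om)
    (smooth_Om : smooth_boundary Om)
    (H : 'rV[R]_d -> 'rV[R]_d) (C1_H : C1_closure Om H)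
    (delta0 : R) (delta0_gt0 : 0 < delta0)
    (H_ge : forall x, closure Om x -> delta0 <= enorm (H x)) :
  exists2 T0 : R, 0 < T0 &
  forall (p : 'rV[R]_d -> R), inL (lebesgue_rV d) Om +oo%E p ->
  forall (N : nat) (Omi : 'I_N -> set 'rV[R]_d),
    is_partition Omi Om -> ConditionB H Omi -> ConditionC H Omi ->
  forall T : R, T0 < T ->
  exists2 C : R, 0 < C &
  forall u : 'rV[R]_d * R -> R,
    inH1 (cylinder Om T) u -> transport_equation Om T H p u ->
  forall u0, initial_trace Om T u u0 ->
  forall ub, lateral_trace Om T u ub ->
    (normL (lebesgue_rV d) Om 2%:E u0 <=
       C%:E * normL dSdt (lateral Om T) 2%:E ub)%E.
Proof.
have [open_Om _ Om0] := dom_Om.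
have mOm : measurable Om by exact: open_measurable_rV.
have [F [L [B [L0 B0 F_lip F_bnd FH]]]] :=
  lipschitz_field_extension open_Om bnd_Om smooth_Om C1_H Om0.
have F_cont : continuous F by exact: lipschitz_continuous F_lip.
have [Phi [Phi_sol Phi0 PhiD Phi_time Phi_space]] := flow_exists L0 B0 F_lip F_bnd.
(* The estimate does not mention the partition: any one of them can provide [T0]. *)
have [[N0 [Omi0 [part0 cB0 cC0]]]|none] := pselect (exists N (Omi : 'I_N -> set 'rV[R]_d),
    [/\ is_partition Omi Om, ConditionB H Omi & ConditionC H Omi]); last first.
  (* A placeholder: without an admissible partition there is nothing to prove. *)
  by exists 1 => // p _ N Omi part cB cC; exfalso; apply: none; exists N, Omi.
have [T0 T00 exits] := exit_time d_gt0 open_Om bnd_Om part0 cB0 cC0 B0 L0 F_lip F_bnd FH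
  Phi_sol Phi0 PhiD Phi_time Phi_space.
exists T0 => // p pinf N Omi _ _ _ T T0T.
have T_gt0 : 0 < T by exact: lt_trans T0T.
have [M M0 p_le] := essentially_bounded open_Om Om0 pinf.
have [k k0 energy] := energy_estimate d_gt0 open_Om B0 T00 L0 T0T M0 F_cont Phi_sol Phi0 PhiD
  Phi_time Phi_space exits.
exists (Num.sqrt (64 * k)); first by rewrite sqrtr_gt0 mulr_gt0.
move=> u H1u Pu u0 u0P ub ubP.
exact: (trace_estimate open_Om T_gt0 B0 M0 F_cont F_bnd FH p_le H1u Pu k0 energy u0P ubP).
Qed.
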